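(* Let $0<q<1$ and let $\mu$ be a (nonzero) absolutely continuous measure on $(0,\infty)$, $d\mu(x)=w(x)\,dx$, with density $w\ge0$ satisfying $\int_0^\infty w(x)\,dx<\infty$ and $w(xq)=x\,w(x)$ for all $x>0$. Let $L$ be the operator on $L^2(\mu)$ with domain the compactly supported functions in $L^2(\mu)$, given by $(Lf)(x)=f(xq)-\frac1xf(x)+\frac1xf(x/q)$, and let $(L^*,\mathrm{dom}(L^* ))$ be its adjoint, which is self-adjoint. Put $\Omega=(q,1]\cap\mathrm{supp}(\mu)$ and $\tilde\Omega_l=\{-q^l/t\mid t\in\Omega\}$ for $l\in\mathbb Z$. Then the spectrum of $L^*$ consists of the point spectrum $q^{\mathbb Z_+}=\{q^n\mid n=0,1,2,\dots\}$, each point having infinite multiplicity, and the continuous spectrum $\overline{\bigcup_{l\in\mathbb Z}\tilde\Omega_l}$. In particular, $\sigma(L^* )=(-\infty,0]\cup q^{\mathbb Z_+}$ when $\Omega=(q,1]$.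
   Context: Compactly supported means vanishing outside some $[a,b]$ with $0<a<b<\infty$. The point spectrum is the set of eigenvalues; infinite multiplicity means the eigenspace is infinite-dimensional. The closure is taken in $\mathbb R$. $\mathrm{supp}(\mu)$ is the support of the measure $\mu$. *)

(* Defs.v *)
From HB Require Import structures.
From mathcomp Require Import all_boot all_order all_algebra.
From mathcomp Require Import all_classical all_reals all_analysis.
From mathcomp Require Import complex.

Set Implicit Arguments.
Unset Strict Implicit.
Unset Printing Implicit Defensive.
Import Order.TTheory GRing.Theory Num.Theory.
Import numFieldNormedType.Exports.

Local Open Scope classical_set_scope.
Local Open Scope ring_scope.
Local Open Scope complex_scope.

(* The complex Hilbert space L^2(mu) is handled through representatives:
   functions R -> R[i], with mu-a.e. equality playing the role of equality. *)
Section L2.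
Context {R : realType}.
Variable mu : {measure set (measurableTypeR R) -> \bar R}.
Implicit Types (f g : R -> R[i]) (S : set (R -> R[i])).

Definition eqL2 f g : Prop := {ae mu, forall x, f x = g x}.

Definition normL2 f : \bar R :=
  'N[mu]_2%:E[EFin \o (fun x => Normc.normc (f x))]%E.

Definition L2 : set (R -> R[i]) := [set f |
  [/\ measurable_fun [set: measurableTypeR R] (fun x => complex.Re (f x)),
      measurable_fun [set: measurableTypeR R] (fun x => complex.Im (f x)) &
      (normL2 f < +oo)%E]].

Definition cintegral f : R[i] :=
  Rintegral mu [set: R] (fun x => complex.Re (f x))
    +i* Rintegral mu [set: R] (fun x => complex.Im (f x)).

Definition ipL2 f g : R[i] := cintegral (fun x => f x * (g x)^*).

Definition denseL2 S : Prop :=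
  forall h, L2 h -> forall e : R, 0 < e ->
  exists2 g, S g & (normL2 (fun x => h x - g x)%R < e%:E)%E.

Definition infinite_dimL2 S : Prop :=
  forall n : nat, exists2 f : 'I_n -> R -> R[i],
    (forall i, S (f i)) &
    forall c : 'I_n -> R[i],
      eqL2 (fun x => \sum_(i < n) c i * f i x) (fun=> 0) -> forall i, c i = 0.

(* An unbounded operator is given by its graph: A (f, g) means that the class
   of f is in the domain of A and that A maps it to the class of g. *)
Definition operator := set ((R -> R[i]) * (R -> R[i])).

Definition adjoint (A : operator) : operator := [set gh |
  [/\ L2 gh.1, L2 gh.2 &
      forall f f', A (f, f') -> ipL2 f' gh.1 = ipL2 f gh.2]].

Section spectrum.
Variable A : operator.

Definition op_eigenspace (z : R[i]) : set (R -> R[i]) :=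
  [set f | A (f, fun x => z * f x)].

Definition point_spectrum : set R[i] :=
  [set z | exists2 f, op_eigenspace z f & ~ eqL2 f (fun=> 0)].

Definition range_sub (z : R[i]) : set (R -> R[i]) :=
  [set h | L2 h /\ exists f g, A (f, g) /\ eqL2 h (fun x => g x - z * f x)].

Definition resolvent_set : set R[i] := [set z |
  [/\ forall f g, A (f, g) -> eqL2 (fun x => g x - z * f x) (fun=> 0) ->
        eqL2 f (fun=> 0),
      L2 `<=` range_sub z &
      exists M : R, forall f g, A (f, g) ->
        (normL2 f <= M%:E * normL2 (fun x => g x - z * f x)%R)%E]].

Definition spectrum : set R[i] := ~` resolvent_set.

Definition continuous_spectrum : set R[i] :=
  [set z | [/\ spectrum z, ~ point_spectrum z & denseL2 (range_sub z)]].

End spectrum.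

Definition msupport : set R :=
  [set x | forall U : set R, open U -> U x -> (0 < mu U)%E].

Definition compactly_supported f : Prop :=
  exists a b : R, [/\ 0 < a, a < b &
    {ae mu, forall x, ~ (a <= x <= b) -> f x = 0}].

Definition qdiff (q : R) f : R -> R[i] := fun x =>
  f (x * q) - (x^-1)%:C * f x + (x^-1)%:C * f (x / q).

Definition Lop (q : R) : operator :=
  [set fg | [/\ L2 fg.1, compactly_supported fg.1 & fg.2 = qdiff q fg.1]].

Definition Omega (q : R) : set R := `]q, 1] `&` msupport.

Definition Omega_tilde (q : R) (l : int) : set R :=
  [set - (q ^ l / t) | t in Omega q].

End L2.

(* Main.v *)
Require Import Defs.
From HB Require Import structures.
From mathcomp Require Import all_boot all_order all_algebra.
From mathcomp Require Import all_classical all_reals all_analysis measurable_realfun.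
From mathcomp Require Import complex ring lra zify.

Set Implicit Arguments.
Unset Strict Implicit.
Unset Printing Implicit Defensive.
Import Order.TTheory GRing.Theory Num.Theory.
Import numFieldNormedType.Exports.
Import Normc.

Local Open Scope classical_set_scope.
Local Open Scope ring_scope.
Local Open Scope complex_scope.

(** On almost every orbit [{x q^k}] the operator [L] is a three-term recurrence,
    solved for the eigenvalue parameter [lambda] by [F (lambda x)] and by
    [lambda^k F (1 / (lambda x))] (with [k] the index of [x] in its orbit), where
    [F] is a confluent q-hypergeometric series with parameter [1 / lambda]. The
    first solution is the recessive one at [k = +oo], the second at [k = -oo].
    Their Casoratian is, up to elementary factors, a function [H] with
    [H (z / q) = z H z] ([H_div]), that is, a theta function; it vanishes on an
    orbit only if [- 1 / lambda] lies on it, except when [1 / lambda] is a power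
    [q^-n], where the two solutions are proportional on every orbit. All
    statements about the spectrum are read off from this picture.

    The relation [w (x q) = x w x] says how the measure transforms under
    [x -> x q] ([mu_scale]). It makes [L] symmetric, and testing against bounded
    compactly supported functions shows that the adjoint is the maximal operator
    ([adjointP]); so every question is about solutions of a difference equation
    that are square integrable.

    Resolvent. If [lambda] is neither 0 nor a power of [q] and [- 1 / lambda]
    stays at a positive relative distance from almost all orbits, then [H] is
    bounded below by a theta function ([H_lower]: far out, [F] is compared with
    the infinite product of the [1 + u q^i] through Gauss' formula). The Green
    kernel built from the two solutions then decays faster than any geometric
    sequence along the orbit ([kernel_bound]), and the Green operator is bounded
    ([green_resolvent]). On the set of all [x] with a given relative distance the
    same construction works for every such [lambda]; as these sets exhaust the
    half-line, the range of [L* - lambda] is always dense ([range_dense]).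

    Uniqueness. The Casoratian of a square integrable eigenfunction with each
    model solution scales exactly, while the integrability forces it to decay
    faster; so both vanish, and so does the eigenfunction ([eigen_eq0]).

    Eigenvalues. For [lambda = q^n] the series is a polynomial, hence square
    integrable; multiplying by functions that are constant on orbits gives an
    infinite-dimensional eigenspace ([eigenspace_infinite]).

    Continuous spectrum. For [lambda = - q^l / y] the two model solutions
    coincide on the orbit of [y] ([F_selfdual]), so that [lambda] would be an
    eigenvalue if the orbit had positive measure. Superposing these solutions
    over a small interval around a point of the support gives approximate
    eigenfunctions ([cont_not_resolvent]).

    The point 0. There the growth of solutions does not decide integrability.
    Instead [L f = h] is solved from the left and the solution is cut off far to
    the right; an energy inequality between consecutive shells shows that the boundary term tends
    to 0 ([range0_dense]). Since the range of [L] is dense, the kernel of the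
    adjoint is trivial ([kernel0]). *)

Local Notation tri n := ('C(n.+1, 2)).

(** * Series with geometrically dominated terms *)

(** An upper limit of partial sums, rather than a limit, so that a series of
    measurable functions is measurable without any convergence hypothesis. *)
HB.lock Definition rsum (R : realType) (u : nat -> R) : R :=
  fine (limn_esup (fun n => (\sum_(i < n) u i)%:E)).

Section series.
Context {R : realType}.
Implicit Types (u v : nat -> R) (f g : nat -> R[i]).

Lemma normc_ge0 (z : R[i]) : 0 <= normc z.
Proof. by case: z => a b /=; rewrite sqrtr_ge0. Qed.

Lemma normcB_sym (x y : R[i]) : normc (x - y) = normc (y - x).
Proof. by rewrite -normcN opprB. Qed.

Lemma normc_sqr (z : R[i]) : normc z ^+ 2 = complex.Re z ^+ 2 + complex.Im z ^+ 2.
Proof. by case: z => a b /=; rewrite sqr_sqrtr// addr_ge0 ?sqr_ge0. Qed.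

Lemma Re_le_normc (z : R[i]) : `|complex.Re z| <= normc z.
Proof.
rewrite -(@ler_pXn2r _ 2)// ?nnegrE ?normc_ge0// normc_sqr real_normK ?num_real//.
by rewrite lerDl sqr_ge0.
Qed.

Lemma Im_le_normc (z : R[i]) : `|complex.Im z| <= normc z.
Proof.
rewrite -(@ler_pXn2r _ 2)// ?nnegrE ?normc_ge0// normc_sqr real_normK ?num_real//.
by rewrite lerDr sqr_ge0.
Qed.

Lemma normc_le_ReIm (z : R[i]) : normc z <= `|complex.Re z| + `|complex.Im z|.
Proof.
rewrite -(@ler_pXn2r _ 2)// ?nnegrE ?normc_ge0 ?addr_ge0// normc_sqr sqrrD.
rewrite !real_normK ?num_real// lerD2r lerDl mulrn_wge0 ?mulr_ge0//.
Qed.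

Lemma normc_real (x : R) : normc x%:C = `|x|.
Proof. by rewrite /normc /= expr0n/= addr0 sqrtr_sqr. Qed.

Lemma normc_exp (z : R[i]) n : normc (z ^+ n) = normc z ^+ n.
Proof.
elim: n => [|n IH]; first by rewrite !expr0 normc1.
by rewrite !exprS normcM IH.
Qed.

Lemma normc_sum n f : normc (\sum_(i < n) f i) <= \sum_(i < n) normc (f i).
Proof.
elim: n => [|n IH]; first by rewrite !big_ord0 normc0.
by rewrite !big_ord_recr/=; apply: le_trans (le_normcD _ _) _; rewrite lerD2r.
Qed.

Lemma normc_prod n f : normc (\prod_(i < n) f i) = \prod_(i < n) normc (f i).
Proof.
elim: n => [|n IH]; first by rewrite !big_ord0 normc1.
by rewrite !big_ord_recr/= normcM IH.
Qed.

Lemma normc_triB (x y : R[i]) : normc x - normc y <= normc (x - y).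
Proof. by rewrite lerBlDr; apply: le_trans (le_normcD _ _); rewrite subrK. Qed.

Lemma geo_half_small (K e : R) : 0 < e -> exists n, K * 2^-1 ^+ n < e.
Proof.
move=> e0; have [K0|K0] := leP K 0.
  by exists 0%N; rewrite expr0 mulr1 (le_lt_trans K0).
have h : (fun n => (2^-1 : R) ^+ n) @ \oo --> (0 : R).
  by apply: cvg_expr; rewrite ger0_norm ?invr_ge0// invf_lt1// ltr1n.
have e0' : 0 < e / K by rewrite divr_gt0.
have /cvgrPdist_lt /(_ _ e0') [N _ /(_ N (leqnn N))] := h.
rewrite sub0r normrN ger0_norm; last by rewrite exprn_ge0// invr_ge0.
by rewrite ltr_pdivlMr// => ?; exists N; rewrite mulrC.
Qed.

(** Equalities between sums of series are obtained from this principle applied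
    to partial sums, so that limits never have to be taken explicitly. *)
Lemma le_geo_half (x y K : R) : (forall n, x <= y + K * 2^-1 ^+ n) -> x <= y.
Proof.
move=> h; apply/ler_addgt0Pr => e e0; have [n hn] := geo_half_small K e0.
by apply: le_trans (h n) _; rewrite lerD2l ltW.
Qed.

Definition csum f : R[i] :=
  rsum (fun n => complex.Re (f n)) +i* rsum (fun n => complex.Im (f n)).

Lemma rsum_tail u C n : (forall k, `|u k| <= C * 2^-1 ^+ k) ->
  `|rsum u - \sum_(i < n) u i| <= 2 * C * 2^-1 ^+ n.
Proof.
move=> uC; pose S k := \sum_(i < k) u i.
have dS k m : `|S (k + m)%N - S k| <= 2 * C * 2^-1 ^+ k - 2 * C * 2^-1 ^+ (k + m).
  elim: m => [|m IH]; first by rewrite addn0 !subrr normr0.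
  rewrite addnS /S big_ord_recr/= addrAC; apply: le_trans (ler_normD _ _) _.
  have := lerD IH (uC (k + m)%N); rewrite -/(S _) => /le_trans; apply.
  by rewrite exprS; lra.
have C0 : 0 <= C.
  by have := le_trans (normr_ge0 _) (uC 0%N); rewrite expr0 mulr1.
have dS' k m : `|S (k + m)%N - S k| <= 2 * C * 2^-1 ^+ k.
  apply: le_trans (dS k m) _; rewrite gerBl !mulr_ge0// exprn_ge0// invr_ge0//.
have SE : S = series u by apply/funext => k; rewrite /S /series/= big_mkord.
have cS : cvgn S.
  rewrite SE; apply: normed_cvg; apply: (series_le_cvg (v_ := geometric C 2^-1)).
  - by move=> k; exact: normr_ge0.
  - by move=> k; rewrite geometric_ge0 ?invr_ge0.
  - by move=> k; exact: uC.
  - by apply: is_cvg_geometric_series; rewrite ger0_norm ?invr_ge0// invf_lt1// ltr1n.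
have -> : rsum u = limn S.
  rewrite rsum.unlock -[X in limn_esup X]/(EFin \o S) is_cvg_limn_esupE; last first.
    by apply: (cvgP (limn S)%:E); apply: cvg_EFin => //; exact: nearW.
  by rewrite EFin_lim.
rewrite ler_norml; apply/andP; split.
  rewrite lerBrDr; apply: limr_ge => //; exists n => // m /= nm.
  by have := dS' n (m - n)%N; rewrite subnKC// ler_norml => /andP[+ _]; rewrite lerBrDr.
rewrite lerBlDr; apply: limr_le => //; exists n => // m /= nm.
by have := dS' n (m - n)%N; rewrite subnKC// ler_norml => /andP[_]; rewrite lerBlDr.
Qed.

Lemma rsum_unique u C s : (forall k, `|u k| <= C * 2^-1 ^+ k) ->
  (exists K, forall n, `|s - \sum_(i < n) u i| <= K * 2^-1 ^+ n) -> rsum u = s.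
Proof.
move=> uC [K sK]; apply/eqP; rewrite -subr_eq0 -normr_le0.
apply: (@le_geo_half _ _ (2 * C + K)) => n; rewrite add0r.
have -> : rsum u - s = (rsum u - \sum_(i < n) u i) - (s - \sum_(i < n) u i).
  by rewrite opprB addrA subrK.
apply: le_trans (ler_normB _ _) _; rewrite mulrDl lerD ?rsum_tail//.
Qed.

Lemma rsum_ge_part u C n : (forall k, `|u k| <= C * 2^-1 ^+ k) ->
  (forall k, 0 <= u k) -> \sum_(i < n) u i <= rsum u.
Proof.
move=> uC u0; apply: (@le_geo_half _ _ (2 * C)) => m.
have := rsum_tail (n + m)%N uC; rewrite ler_norml => /andP[h _].
have C0 : 0 <= C by have := le_trans (normr_ge0 _) (uC 0%N); rewrite expr0 mulr1.
have : 2 * C * 2^-1 ^+ (n + m) <= 2 * C * 2^-1 ^+ m.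
  rewrite ler_wpM2l ?mulr_ge0// exprD ler_piMl ?exprn_ge0 ?invr_ge0//.
  by rewrite exprn_ile1 ?invr_ge0// invf_le1// ler1n.
have : \sum_(i < n) u i <= \sum_(i < n + m) u i.
  by rewrite big_split_ord/= lerDl sumr_ge0.
lra.
Qed.

Lemma rsum_le u C B : (forall k, `|u k| <= C * 2^-1 ^+ k) ->
  (forall n, \sum_(i < n) u i <= B) -> rsum u <= B.
Proof.
move=> uC uB; apply: (@le_geo_half _ _ (2 * C)) => m.
have := rsum_tail m uC; rewrite ler_norml => /andP[_]; have := uB m; lra.
Qed.

Lemma rsum_recl u C : (forall k, `|u k| <= C * 2^-1 ^+ k) ->
  rsum u = u 0%N + rsum (fun n => u n.+1).
Proof.
move=> uC; have uC' k : `|u k.+1| <= (C / 2) * 2^-1 ^+ k.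
  by apply: le_trans (uC _) _; rewrite exprS mulrA.
apply: (rsum_unique uC); exists (2 * C) => -[|n].
  rewrite big_ord0 subr0 expr0 mulr1; apply: le_trans (ler_normD _ _) _.
  have := uC 0%N; have := rsum_tail 0 uC'; rewrite big_ord0 subr0 expr0 !mulr1.
  by lra.
rewrite big_ord_recl/= opprD addrACA subrr add0r.
apply: le_trans (rsum_tail n uC') _; rewrite exprS.
lra.
Qed.

(** Domination by a multiple of [2^-n] is the only summability criterion in use:
    all the series below have terms of size [q ^ (n ^ 2 / 2)]. *)
Definition summ f := exists C, forall n, normc (f n) <= C * 2^-1 ^+ n.

Lemma csum_tail f : summ f ->
  exists K, forall n, normc (csum f - \sum_(i < n) f i) <= K * 2^-1 ^+ n.
Proof.
move=> [C fC]; exists (2 * C + 2 * C) => n.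
have rC k : `|complex.Re (f k)| <= C * 2^-1 ^+ k by apply: le_trans (Re_le_normc _) _.
have iC k : `|complex.Im (f k)| <= C * 2^-1 ^+ k by apply: le_trans (Im_le_normc _) _.
apply: le_trans (normc_le_ReIm _) _.
have -> : \sum_(i < n) f i =
    (\sum_(i < n) complex.Re (f i)) +i* (\sum_(i < n) complex.Im (f i)).
  elim: n => [|n IH]; first by rewrite !big_ord0.
  by rewrite !big_ord_recr/= IH; case: (f n).
by rewrite mulrDl lerD//= rsum_tail.
Qed.

Lemma csum_unique f s : summ f ->
  (exists K, forall n, normc (s - \sum_(i < n) f i) <= K * 2^-1 ^+ n) -> csum f = s.
Proof.
move=> /csum_tail[K' fK'] [K sK]; apply/subr0_eq/eq0_normc/le_anti.
rewrite normc_ge0 andbT.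
apply: (@le_geo_half _ _ (K' + K)) => n; rewrite add0r.
have -> : csum f - s = (csum f - \sum_(i < n) f i) - (s - \sum_(i < n) f i).
  by rewrite opprB addrA subrK.
apply: le_trans (le_normcD _ _) _; rewrite normcN mulrDl lerD//.
Qed.

Lemma eq_csum f g : f =1 g -> csum f = csum g.
Proof. by move=> /funext ->. Qed.

Lemma csum_le f B : summ f -> (forall n, \sum_(i < n) normc (f i) <= B) ->
  normc (csum f) <= B.
Proof.
move=> /csum_tail[K fK] fB; apply: (@le_geo_half _ _ K) => n.
rewrite -[csum f](subrK (\sum_(i < n) f i)); apply: le_trans (le_normcD _ _) _.
by rewrite addrC lerD//; apply: le_trans (normc_sum _ _) _.
Qed.

Lemma summZ c f : summ f -> summ (fun n => c * f n).
Proof.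
move=> [C fC]; exists (normc c * C) => n; rewrite normcM -mulrA.
by rewrite ler_wpM2l// normc_ge0.
Qed.

Lemma summD f g : summ f -> summ g -> summ (fun n => f n + g n).
Proof.
move=> [C fC] [D gD]; exists (C + D) => n; apply: le_trans (le_normcD _ _) _.
by rewrite mulrDl lerD.
Qed.

Lemma summS f : summ f -> summ (fun n => f n.+1).
Proof.
by move=> [C fC]; exists (C / 2) => n; apply: le_trans (fC _) _; rewrite exprS mulrA.
Qed.

Lemma csum_recl f : summ f -> csum f = f 0%N + csum (fun n => f n.+1).
Proof.
move=> sf; have [K hK] := csum_tail (summS sf); apply: csum_unique => //.
exists (normc (f 0%N + csum (fun n => f n.+1)) + 2 * K) => -[|n].
  rewrite big_ord0 subr0 expr0 mulr1 lerDl mulr_ge0//.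
  by have := le_trans (normc_ge0 _) (hK 0%N); rewrite expr0 mulr1.
rewrite big_ord_recl/= opprD addrACA subrr add0r.
apply: le_trans (hK n) _; rewrite mulrDl exprS.
rewrite [X in _ <= _ + X](_ : _ = K * 2^-1 ^+ n); last by lra.
by rewrite lerDr !mulr_ge0 ?normc_ge0 ?invr_ge0// exprn_ge0// invr_ge0.
Qed.

Lemma csumZ c f : summ f -> csum (fun n => c * f n) = c * csum f.
Proof.
move=> sf; apply: csum_unique; first exact: summZ.
have [K hK] := csum_tail sf; exists (normc c * K) => n.
by rewrite -mulr_sumr -mulrBr normcM -mulrA ler_wpM2l// normc_ge0.
Qed.

Lemma csumD f g : summ f -> summ g -> csum (fun n => f n + g n) = csum f + csum g.
Proof.
move=> sf sg; apply: csum_unique; first exact: summD.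
have [K hK] := csum_tail sf; have [L hL] := csum_tail sg; exists (K + L) => n.
rewrite big_split/= opprD addrACA mulrDl.
by apply: le_trans (le_normcD _ _) _; apply: lerD; [exact: hK|exact: hL].
Qed.

Lemma finite_summ f N : (forall n, (N <= n)%N -> f n = 0) -> summ f.
Proof.
move=> f0; exists (\sum_(i < N) normc (f i) * 2 ^+ i) => n.
have [Nn|nN] := leqP N n.
  rewrite f0// normc0 mulr_ge0 ?exprn_ge0 ?invr_ge0// sumr_ge0// => i _.
  by rewrite mulr_ge0 ?exprn_ge0 ?normc_ge0.
rewrite exprVn ler_pdivlMr ?exprn_gt0// (bigD1 (Ordinal nN))//= lerDl sumr_ge0//.
by move=> i _; rewrite mulr_ge0 ?exprn_ge0 ?normc_ge0.
Qed.

Lemma csum_finite f N : (forall n, (N <= n)%N -> f n = 0) ->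
  csum f = \sum_(i < N) f i.
Proof.
move=> f0; have pN n : (N <= n)%N -> \sum_(i < n) f i = \sum_(i < N) f i.
  by elim: n => [|n IH]; [rewrite leqn0 => /eqP->|
    rewrite leq_eqVlt => /orP[/eqP->//|Nn]; rewrite big_ord_recr/= f0// addr0 IH].
apply: csum_unique; first exact: finite_summ f0.
have h n : (N <= n)%N -> \sum_(i < N) f i - \sum_(i < n) f i = 0.
  by move=> /pN ->; rewrite subrr.
by have [K hK] := finite_summ h; exists K.
Qed.

End series.

(** * The confluent q-hypergeometric series *)

Definition qpochhammer (R : realType) (q : R) (a : R[i]) n : R[i] :=
  \prod_(i < n) (1 - a * q%:C ^+ i).
Definition qfactorial (R : realType) (q : R) n : R := \prod_(i < n) (1 - q ^+ i.+1).
Definition phi11_coef (R : realType) (q : R) a n : R[i] := qpochhammer q a n / (qfactorial q n)%:C.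

(** [F a z] is the basic hypergeometric series 1phi1(a; 0; q, - q z). With
    [a = 1 / lambda], both [F a (lambda x)] and [lambda ^ k F a (1 / (lambda x))]
    (with [k] the index of [x] in its orbit) solve [L f = lambda f]. *)
Definition Fterm (R : realType) (q : R) (a z : R[i]) n : R[i] :=
  phi11_coef q a n * q%:C ^+ 'C(n.+1, 2) * z ^+ n.
HB.lock Definition phi11 (R : realType) (q : R) (a z : R[i]) : R[i] :=
  csum (Fterm q a z).

Lemma triS n : tri n.+1 = (tri n + n.+1)%N.
Proof. by rewrite binS bin1. Qed.

Section qseries.
Context {R : realType} (q : R).
Hypotheses (q_gt0 : 0 < q) (q_lt1 : q < 1).
Local Notation Q := (q%:C).

Let q_ge0 : 0 <= q. Proof. exact: ltW. Qed.
Let q_neq0 : q != 0. Proof. by rewrite gt_eqF. Qed.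
Let q_le1 : q <= 1. Proof. exact: ltW. Qed.

Lemma qexp_small (e : R) : 0 < e -> exists n, q ^+ n < e.
Proof.
move=> e0; have h : (fun n => q ^+ n) @ \oo --> (0 : R).
  by apply: cvg_expr; rewrite ger0_norm.
have /cvgrPdist_lt /(_ _ e0) [N _ /(_ N (leqnn N))] := h.
by rewrite sub0r normrN ger0_norm ?exprn_ge0// => ?; exists N.
Qed.

Lemma le_qexp m n : (m <= n)%N -> q ^+ n <= q ^+ m.
Proof. by move=> mn; apply: ler_wiXn2l. Qed.

Lemma bounded_of_eventually_noninc (v : nat -> R) N :
  (forall n, (N <= n)%N -> v n.+1 <= v n) -> exists2 C, 0 <= C & forall n, v n <= C.
Proof.
move=> vN; exists (\sum_(i < N.+1) `|v i|); first by rewrite sumr_ge0.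
have small n : (n <= N)%N -> v n <= \sum_(i < N.+1) `|v i|.
  move=> nN; have nN' : (n < N.+1)%N by [].
  rewrite (bigD1 (Ordinal nN'))//=; apply: le_trans (ler_norm _) _.
  by rewrite lerDl sumr_ge0.
elim=> [|n IH]; first exact: small.
have [Nn|nN] := leqP N n; last exact: small.
exact: le_trans (vN _ Nn) IH.
Qed.

(** Super-exponential decay absorbs any geometric growth; it is enough that the
    increments of the exponents grow linearly. *)
Lemma superexp_bound (g : nat -> nat) (K : R) : 0 <= K ->
  (forall n, (g n + n./2 <= g n.+1)%N) ->
  exists2 C, 0 <= C & forall n, q ^+ g n * K ^+ n <= C.
Proof.
move=> K0 gS; have K1 : 0 < K + 1 by rewrite ltr_wpDl.
have [N hN] := @qexp_small (K + 1)^-1 ltac:(by rewrite invr_gt0).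
apply: (@bounded_of_eventually_noninc (fun n => q ^+ g n * K ^+ n) N.*2) => n Nn.
have hq : q ^+ g n.+1 <= q ^+ g n * q ^+ N.
  rewrite -exprD le_qexp//; apply: leq_trans (gS n); rewrite leq_add2l.
  by rewrite -(doubleK N) half_leq.
apply: le_trans (_ : q ^+ g n * q ^+ N * (K * K ^+ n) <= _).
  by rewrite exprS ler_wpM2r// mulr_ge0// exprn_ge0.
rewrite -mulrA ler_wpM2l ?exprn_ge0// mulrA ler_piMl ?exprn_ge0//.
apply: le_trans (_ : (K + 1)^-1 * K <= _); first by rewrite ler_wpM2r// ltW.
by rewrite mulrC ler_pdivrMr// mul1r lerDl.
Qed.

Lemma tri_superexp (K : R) : 0 <= K ->
  exists2 C, 0 <= C & forall n, q ^+ tri n * K ^+ n <= C * 2^-1 ^+ n.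
Proof.
move=> K0; have [||C C0 hC] := @superexp_bound (fun n => tri n) (K * 2).
- by rewrite mulr_ge0.
- by move=> n; rewrite triS leq_add2l; lia.
exists C => // n; rewrite exprVn ler_pdivlMr ?exprn_gt0// -mulrA -exprMn; exact: hC.
Qed.

Lemma prod_le1 n (r : nat -> R) : (forall i, 0 <= r i <= 1) -> \prod_(i < n) r i <= 1.
Proof.
move=> r1; elim: n => [|n IH]; first by rewrite big_ord0.
rewrite big_ord_recr/= mulr_ile1//; first by rewrite prodr_ge0// => i _; case/andP: (r1 i).
all: by case/andP: (r1 n).
Qed.

Lemma geo_sum_le n : \sum_(i < n) q ^+ i <= (1 - q)^-1.
Proof.
have q1 : 0 < 1 - q by rewrite subr_gt0.
rewrite -[leRHS]mul1r ler_pdivlMr// mulrC -[X in X * _]opprB mulNr -subrX1.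
by rewrite opprB gerBl exprn_ge0.
Qed.

Lemma prod_upper (r : nat -> R) K : 0 <= K -> (forall i, 0 <= r i) ->
  (forall i, r i <= 1 + K * q ^+ i) ->
  exists2 C, 1 <= C & forall n, \prod_(i < n) r i <= C.
Proof.
move=> K0 r0 rK; have q1 : 0 < 1 - q by rewrite subr_gt0.
exists (expR (K / (1 - q))) => [|n].
  by rewrite -[leLHS]expR0 ler_expR divr_ge0// ltW.
apply: le_trans (_ : expR (K * \sum_(i < n) q ^+ i) <= _); last first.
  by rewrite ler_expR ler_wpM2l// geo_sum_le.
elim: n => [|n IH]; first by rewrite !big_ord0 mulr0 expR0.
rewrite !big_ord_recr/= mulrDr expRD ler_pM// ?prodr_ge0//.
by apply: le_trans (rK n) _; rewrite expR_ge1Dx.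
Qed.

(** Only finitely many factors can be small; on the others the product is at
    least [1 - sum_i K q^i], which is above 1/2 once enough factors are removed. *)
Lemma prod_lower (r : nat -> R) K : 0 <= K -> (forall i, 0 < r i) ->
  (forall i, 1 - K * q ^+ i <= r i) ->
  exists2 c, 0 < c & forall n, c <= \prod_(i < n) r i.
Proof.
move=> K0 r0 rK; have q1 : 0 < 1 - q by rewrite subr_gt0.
have [N hN] := @qexp_small ((1 - q) / (2 * (K + 1)))
  ltac:(by rewrite divr_gt0// mulr_gt0// ltr_wpDl).
have KN : K * (q ^+ N / (1 - q)) <= 2^-1.
  rewrite mulrA ler_pdivrMr//; apply: le_trans (_ : (K + 1) * q ^+ N <= _).
    by rewrite ler_wpM2r ?exprn_ge0// lerDl.
  apply: le_trans (_ : (K + 1) * ((1 - q) / (2 * (K + 1))) <= _).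
    by rewrite ler_wpM2l ?addr_ge0// ltW.
  by rewrite le_eqVlt; apply/orP; left; apply/eqP; field; lra.
(* from index N on, 1 - sum K q^i stays above 1/2 *)
have tail m : 1 - K * (q ^+ N * \sum_(i < m) q ^+ i) <= \prod_(i < m) r (N + i)%N
           /\ 0 <= 1 - K * (q ^+ N * \sum_(i < m) q ^+ i).
  have pos k : 2^-1 <= 1 - K * (q ^+ N * \sum_(i < k) q ^+ i).
    rewrite lerBrDl -lerBrDr; apply: le_trans (_ : K * (q ^+ N / (1 - q)) <= _).
      by rewrite ler_wpM2l// ler_wpM2l ?exprn_ge0// geo_sum_le.
    by apply: le_trans KN _; lra.
  split; last by apply: le_trans (pos m); rewrite invr_ge0.
  elim: m => [|m IH]; first by rewrite !big_ord0 !mulr0 subr0.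
  rewrite !big_ord_recr/=.
  set S := \sum_(i < m) _ in IH pos *.
  apply: le_trans (_ : (1 - K * (q ^+ N * S)) * r (N + m)%N <= _); last first.
    by rewrite ler_wpM2r// ltW.
  have x0 : 0 <= 1 - K * (q ^+ N * S) by apply: le_trans (pos m); rewrite invr_ge0.
  have := ler_wpM2l x0 (rK (N + m)%N); rewrite exprD; apply: le_trans.
  have : 0 <= K * (q ^+ N * S) * (K * (q ^+ N * q ^+ m)).
    by rewrite !mulr_ge0 ?exprn_ge0// sumr_ge0// => i _; rewrite exprn_ge0.
  lra.
have tail2 m : 2^-1 <= \prod_(i < m) r (N + i)%N.
  have [+ _] := tail m; apply: le_trans; rewrite lerBrDl -lerBrDr.
  apply: le_trans (_ : K * (q ^+ N / (1 - q)) <= _).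
    by rewrite ler_wpM2l// ler_wpM2l ?exprn_ge0// geo_sum_le.
  by apply: le_trans KN _; lra.
pose c := \prod_(i < N) Num.min 1 (r i).
have c0 : 0 < c by rewrite prodr_gt0// => i _; rewrite lt_min ltr01 r0.
exists (c / 2) => [|n]; first by rewrite divr_gt0.
have head k : c <= \prod_(i < k) r i \/ (N < k)%N.
  have [kN|] := leqP k N; [left|by right].
  rewrite /c -(subnKC kN) big_split_ord/=.
  rewrite -[leRHS]mulr1 ler_pM ?prodr_ge0// => [i _|i _||].
  - by rewrite le_min ler01 ltW.
  - by rewrite le_min ler01 ltW.
  - by apply: ler_prod => i _; rewrite le_min ler01 ltW//= ge_min lexx orbT.
  - apply: (@prod_le1 _ (fun i => Num.min 1 (r (k + i)%N))) => i.
    by rewrite le_min ler01 ltW//= ge_min lexx.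
have [nN|Nn] := leqP n N.
  have [h|] := head n; last by rewrite ltnNge nN.
  by apply: le_trans h; rewrite ler_pdivrMr// ler_pMr// ler1n.
have [h|] := head N; last by rewrite ltnn.
rewrite -(subnKC (ltnW Nn)) big_split_ord/=.
by apply: ler_pM; [exact: ltW|rewrite invr_ge0|exact: h|exact: tail2].
Qed.

Local Notation qpoch := (qpochhammer q).
Local Notation qfac := (qfactorial q).
Local Notation acoef := (phi11_coef q).

Lemma qexp_lt1 n : q ^+ n.+1 < 1.
Proof. by rewrite exprn_ilt1. Qed.

Lemma qfac_gt0 n : 0 < qfac n.
Proof. by rewrite prodr_gt0// => i _; rewrite subr_gt0 qexp_lt1. Qed.

Lemma qfacS n : qfac n.+1 = qfac n * (1 - q ^+ n.+1).
Proof. by rewrite /qfac big_ord_recr. Qed.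

Lemma qpochS a n : qpoch a n.+1 = qpoch a n * (1 - a * Q ^+ n).
Proof. by rewrite /qpoch big_ord_recr. Qed.

Lemma qfac_lower : exists2 c, 0 < c & forall n, c <= qfac n.
Proof.
apply: (@prod_lower (fun i => 1 - q ^+ i.+1) 1) => // i.
  by rewrite subr_gt0 qexp_lt1.
by rewrite mul1r lerD2l lerN2 le_qexp.
Qed.

Lemma normcQ n : normc (Q ^+ n) = q ^+ n.
Proof. by rewrite normc_exp normc_real ger0_norm. Qed.

Lemma QE n : Q ^+ n = (q ^+ n)%:C.
Proof. by rewrite rmorphXn. Qed.

Lemma qpoch_upper A : 0 <= A ->
  exists2 C, 1 <= C & forall a n, normc a <= A -> normc (qpoch a n) <= C.
Proof.
move=> A0; have [||C C1 hC] := @prod_upper (fun i => 1 + A * q ^+ i) A A0.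
- by move=> i; rewrite addr_ge0// mulr_ge0// exprn_ge0.
- by [].
exists C => // a n aA; rewrite (normc_prod n (fun i => 1 - a * Q ^+ i)); apply: le_trans (hC n).
apply: ler_prod => i _; rewrite normc_ge0/=; apply: le_trans (le_normcD _ _) _.
by rewrite normc1 normcN normcM normcQ lerD2l ler_wpM2r// exprn_ge0.
Qed.

Lemma acoef_upper A : 0 <= A ->
  exists2 C, 1 <= C & forall a n, normc a <= A -> normc (acoef a n) <= C.
Proof.
move=> A0; have [C C1 hC] := qpoch_upper A0; have [c c0 hc] := qfac_lower.
have c1 : c <= 1 by have := hc 0%N; rewrite /qfac big_ord0.
exists (C / c) => [|a n aA].
  by rewrite ler_pdivlMr// mul1r (le_trans c1).
rewrite /acoef normcM normcV normc_real gtr0_norm ?qfac_gt0//.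
rewrite ler_pM ?normc_ge0 ?hC// ?invr_ge0 ?lef_pV2 ?posrE ?qfac_gt0// ltW// qfac_gt0//.
Qed.

Lemma acoef0 a : acoef a 0 = 1.
Proof. by rewrite /acoef /qpoch /qfac !big_ord0 divr1. Qed.

Lemma acoefS a n :
  acoef a n.+1 * (1 - Q ^+ n.+1) = acoef a n * (1 - a * Q ^+ n).
Proof.
have h1 : 1 - Q ^+ n.+1 != 0.
  by rewrite QE subr_eq0 (inj_eq (@complexI R) 1) eq_sym lt_eqF ?qexp_lt1.
have h2 : (qfac n)%:C != 0 :> R[i] by rewrite (inj_eq (@complexI R) _ 0) gt_eqF ?qfac_gt0.
rewrite /acoef qpochS qfacS rmorphM rmorphB rmorph1/= -QE.
by field; apply/andP.
Qed.

(** The majorants: a partial theta series, and the two-sided theta series that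
    also covers arguments near 0. *)
Definition ptheta (s : R) : R := rsum (fun n => q ^+ tri n * s ^+ n).
Definition theta (s : R) : R := ptheta s + ptheta s^-1 / s.

Lemma ptheta_summ s : 0 <= s ->
  exists C, forall k, `|q ^+ tri k * s ^+ k| <= C * 2^-1 ^+ k.
Proof.
move=> s0; have [C _ hC] := tri_superexp s0; exists C => k.
by rewrite ger0_norm ?mulr_ge0 ?exprn_ge0.
Qed.

Lemma ptheta_ge s n : 0 <= s -> q ^+ tri n * s ^+ n <= ptheta s.
Proof.
move=> s0; have [C hC] := ptheta_summ s0.
have p0 k : 0 <= q ^+ tri k * s ^+ k by rewrite mulr_ge0 ?exprn_ge0.
apply: le_trans (rsum_ge_part n.+1 hC p0).
by rewrite big_ord_recr/= lerDr sumr_ge0.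
Qed.

Lemma ptheta_ge1 s : 0 <= s -> 1 <= ptheta s.
Proof. by move=> /(ptheta_ge 0); rewrite bin_small// !expr0 mulr1. Qed.

Lemma ptheta_part s n : 0 <= s -> \sum_(i < n) q ^+ tri i * s ^+ i <= ptheta s.
Proof.
move=> s0; have [C hC] := ptheta_summ s0; apply: (rsum_ge_part n hC) => k.
by rewrite mulr_ge0 ?exprn_ge0.
Qed.

Lemma le_ptheta s t : 0 <= s -> s <= t -> ptheta s <= ptheta t.
Proof.
move=> s0 st; have t0 := le_trans s0 st; have [C hC] := ptheta_summ s0.
apply: (rsum_le hC) => n; apply: le_trans (ptheta_part n t0).
by apply: ler_sum => i _; rewrite ler_wpM2l ?exprn_ge0// lerXn2r.
Qed.

Lemma ptheta_div s : 0 <= s -> ptheta (s / q) = 1 + s * ptheta s.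
Proof.
move=> s0; have sq0 : 0 <= s / q by rewrite divr_ge0.
have [C hC] := ptheta_summ sq0; have [D hD] := ptheta_summ s0.
rewrite /ptheta (rsum_recl hC) bin_small// !expr0 mulr1; congr (_ + _).
apply: (@rsum_unique _ _ (C / 2)) => [k|].
  by rewrite -mulrA -exprS; exact: hC.
exists (s * (2 * D)) => n.
have -> : \sum_(i < n) q ^+ tri i.+1 * (s / q) ^+ i.+1 =
    s * \sum_(i < n) q ^+ tri i * s ^+ i.
  rewrite mulr_sumr; apply: eq_bigr => i _.
  rewrite triS exprD expr_div_n [s ^+ i.+1]exprS.
  have : q ^+ i.+1 != 0 by rewrite expf_neq0.
  by move: (q ^+ i.+1) (q ^+ tri i) (s ^+ i) => x y z x0; field.
rewrite -mulrBr normrM ger0_norm// -!mulrA ler_wpM2l// mulrA.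
exact: rsum_tail.
Qed.

Lemma theta_div s : 0 < s -> theta (s / q) = s * theta s.
Proof.
move=> s0; rewrite /theta ptheta_div ?ltW// invfM invrK mulrDr.
have := @ptheta_div (s^-1 * q) ltac:(by rewrite mulr_ge0 ?invr_ge0// ltW).
rewrite mulfK// => ->; field; rewrite gt_eqF//.
Qed.

(** The quasi-periodicity [theta (s / q) = s theta s], iterated: moving along
    the orbit costs the same weight as for the measure. *)
Lemma theta_mulqX s d : 0 < s -> theta (s * q ^+ d) * (s ^+ d * q ^+ tri d) = theta s.
Proof.
move=> s0; elim: d => [|d IH].
  by rewrite bin_small// !expr0 !mulr1.
have sd0 : 0 < s * q ^+ d.+1 by rewrite mulr_gt0 ?exprn_gt0.
have := theta_div sd0; rewrite exprSr mulrA mulfK// => h.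
rewrite -IH h triS exprD [s ^+ d.+1]exprS [q ^+ d.+1]exprS.
by move: (q ^+ d) (q ^+ tri d) (s ^+ d) => y z t; ring.
Qed.

Lemma theta_gt0 s : 0 < s -> 0 < theta s.
Proof.
move=> s0; have := @ptheta_ge1 s (ltW s0).
have := @ptheta_ge1 s^-1 ltac:(by rewrite invr_ge0 ltW).
by move=> h1 h2; rewrite addr_gt0 ?divr_gt0// (lt_le_trans ltr01).
Qed.

Lemma ptheta_le_theta s : 0 < s -> ptheta s <= theta s.
Proof.
move=> s0; rewrite lerDl divr_ge0 ?ltW// (lt_le_trans ltr01)// ptheta_ge1//.
by rewrite invr_ge0 ltW.
Qed.

Lemma thetaV s : 0 < s -> theta s^-1 = s * theta s.
Proof.
by move=> s0; rewrite /theta invrK mulrDr; field; rewrite gt_eqF.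
Qed.

Lemma theta_ge s n : 0 < s -> q ^+ tri n * s ^+ n <= theta s.
Proof. by move=> s0; apply: le_trans (ptheta_le_theta s0); apply: ptheta_ge; exact: ltW. Qed.

Local Notation F := (phi11 q).
Local Notation Fterm := (Fterm q).

Lemma FE a z : F a z = csum (Fterm a z).
Proof. by rewrite phi11.unlock. Qed.

Lemma Fterm_le A : 0 <= A -> exists2 C, 1 <= C & forall a z n, normc a <= A ->
  normc (Fterm a z n) <= C * (q ^+ tri n * normc z ^+ n).
Proof.
move=> A0; have [C C1 hC] := acoef_upper A0; exists C => // a z n aA.
rewrite /Fterm [normc _]normcM [normc (_ * Q ^+ _)]normcM normcQ normc_exp -mulrA.
by rewrite ler_wpM2r ?mulr_ge0 ?exprn_ge0 ?normc_ge0 ?hC.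
Qed.

Lemma Fterm_summ a z : summ (Fterm a z).
Proof.
have [C C1 hC] := Fterm_le (normc_ge0 a).
have [D D0 hD] := tri_superexp (normc_ge0 z).
exists (C * D) => n; apply: le_trans (hC _ _ _ (lexx _)) _.
by rewrite -mulrA ler_wpM2l// (le_trans ler01).
Qed.

Lemma F_le A : 0 <= A -> exists2 C, 1 <= C & forall a z, normc a <= A ->
  normc (F a z) <= C * ptheta (normc z).
Proof.
move=> A0; have [C C1 hC] := Fterm_le A0; exists C => // a z aA.
rewrite FE; apply: csum_le; first exact: Fterm_summ.
move=> n; apply: le_trans (_ : C * \sum_(i < n) q ^+ tri i * normc z ^+ i <= _).
  by rewrite mulr_sumr; apply: ler_sum => i _; exact: hC.
by rewrite ler_wpM2l ?(le_trans ler01)// ptheta_part// normc_ge0.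
Qed.

Lemma F_near0 A : 0 <= A -> exists2 C, 0 <= C & forall a z, normc a <= A ->
  normc z <= 1 -> normc (F a z - 1) <= C * normc z.
Proof.
move=> A0; have [C C1 hC] := Fterm_le A0.
have C0 : 0 <= C by rewrite (le_trans ler01).
exists (C * ptheta 1); first by rewrite mulr_ge0// (le_trans ler01)// ptheta_ge1.
move=> a z aA z1; rewrite FE (csum_recl (Fterm_summ a z)).
rewrite /Fterm acoef0 bin_small// !expr0 !mulr1 addrC addKr.
apply: csum_le; first exact: (summS (Fterm_summ a z)).
move=> n; apply: le_trans (_ : C * normc z * \sum_(i < n) q ^+ tri i * 1 ^+ i <= _).
  rewrite mulr_sumr; apply: ler_sum => i _; apply: le_trans (hC a z i.+1 aA) _.
  rewrite -mulrA ler_wpM2l// exprS expr1n mulr1 triS exprD.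
  rewrite mulrCA ler_wpM2l ?normc_ge0// -mulrA ler_piMr ?exprn_ge0//.
  by rewrite mulr_ile1 ?exprn_ge0 ?normc_ge0 ?exprn_ile1 ?normc_ge0// exprn_ile1.
rewrite mulrAC ler_wpM2r ?normc_ge0// ler_wpM2l//.
exact: ptheta_part.
Qed.

Lemma Q_neq0 : Q != 0.
Proof. by rewrite (inj_eq (@complexI R) _ 0). Qed.

(** The eigenvalue equation of [L] in disguise (with [z = lambda x] and
    [a = 1 / lambda]); it is the recurrence of the coefficients. *)
Lemma F_eq a z : F a (z / Q) = (1 + z) * F a z - a * z * F a (Q * z).
Proof.
have s0 := Fterm_summ a (z / Q); have s1 := Fterm_summ a z.
have s2 := Fterm_summ a (Q * z).
suff H : F a (z / Q) - F a z = z * (F a z - a * F a (Q * z)).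
  rewrite -[LHS](subrK (F a z)) H.
  by move: (F a z) (F a (Q * z)) => x y; ring.
pose u n := Fterm a (z / Q) n + -1 * Fterm a z n.
pose v n := Fterm a z n + - a * Fterm a (Q * z) n.
have su : summ u by exact: summD s0 (summZ _ s1).
have sv : summ v by exact: summD s1 (summZ _ s2).
have -> : F a (z / Q) - F a z = csum u.
  by rewrite !FE /u (csumD s0 (summZ _ s1)) (csumZ _ s1) mulN1r.
have -> : F a z - a * F a (Q * z) = csum v.
  by rewrite !FE /v (csumD s1 (summZ _ s2)) (csumZ _ s2) mulNr.
rewrite -(csumZ z sv) (csum_recl su) /u /v.
rewrite {1 2}/Fterm acoef0 bin_small// !expr0 !mulr1 subrr add0r.
apply: eq_csum => n; rewrite /Fterm triS exprD !exprMn exprVn.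
have := acoefS a n; rewrite !exprS.
have : Q ^+ n != 0 by rewrite expf_neq0// Q_neq0.
have := Q_neq0.
move: (acoef a n.+1) (acoef a n) (Q ^+ n) (Q ^+ tri n) (z ^+ n) => x y p t s Q0 p0 h.
transitivity (z * s * t * (x * (1 - Q * p))); first by field; apply/andP.
by rewrite h; ring.
Qed.

End qseries.

(** * The Casoratian of the two model solutions *)

(** The Casoratian of the solutions [F a (lambda x)] and
    [lambda^k F a (1 / (lambda x))], with [z = lambda x] and the power of
    [lambda] removed. *)
HB.lock Definition casoratian (R : realType) (q : R) (a z : R[i]) : R[i] :=
  phi11 q a z * phi11 q a (z^-1 / q%:C) - a * phi11 q a (q%:C * z) * phi11 q a z^-1.

Section casoratian.
Context {R : realType} (q : R).
Hypotheses (q_gt0 : 0 < q) (q_lt1 : q < 1).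
Local Notation Q := (q%:C).
Local Notation F := (phi11 q).
Local Notation H := (casoratian q).
Local Notation qpoch := (qpochhammer q).
Local Notation qfac := (qfactorial q).
Local Notation acoef := (phi11_coef q).
Local Notation ptheta := (ptheta q).
Local Notation theta := (theta q).

Let q_ge0 : 0 <= q. Proof. exact: ltW. Qed.
Let q_neq0 : q != 0. Proof. by rewrite gt_eqF. Qed.
Let q_le1 : q <= 1. Proof. exact: ltW. Qed.
Let Qn0 : Q != 0. Proof. exact: Q_neq0. Qed.

(** The Casoratian of two solutions of a three-term recurrence satisfies a
    one-term recurrence. *)
Lemma H_div a z : z != 0 -> H a (z / Q) = z * H a z.
Proof.
move=> z0; rewrite casoratian.unlock.
have -> : Q * (z / Q) = z by rewrite mulrCA divff// mulr1.
have -> : (z / Q)^-1 / Q = z^-1 by rewrite invfM invrK -mulrA divff// mulr1.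
have -> : (z / Q)^-1 = Q * z^-1 by rewrite invfM invrK mulrC.
rewrite (F_eq q_gt0 q_lt1 a z) (F_eq q_gt0 q_lt1 a z^-1).
move: (F a z) (F a z^-1) (F a (Q * z)) (F a (Q * z^-1)) => x y u v.
by field.
Qed.

Lemma H_mulQX a z d : z != 0 -> H a (z * Q ^+ d) * (z ^+ d * Q ^+ tri d) = H a z.
Proof.
move=> z0; elim: d => [|d IH]; first by rewrite bin_small// !expr0 !mulr1.
have zd0 : z * Q ^+ d.+1 != 0 by rewrite mulf_neq0// expf_neq0.
have := H_div a zd0; rewrite exprSr mulrA mulfK// => h.
rewrite -IH h triS exprD [z ^+ d.+1]exprS [Q ^+ d.+1]exprS.
move: (Q ^+ d) (Q ^+ tri d) (z ^+ d) => y s t; ring.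
Qed.

(** ** Gaussian binomials and Gauss' product formula *)
(** The Gaussian binomials, by Pascal's rule; defined in this way they are
    visibly nonnegative. *)
Fixpoint qb (N n : nat) : R :=
  match N, n with
  | _, 0 => 1
  | 0, _.+1 => 0
  | N'.+1, n'.+1 => qb N' n + q ^+ (N' - n') * qb N' n'
  end.

Lemma qb0 N : qb N 0 = 1. Proof. by case: N. Qed.

Lemma qb_small N n : (N < n)%N -> qb N n = 0.
Proof.
elim: N n => [|N IH] [|n]//= Nn; rewrite !IH ?mulr0 ?addr0//.
exact: ltnW.
Qed.

Lemma qb_ge0 N n : 0 <= qb N n.
Proof.
elim: N n => [|N IH] [|n]/=; rewrite ?ler01 ?lexx//.
by rewrite addr_ge0// mulr_ge0// exprn_ge0.
Qed.

Lemma qb_ge1 N n : (n <= N)%N -> 1 <= qb N n.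
Proof.
elim: N n => [|N IH] [|n]//= nN.
have [nN'|Nn] := ltnP n N.
  by apply: le_trans (IH _ nN') _; rewrite lerDl mulr_ge0 ?exprn_ge0 ?qb_ge0.
have -> : n = N by apply/eqP; rewrite eqn_leq Nn andbT.
by rewrite qb_small// add0r subnn expr0 mul1r IH.
Qed.

Lemma qb_qfac N n : (n <= N)%N -> qb N n * qfac n * qfac (N - n) = qfac N.
Proof.
elim: N n => [|N IH] [|n] nN //=; rewrite ?subn0.
- by rewrite /qfactorial !big_ord0 !mulr1.
- by rewrite /qfactorial !big_ord0 !mulr1 mul1r.
have h2 := IH n nN; rewrite subSS.
have [nN'|Nn] := ltnP n N.
  have h1 := IH _ nN'; rewrite [in RHS]qfacS.
  have e : (N - n)%N = (N - n.+1).+1 by rewrite subnSK.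
  rewrite mulrDl mulrDl [X in X + _](_ : _ = qfac N * (1 - q ^+ (N - n))); last first.
    have -> : qfac (N - n) = qfac (N - n.+1) * (1 - q ^+ (N - n)).
      by rewrite [in LHS]e [LHS]qfacS -e.
    by rewrite -h1; ring.
  rewrite [X in _ + X](_ : _ = qfac N * (q ^+ (N - n) * (1 - q ^+ n.+1))); last first.
    by rewrite -h2 qfacS; ring.
  rewrite [q ^+ N.+1](_ : _ = q ^+ (N - n) * q ^+ n.+1); first by ring.
  by rewrite -exprD; congr (_ ^+ _); lia.
have -> : n = N by apply/eqP; rewrite eqn_leq Nn andbT.
rewrite qb_small// add0r subnn expr0 mul1r.
rewrite !qfacS -{2}(IH N (leqnn N)) subnn; ring.
Qed.

Lemma gauss_prod (u : R[i]) N :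
  \prod_(i < N) (1 + u * Q ^+ i) = \sum_(n < N.+1) (qb N n)%:C * Q ^+ 'C(n, 2) * u ^+ n.
Proof.
elim: N => [|N IH]; first by rewrite big_ord0 big_ord1/= bin0n !expr0 !mulr1.
rewrite big_ord_recr/= IH.
set S := (X in X * _); rewrite big_ord_recl/= bin0n !expr0 !mulr1.
under [in RHS]eq_bigr => n _ do rewrite rmorphD/= !mulrDl.
rewrite big_split/= addrA.
have -> : 1%:C + \sum_(n < N.+1) (qb N n.+1)%:C * Q ^+ 'C(n.+1, 2) * u ^+ n.+1 =
    \sum_(n < N.+1) (qb N n)%:C * Q ^+ 'C(n, 2) * u ^+ n.
  rewrite big_ord_recr/= qb_small// rmorph0 !mul0r addr0.
  by rewrite [RHS]big_ord_recl/= qb0 !expr0 !mulr1.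
rewrite -/S mulrDr mulr1; congr (_ + _); rewrite mulr_suml; apply: eq_bigr => n _.
rewrite /bump/= add0n add1n.
rewrite rmorphM/= binS bin1 -QE exprS.
have -> : Q ^+ N = Q ^+ (N - n) * Q ^+ n by rewrite -exprD subnK// -ltnS.
by rewrite exprD; ring.
Qed.

(** ** Comparison of [F] with a product for large arguments *)
Lemma qpoch_cauchy (a : R[i]) : exists2 K, 0 <= K &
  forall n m, (n <= m)%N -> normc (qpoch a n - qpoch a m) <= K * q ^+ n.
Proof.
have q1 : 0 < 1 - q by rewrite subr_gt0.
have [C C1 hC] := qpoch_upper q_gt0 q_lt1 (normc_ge0 a).
have C0 : 0 <= C by rewrite (le_trans ler01).
exists (C * normc a / (1 - q)) => [|n m].
  by rewrite divr_ge0 ?mulr_ge0 ?normc_ge0// ltW.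
have step k : normc (qpoch a n - qpoch a (n + k)) <=
    C * normc a * q ^+ n * \sum_(i < k) q ^+ i.
  elim: k => [|k IH]; first by rewrite addn0 subrr normc0 big_ord0 mulr0.
  rewrite addnS qpochS mulrBr mulr1 opprB addrCA addrC big_ord_recr/= mulrDr.
  apply: le_trans (le_normcD _ _) _; rewrite lerD//.
  rewrite !normcM normcQ// exprD.
  rewrite [leRHS](_ : _ = C * (normc a * (q ^+ n * q ^+ k))); last by ring.
  by rewrite ler_wpM2r ?hC// !mulr_ge0 ?normc_ge0 ?exprn_ge0.
move=> nm; rewrite -(subnKC nm); apply: le_trans (step _) _.
rewrite [leRHS](_ : _ = C * normc a * q ^+ n * (1 - q)^-1); last by ring.
by rewrite ler_wpM2l ?geo_sum_le// !mulr_ge0 ?normc_ge0 ?exprn_ge0.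
Qed.

Lemma qpochQ n : qpoch Q n = (qfac n)%:C.
Proof.
rewrite /qpochhammer /qfactorial rmorph_prod; apply: eq_bigr => i _.
by rewrite -exprS rmorphB rmorph1/= rmorphXn.
Qed.

(** The coefficients of [F] are close to [(a; q)_oo] times those of the infinite
    product; the error [q^n] becomes a factor [q] in the argument, and the
    second error disappears as [N] grows. *)
Lemma coef_compare a : exists2 K, 0 <= K & forall N n,
  normc (acoef a n - qpoch a N * (qb N n)%:C) <= K * (q ^+ n + q ^+ N / q ^+ n).
Proof.
have [K1 K10 hK1] := qpoch_cauchy a; have [K2 K20 hK2] := qpoch_cauchy Q.
have [c c0 hc] := qfac_lower q_gt0 q_lt1.
have [C C1 hC] := qpoch_upper q_gt0 q_lt1 (normc_ge0 a).
have [D D1 hD] := acoef_upper q_gt0 q_lt1 (normc_ge0 a).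
have C0 : 0 <= C by rewrite (le_trans ler01).
have D0 : 0 <= D by rewrite (le_trans ler01).
have hqf n : (qfac n)%:C != 0 :> R[i].
  by rewrite (inj_eq (@complexI R) _ 0) gt_eqF// qfac_gt0.
have cV n : normc ((qfac n)%:C^-1) <= c^-1.
  rewrite normcV normc_real gtr0_norm ?qfac_gt0// lef_pV2 ?posrE ?qfac_gt0//.
have c0' : 0 <= c^-1 by rewrite invr_ge0 ltW.
exists (K1 / c + C * K2 / c / c + D) => [|N n].
  by rewrite !addr_ge0 ?mulr_ge0.
have p1 : 0 <= q ^+ n by rewrite exprn_ge0.
have p2 : 0 <= q ^+ N / q ^+ n by rewrite divr_ge0 ?exprn_ge0.
have [nN|Nn] := leqP n N; last first.
  rewrite qb_small// mulr0 subr0; apply: le_trans (hD _ n (lexx _)) _.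
  apply: le_trans (_ : D * (q ^+ n + q ^+ N / q ^+ n) <= _).
    rewrite ler_peMr//; apply: le_trans (_ : q ^+ N / q ^+ n <= _).
      by rewrite ler_pdivlMr ?exprn_gt0// mul1r le_qexp// ltnW.
    by rewrite lerDr.
  by rewrite ler_wpM2r ?addr_ge0// lerDr addr_ge0 ?mulr_ge0.
have e : acoef a n - qpoch a N * (qb N n)%:C =
   (qpoch a n - qpoch a N) * (qfac n)%:C^-1 +
   qpoch a N * ((qpoch Q (N - n) - qpoch Q N) * (qfac (N - n))%:C^-1 * (qfac n)%:C^-1).
  rewrite !qpochQ /phi11_coef -[qfac N in RHS](qb_qfac nN) !rmorphM/=.
  by have := hqf n; have := hqf (N - n)%N => h1 h2; field; apply/andP.
rewrite e; apply: le_trans (le_normcD _ _) _; rewrite !normcM.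
have e1 : normc (qpoch a n - qpoch a N) * normc (qfac n)%:C^-1 <= K1 / c * q ^+ n.
  rewrite mulrAC; apply: ler_pM; rewrite ?normc_ge0//; exact: hK1.
have qq : q ^+ (N - n) = q ^+ N / q ^+ n.
  by rewrite -[N in RHS](subnK nN) exprD mulfK ?expf_neq0.
have e2 : normc (qpoch a N) * (normc (qpoch Q (N - n) - qpoch Q N) *
    normc (qfac (N - n))%:C^-1 * normc (qfac n)%:C^-1) <=
    C * K2 / c / c * (q ^+ N / q ^+ n).
  rewrite [leRHS](_ : _ = C * (K2 * (q ^+ N / q ^+ n) / c / c)); last by ring.
  apply: ler_pM; rewrite ?mulr_ge0 ?normc_ge0 ?hC//.
  apply: ler_pM; rewrite ?mulr_ge0 ?normc_ge0//.
  apply: ler_pM; rewrite ?mulr_ge0 ?normc_ge0//.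
  by rewrite -qq; apply: hK2; exact: leq_subr.
apply: le_trans (lerD e1 e2) _.
set x := q ^+ n in p1 *; set y := q ^+ N / _ in p2 *.
have : 0 <= K1 / c by rewrite mulr_ge0.
have : 0 <= C * K2 / c / c by rewrite !mulr_ge0.
move: (K1 / c) (C * K2 / c / c) => u v v0 u0; nra.
Qed.

(** For large [u] the product is of size [theta u], larger than [ptheta u] by a
    factor [u], so the right-hand side is an error term. *)
Lemma F_prod_compare a : exists2 K, 0 <= K & forall u N,
  normc (F a (u / Q) - qpoch a N * \prod_(i < N) (1 + u * Q ^+ i)) <=
  K * (ptheta (normc u) + q ^+ N * ptheta (normc u / q ^+ 2)).
Proof.
have [K K0 hK] := coef_compare a; exists K => // u N.
pose f n := qpoch a N * ((qb N n)%:C * Q ^+ 'C(n, 2) * u ^+ n).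
have fN n : (N.+1 <= n)%N -> f n = 0 by move=> Nn; rewrite /f qb_small// !mul0r mulr0.
have sf : summ f.
  apply: (finite_summ fN).
have s0 := Fterm_summ q_gt0 q_lt1 a (u / Q).
rewrite gauss_prod mulr_sumr -(csum_finite fN) FE -mulN1r -(csumZ _ sf) -(csumD s0 (summZ _ sf)).
apply: csum_le; first exact: summD s0 (summZ _ sf).
move=> n.
have u0 := normc_ge0 u.
have u2 : 0 <= normc u / q ^+ 2 by rewrite divr_ge0// exprn_ge0.
apply: le_trans (_ : \sum_(i < n) K * (q ^+ tri i * normc u ^+ i +
    q ^+ N * (q ^+ tri i * (normc u / q ^+ 2) ^+ i)) <= _); last first.
  rewrite -mulr_sumr ler_wpM2l// big_split/= -mulr_sumr lerD ?ptheta_part//.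
  by rewrite ler_wpM2l ?exprn_ge0// ptheta_part.
apply: ler_sum => i _.
have -> : Fterm q a (u / Q) i + -1 * f i =
    (acoef a i - qpoch a N * (qb N i)%:C) * (Q ^+ 'C(i, 2) * u ^+ i).
  have qi : Q ^+ i != 0 by rewrite expf_neq0.
  rewrite /Fterm /f binS bin1 exprD expr_div_n.
  by move: (Q ^+ i) (u ^+ i) (acoef a i) (qb N i)%:C (qpoch a N) qi => x y z t s x0; field.
rewrite !normcM normcQ// normc_exp; apply: le_trans.
  apply: ler_wpM2r (hK N i); by rewrite mulr_ge0 ?exprn_ge0.
rewrite -mulrA ler_wpM2l// le_eqVlt; apply/orP; left; apply/eqP.
have qi : q ^+ i != 0 by rewrite expf_neq0.
rewrite binS bin1 exprD expr_div_n -exprM mulnC exprM expr2.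
by move: (q ^+ i) (q ^+ 'C(i, 2)) (normc u ^+ i) (q ^+ N) qi => x y z t x0; field.
Qed.

(** ** Lower bounds away from the zeros *)

(** The orbit [z q^i] keeps a relative distance [eps] from [-1]. *)
Definition away (eps : R) (z : R[i]) := forall i : int,
  eps * (1 + normc z * q ^ i) <= normc (1 + z * (q ^ i)%:C).

Lemma away_nat eps z n : away eps z -> eps * (1 + normc z * q ^+ n) <= normc (1 + z * Q ^+ n).
Proof. by move=> /(_ n%:Z); rewrite -!exprnP -QE. Qed.

Lemma away_mulQX eps z n : away eps z -> away eps (z * Q ^+ n).
Proof.
move=> h i; have := h (n%:Z + i); rewrite expfzDr// -exprnP rmorphM/= -QE.
by rewrite !mulrA normcM normcQ.
Qed.

Lemma awayV eps z : z != 0 -> away eps z -> away eps z^-1.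
Proof.
move=> z0 h i; have := h (- i).
have qi : q ^ i != 0 by rewrite expfz_neq0.
have qi0 : 0 < q ^ i by rewrite exprz_gt0.
have nz : normc z != 0 by apply: contra z0 => /eqP/eq0_normc ->.
have nz0 : 0 < normc z by rewrite lt_neqAle eq_sym nz normc_ge0.
have qic : (q ^ i)%:C != 0 :> R[i] by rewrite (inj_eq (@complexI R) _ 0).
have -> : 1 + z * (q ^ (- i))%:C = (z * (q ^ (- i))%:C) * (1 + z^-1 * (q ^ i)%:C).
  rewrite -invr_expz rmorphV ?unitfE//=; field; rewrite z0; exact: qic.
rewrite normcM normcM normc_real normcV -invr_expz ger0_norm ?invr_ge0 ?(ltW qi0)//.
have -> : eps * (1 + normc z * (q ^ i)^-1) =
    normc z * (q ^ i)^-1 * (eps * (1 + (normc z)^-1 * q ^ i)).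
  by field; rewrite nz qi.
by rewrite ler_pM2l// mulr_gt0// invr_gt0.
Qed.

Let r eps l := Num.max eps (1 - 2 * q ^+ l).

(** When [w] is very small or very large, [1 + w] is automatically comparable
    to [1 + |w|], with a ratio that tends to 1 geometrically. *)
Let ratio_small eps l (w : R[i]) : eps * (1 + normc w) <= normc (1 + w) ->
  normc w <= q ^+ l -> r eps l * (1 + normc w) <= normc (1 + w).
Proof.
move=> h wl; rewrite /r /Num.max; case: ifP => // _.
have : 1 - normc w <= normc (1 + w).
  have := normc_triB 1 (- w); rewrite normcN opprK normc1; exact.
apply: le_trans; have := normc_ge0 w; move: (normc w) (q ^+ l) wl => x y; nra.
Qed.

Let ratio_large eps l (w : R[i]) : eps * (1 + normc w) <= normc (1 + w) ->
  1 <= q ^+ l * normc w -> r eps l * (1 + normc w) <= normc (1 + w).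
Proof.
move=> h wl; rewrite /r /Num.max; case: ifP => // _.
have : normc w - 1 <= normc (1 + w).
  have := normc_triB w (- 1); rewrite normcN opprK normc1 addrC [w + 1]addrC; exact.
apply: le_trans; have := normc_ge0 w.
have : 0 <= q ^+ l by rewrite exprn_ge0.
move: (normc w) (q ^+ l) wl => x y; nra.
Qed.

(** The factors whose argument is close to 1 in modulus are few and are
    controlled by [away]; the ratios of the other ones tend to 1 geometrically
    on both sides. *)
Lemma prod_ratio eps : 0 < eps -> eps <= 1 -> exists2 k, 0 < k &
  forall u, away eps u -> forall N,
  k * \prod_(i < N) (1 + normc u * q ^+ i) <= normc (\prod_(i < N) (1 + u * Q ^+ i)).
Proof.
move=> e0 e1; have [||k k0 hk] := @prod_lower _ q q_gt0 q_lt1 (r eps) 2 ltac:(by []).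
- by move=> i; rewrite lt_max e0.
- by move=> i; rewrite le_max lexx orbT.
have r01 l : 0 <= r eps l <= 1.
  by rewrite le_max ltW//= ge_max e1/= gerBl mulr_ge0// exprn_ge0.
exists (k * k) => [|u hu N]; first by rewrite mulr_gt0.
(* j is the first index with |u| q^j <= 1 *)
have [j [hj1 hj2]] : exists j : nat, normc u * q ^+ j <= 1 /\
    forall i, (i < j)%N -> 1 <= normc u * q ^+ i.
  have exj : exists j, normc u * q ^+ j <= 1.
    have [n hn] := @qexp_small _ q q_gt0 q_lt1 (normc u + 1)^-1
      ltac:(by rewrite invr_gt0 ltr_wpDl ?normc_ge0).
    exists n; apply: le_trans (_ : normc u * (normc u + 1)^-1 <= _).
      by rewrite ler_wpM2l ?normc_ge0// ltW.
    rewrite ler_pdivrMr ?ltr_wpDl ?normc_ge0// mul1r lerDl//.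
  exists (ex_minn exj); case: ex_minnP => j hj jmin; split => // i ij.
  by rewrite ltW// ltNge; apply/negP => /jmin; rewrite leqNgt ij.
pose s i := if (i < j)%N then r eps (j.-1 - i) else r eps (i - j).
have s01 i : 0 <= s i <= 1 by rewrite /s; case: ifP.
have ratio i : s i * (1 + normc u * q ^+ i) <= normc (1 + u * Q ^+ i).
  have hi := away_nat i hu.
  have e : normc u * q ^+ i = normc (u * Q ^+ i) by rewrite normcM normcQ.
  rewrite e in hi *; rewrite /s; case: ltnP => ij.
    apply: ratio_large => //; rewrite -e mulrCA -exprD.
    rewrite subnK; last by rewrite -ltnS prednK// (leq_ltn_trans _ ij).
    by apply: hj2; rewrite prednK// (leq_ltn_trans _ ij).
  apply: ratio_small => //; rewrite -e -[leRHS]mul1r -{1}(subnKC ij) exprD mulrA.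
  by rewrite ler_wpM2r// exprn_ge0.
have sk : k * k <= \prod_(i < N) s i.
  apply: le_trans (_ : \prod_(i < N + j) s i <= _); last first.
    rewrite big_split_ord/= ler_piMr ?prodr_ge0// => [i _|].
      by case/andP: (s01 i).
    by apply: (@prod_le1 _ _ (fun i => s (N + i)%N)).
  rewrite addnC big_split_ord/= ler_pM ?(ltW k0)//.
    rewrite (reindex_inj rev_ord_inj)/=.
    rewrite (eq_bigr (fun i : 'I_j => r eps i)); first exact: hk.
    move=> i _; rewrite /s ifT; last by rewrite -subn_gt0 subKn.
    by congr (r eps _); have := ltn_ord i; lia.
  rewrite (eq_bigr (fun i : 'I_N => r eps i)); first exact: hk.
  by move=> i _; rewrite /s ltnNge leq_addr/= addKn.
apply: le_trans (_ : \prod_(i < N) s i * \prod_(i < N) (1 + normc u * q ^+ i) <= _).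
  rewrite ler_wpM2r// prodr_ge0// => i _; rewrite addr_ge0// mulr_ge0 ?normc_ge0//.
  by rewrite exprn_ge0.
rewrite (normc_prod N (fun i => 1 + u * Q ^+ i)) -big_split/=.
apply: ler_prod => i _; rewrite ratio andbT mulr_ge0//; first by case/andP: (s01 i).
by rewrite addr_ge0// mulr_ge0 ?normc_ge0// exprn_ge0.
Qed.

(** The parameters excluded here are those with [1 / a] a nonnegative power of [q]. *)
Lemma qpoch_lower a : (forall i, a * Q ^+ i != 1) ->
  exists2 c, 0 < c & forall n, c <= normc (qpoch a n).
Proof.
move=> ha; have [||c c0 hc] := @prod_lower _ q q_gt0 q_lt1
    (fun i => normc (1 - a * Q ^+ i)) (normc a) (normc_ge0 a).
- move=> i; rewrite lt_neqAle normc_ge0 andbT eq_sym.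
  apply: contra (ha i) => /eqP/eq0_normc/eqP; rewrite subr_eq0 eq_sym//.
- by move=> i; have := normc_triB 1 (a * Q ^+ i); rewrite normc1 normcM normcQ.
exists c => // n; rewrite (normc_prod n (fun i => 1 - a * Q ^+ i)); exact: hc.
Qed.

(** Every Gaussian binomial with admissible indices is at least 1. *)
Lemma prod_ge_ptheta U N : 0 <= U ->
  U * \sum_(n < N) q ^+ tri n * U ^+ n <= \prod_(i < N) (1 + U * q ^+ i).
Proof.
move=> U0; have -> : \prod_(i < N) (1 + U * q ^+ i) =
    \sum_(n < N.+1) qb N n * q ^+ 'C(n, 2) * U ^+ n.
  apply: (@complexI R); rewrite rmorph_prod rmorph_sum/=.
  transitivity (\prod_(i < N) (1 + U%:C * Q ^+ i)).
    by apply: eq_bigr => i _; rewrite rmorphD rmorphM rmorph1/= QE.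
  by rewrite gauss_prod; apply: eq_bigr => n _; rewrite !rmorphM/= !rmorphXn.
rewrite big_ord_recl/= mulr_sumr -[leLHS]add0r lerD//.
  by rewrite !mulr_ge0 ?qb_ge0 ?exprn_ge0.
apply: ler_sum => n _; rewrite /bump/= add1n exprS mulrCA -[leLHS]mul1r -mulrA.
by rewrite ler_wpM2r ?mulr_ge0 ?exprn_ge0// qb_ge1.
Qed.

Lemma ptheta_half s : 0 <= s -> exists N, forall M, (N <= M)%N ->
  ptheta s / 2 <= \sum_(n < M) q ^+ tri n * s ^+ n.
Proof.
move=> s0; have [C hC] := ptheta_summ q_gt0 q_lt1 s0.
have [N hN] := @geo_half_small R (2 * C) 2^-1 ltac:(by []).
exists N => M NM; have := rsum_tail N hC; rewrite ler_norml => /andP[_].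
have := ptheta_ge1 q_gt0 q_lt1 s0; rewrite -/(ptheta s).
have : \sum_(n < N) q ^+ tri n * s ^+ n <= \sum_(n < M) q ^+ tri n * s ^+ n.
  rewrite -(subnKC NM) big_split_ord/= lerDl sumr_ge0// => i _.
  by rewrite mulr_ge0 ?exprn_ge0.
lra.
Qed.

(** For small [z] the first product in [H] dominates: [F a z] is close to 1 and
    [F a (z^-1 / q)] is comparable to the infinite product, whereas the second
    product lacks a factor of size [1 / |z|]. *)
Lemma H_lower_near0 a eps : 0 < eps -> eps <= 1 -> (forall i, a * Q ^+ i != 1) ->
  exists2 s0, 0 < s0 & exists2 c, 0 < c & forall z, z != 0 -> away eps z ->
    normc z <= s0 -> c * theta (normc z) <= normc (H a z).
Proof.
move=> e0 e1 ha; have [k k0 hk] := prod_ratio e0 e1.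
have [c c0 hc] := qpoch_lower ha; have [K K0 hK] := F_prod_compare a.
have [C1 C11 hC1] := F_le q_gt0 q_lt1 (normc_ge0 a).
have [C2 C20 hC2] := F_near0 q_gt0 q_lt1 (normc_ge0 a).
have C10 : 0 <= C1 by rewrite (le_trans ler01).
have ck0 : 0 < c * k by rewrite mulr_gt0.
pose L := normc a * (C1 * ptheta 1) * C1.
have L0 : 0 <= L.
  by rewrite !mulr_ge0 ?normc_ge0// (le_trans ler01)// ptheta_ge1.
(* 1 / V is so small that |F a z| >= 1/2 and that the main term, of order
   c k / |z|, is at least twice the sum of the errors K and L *)
pose V := 1 + 2 * C2 + 8 * (K + L) / (c * k).
have t0 : 0 <= 8 * (K + L) / (c * k).
  by apply: divr_ge0; [rewrite mulr_ge0// addr_ge0|exact: ltW].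
have V1 : 1 <= V by rewrite /V; lra.
have V0 : 0 < V by rewrite (lt_le_trans ltr01).
exists V^-1; first by rewrite invr_gt0.
exists (c * k / 16); first by rewrite divr_gt0.
move=> z z0 hz zV.
have nz0 : 0 < normc z.
  by rewrite lt_neqAle normc_ge0 andbT eq_sym; apply: contra z0 => /eqP/eq0_normc ->.
pose U := (normc z)^-1; pose P := ptheta U.
have U0 : 0 < U by rewrite invr_gt0.
have VU : V <= U by rewrite -[V]invrK lef_pV2 ?posrE ?invr_gt0.
have U1 : 1 <= U by apply: le_trans VU.
have P1 : 1 <= P by rewrite ptheta_ge1// ltW.
have P0 : 0 <= P by rewrite (le_trans ler01).
have z1 : normc z <= 1 by rewrite -[normc z]invrK invf_le1.
have uU : normc z^-1 = U by rewrite normcV.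
have hFu : (c * k * U / 2 - 2 * K) * P <= normc (F a (z^-1 / Q)).
  have [N1 hN1] := ptheta_half (ltW U0).
  pose B := ptheta (U / q ^+ 2).
  have B0 : 0 < B.
    by rewrite (lt_le_trans ltr01)// ptheta_ge1// divr_ge0 ?exprn_ge0// ltW.
  have [N2 hN2] := @qexp_small _ q q_gt0 q_lt1 B^-1 ltac:(by rewrite invr_gt0).
  pose N := (N1 + N2)%N.
  have hN : q ^+ N * B <= 1.
    rewrite -ler_pdivlMr// mul1r; apply: le_trans (ltW hN2).
    by rewrite le_qexp// leq_addl.
  have hS := hN1 N (leq_addr _ _).
  have := hK z^-1 N; rewrite uU -/P -/B normcB_sym.
  have := normc_triB (qpoch a N * \prod_(i < N) (1 + z^-1 * Q ^+ i)) (F a (z^-1 / Q)).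
  have hP : c * (k * (U * (P / 2))) <= normc (qpoch a N * \prod_(i < N) (1 + z^-1 * Q ^+ i)).
    rewrite normcM ler_pM ?(ltW c0)//; first by rewrite !mulr_ge0 ?ltW// (lt_le_trans ltr01).
    apply: le_trans (hk _ (awayV z0 hz) N); rewrite uU ler_wpM2l ?(ltW k0)//.
    by apply: le_trans (prod_ge_ptheta N (ltW U0)); rewrite ler_wpM2l// ltW.
  have KqB : K * (q ^+ N * B) <= K * 1 by rewrite ler_wpM2l.
  have KP : K * 1 <= K * P by rewrite ler_wpM2l.
  move: (normc _) (normc (F a _)) (normc (_ - _)) hP KqB KP => x y w.
  by move: (q ^+ N * B) => qB; lra.
have hFz : 2^-1 <= normc (F a z).
  have h1 := hC2 a z (lexx _) z1.
  have h2 := normc_triB 1 (F a z); rewrite normc1 normcB_sym in h2.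
  have h3 : C2 * normc z <= 2^-1.
    have -> : normc z = U^-1 by rewrite invrK.
    rewrite ler_pdivrMr//; move: VU; rewrite /V; lra.
  by move: h1 h2 h3; lra.
have hFQz : normc (F a (Q * z)) <= C1 * ptheta 1.
  apply: le_trans (hC1 a _ (lexx _)) _; rewrite ler_wpM2l// le_ptheta ?normc_ge0//.
  by rewrite normcM -[Q]expr1 normcQ// expr1 mulr_ile1 ?normc_ge0.
have hFu2 : normc (F a z^-1) <= C1 * P by rewrite /P -uU; exact: hC1.
have hV : 8 * (K + L) <= c * k * U.
  by rewrite mulrC -ler_pdivrMl ?mulr_gt0// mulrC (le_trans _ VU)// /V; lra.
have hH : (c * k * U / 4 - K - L) * P <= normc (H a z).
  rewrite casoratian.unlock; apply: le_trans (normc_triB _ _).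
  rewrite ![normc (_ * _)]normcM.
  have : 2^-1 * ((c * k * U / 2 - 2 * K) * P) <= normc (F a z) * normc (F a (z^-1 / Q)).
    by apply: ler_pM => //; rewrite mulr_ge0//; lra.
  have : normc a * normc (F a (Q * z)) * normc (F a z^-1) <= L * P.
    rewrite /L -[leRHS]mulrA ler_pM ?mulr_ge0 ?normc_ge0//.
    by rewrite ler_wpM2l ?normc_ge0.
  move: (normc (F a z) * _) (normc a * _ * _) => x y; lra.
apply: le_trans hH.
have hth : theta (normc z) <= 2 * U * P.
  rewrite /theta -/U -/P mulrC [_ * U]mulrC [X in _ <= X](_ : _ = U * P + U * P); last by ring.
  rewrite lerD2r; apply: le_trans (_ : P <= _); last by rewrite ler_peMl// (le_trans ler01).
  by rewrite le_ptheta ?normc_ge0// (le_trans z1).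
apply: le_trans (_ : c * k / 16 * (2 * U * P) <= _).
  by rewrite ler_wpM2l// divr_ge0// ltW.
rewrite [leLHS](_ : _ = (c * k * U / 8) * P); last by field.
rewrite ler_wpM2r//; lra.
Qed.

(** Both sides obey the same quasi-periodicity, so the bound near 0 spreads
    over the whole orbit. *)
Lemma H_lower a eps : 0 < eps -> eps <= 1 -> (forall i, a * Q ^+ i != 1) ->
  exists2 c, 0 < c & forall z, z != 0 -> away eps z ->
    c * theta (normc z) <= normc (H a z).
Proof.
move=> e0 e1 ha; have [s0 s00 [c c0 hc]] := H_lower_near0 e0 e1 ha.
exists c => // z z0 hz.
have nz0 : 0 < normc z.
  by rewrite lt_neqAle normc_ge0 andbT eq_sym; apply: contra z0 => /eqP/eq0_normc ->.
have [d hd] := @qexp_small _ q q_gt0 q_lt1 (s0 / normc z) ltac:(by rewrite divr_gt0).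
have zd0 : z * Q ^+ d != 0 by rewrite mulf_neq0// expf_neq0.
have := hc _ zd0 (away_mulQX d hz); rewrite normcM normcQ//.
rewrite mulrC -ler_pdivlMr// => /(_ (ltW hd)) h.
rewrite -(H_mulQX a d z0) -(theta_mulqX q_gt0 q_lt1 d nz0).
rewrite [normc (_ * (_ * _))]normcM [normc (z ^+ d * _)]normcM normcQ// normc_exp.
rewrite [normc z * q ^+ d]mulrC [leLHS]mulrA.
by rewrite ler_wpM2r// mulr_ge0 ?exprn_ge0 ?normc_ge0.
Qed.

Lemma H_neq0 a eps z : 0 < eps -> eps <= 1 -> (forall i, a * Q ^+ i != 1) ->
  z != 0 -> away eps z -> H a z != 0.
Proof.
move=> e0 e1 ha z0 hz; have [c c0 hc] := H_lower e0 e1 ha.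
have nz0 : 0 < normc z.
  by rewrite lt_neqAle normc_ge0 andbT eq_sym; apply: contra z0 => /eqP/eq0_normc ->.
apply/eqP => h; have := hc z z0 hz; rewrite h normc0 leNgt mulr_gt0//.
exact: theta_gt0.
Qed.

End casoratian.

(** * A bound on the Green kernel *)

Lemma normc_gt0 {R : realType} (z : R[i]) : z != 0 -> 0 < normc z.
Proof.
by move=> z0; rewrite lt_neqAle normc_ge0 andbT eq_sym; apply: contra z0 => /eqP/eq0_normc ->.
Qed.

Lemma tri_double n : (tri n).*2 = (n * n.+1)%N.
Proof.
elim: n => [|n IH]; first by rewrite bin_small.
by rewrite triS doubleD IH; lia.
Qed.

Lemma triD n m : tri (n + m) = (tri n + tri m + n * m)%N.
Proof. by have := tri_double n; have := tri_double m; have := tri_double (n + m); nia. Qed.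

Lemma sqr_mono {R : realType} (x y : R) : 0 <= x -> x <= y -> x ^+ 2 <= y ^+ 2.
Proof. by move=> x0 xy; rewrite ler_pXn2r// nnegrE// (le_trans x0). Qed.

Lemma half_uphalf n : (n = n./2 + uphalf n)%N.
Proof. by rewrite addnC uphalf_half -addnA addnn odd_double_half. Qed.

Lemma half_prodS n : (n./2 * uphalf n + n./2 <= n.+1./2 * uphalf n.+1)%N.
Proof.
rewrite /= mulnS mulnC addnC leq_add2r uphalf_half leq_addl//.
Qed.

(** The exponents below come from splitting [d] into two nearly equal halves,
    [d = n + m]: [theta s ^ 2] is at least [q^(tri n + tri m) s^d], and [tri d]
    exceeds [tri n + tri m] by [n m], about [d^2 / 4]. *)
Lemma half_prod_tri d : (d./2 * uphalf d + tri d <= d * d)%N.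
Proof.
have := half_uphalf d; have := tri_double d.
move: (d./2) (uphalf d) (tri d) => n m t + e; rewrite e -mul2n => {e}.
have : (n <= n * n)%N by case: (n) => // k; rewrite leq_pmulr.
have : (m <= m * m)%N by case: (m) => // k; rewrite leq_pmulr.
nia.
Qed.

Section kernel.
Context {R : realType} (q : R).
Hypotheses (q_gt0 : 0 < q) (q_lt1 : q < 1).
Local Notation Q := (q%:C).
Local Notation F := (phi11 q).
Local Notation H := (casoratian q).
Local Notation ptheta := (ptheta q).
Local Notation theta := (theta q).

Let q_ge0 : 0 <= q. Proof. exact: ltW. Qed.
Let q_neq0 : q != 0. Proof. by rewrite gt_eqF. Qed.
Let q_le1 : q <= 1. Proof. exact: ltW. Qed.
Let Qn0 : Q != 0. Proof. exact: Q_neq0. Qed.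

(** The kernel of the Green operator, in the units in which the measure is
    invariant. The gain of order [q^(d^2 / 4)] absorbs any geometric factor. *)
Lemma kernel_bound a eps K : 0 < eps -> eps <= 1 -> (forall i, a * Q ^+ i != 1) ->
  0 <= K -> exists2 C, 0 <= C & forall z d, z != 0 -> away q eps z ->
  normc (F a (z * Q ^+ d) * F a z^-1 / H a z) ^+ 2 * (normc z ^+ d * q ^+ tri d) * K ^+ d
    <= C.
Proof.
move=> e0 e1 ha K0; have [c c0 hc] := H_lower q_gt0 q_lt1 e0 e1 ha.
have [C1 C11 hC1] := F_le q_gt0 q_lt1 (normc_ge0 a).
have C10 : 0 <= C1 by rewrite (le_trans ler01).
pose g d := (d./2 * uphalf d)%N.
have gS n : (g n + n./2 <= g n.+1)%N by exact: half_prodS.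
have [C2 C20 hC2] := superexp_bound q_gt0 q_lt1 K0 gS.
pose D := C1 * ptheta 1.
have p1 : 1 <= ptheta 1 by rewrite ptheta_ge1.
have D1 : 1 <= D by rewrite /D -[leLHS]mulr1 ler_pM.
have D0 : 0 <= D by rewrite (le_trans ler01).
have Fsmall w : normc w <= 1 -> normc (F a w) <= D.
  move=> w1; apply: le_trans (hC1 a w (lexx _)) _.
  by rewrite ler_wpM2l// le_ptheta ?normc_ge0.
have Fbig w : w != 0 -> normc (F a w) <= D * theta (normc w).
  move=> w0; have nw := normc_gt0 w0; apply: le_trans (hC1 a w (lexx _)) _.
  apply: ler_pM => //; first by rewrite (le_trans ler01)// ptheta_ge1// ltW.
    by rewrite /D ler_peMr.
  exact: ptheta_le_theta.
exists ((D ^+ 2) ^+ 2 / c ^+ 2 * C2) => [|z d z0 hz].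
  by rewrite mulr_ge0// divr_ge0// ?exprn_ge0// ltW.
have s0 := normc_gt0 z0; set s := normc z in s0 *.
have s00 := ltW s0.
pose T := theta s; have T0 : 0 < T by exact: theta_gt0.
have T00 := ltW T0.
have sd0 : 0 < s ^+ d * q ^+ tri d by rewrite mulr_gt0// exprn_gt0.
have sd00 := ltW sd0.
(* in all three ranges of s the product of the two F's is controlled by theta *)
have main : (normc (F a (z * Q ^+ d)) * normc (F a z^-1)) ^+ 2 * (s ^+ d * q ^+ tri d)
    <= (D ^+ 2) ^+ 2 * (T ^+ 2 * q ^+ g d).
  have nzd : normc (z * Q ^+ d) = s * q ^+ d by rewrite normcM normcQ.
  have zd0 : z * Q ^+ d != 0 by rewrite mulf_neq0// expf_neq0.
  have nzV : normc z^-1 = s^-1 by rewrite normcV.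
  have ngd := half_uphalf d.
  have trig : (tri d = tri d./2 + tri (uphalf d) + g d)%N by rewrite {1}ngd triD.
  have [s1|s1] := leP s 1.
    have b1 : normc (F a (z * Q ^+ d)) <= D.
      by apply: Fsmall; rewrite nzd mulr_ile1 ?exprn_ge0 ?exprn_ile1//.
    have b2 : normc (F a z^-1) <= D * T.
      apply: le_trans (Fbig _ _) _; first by rewrite invr_eq0.
      by rewrite nzV thetaV// ler_wpM2l// ler_piMl//.
    have b3 : normc (F a (z * Q ^+ d)) * normc (F a z^-1) <= D ^+ 2 * T.
      by rewrite expr2 -mulrA ler_pM ?normc_ge0.
    apply: le_trans (_ : (D ^+ 2 * T) ^+ 2 * q ^+ g d <= _).
      apply: ler_pM; rewrite ?exprn_ge0 ?mulr_ge0 ?normc_ge0 ?exprn_ge0//.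
        by apply: sqr_mono => //; rewrite mulr_ge0 ?normc_ge0.
      apply: le_trans (_ : 1 * q ^+ tri d <= _).
        by rewrite ler_wpM2r ?exprn_ge0// exprn_ile1//.
      by rewrite mul1r le_qexp// trig leq_addl.
    by rewrite exprMn -mulrA.
  have b2 : normc (F a z^-1) <= D.
    by apply: Fsmall; rewrite nzV invf_le1// ltW.
  have [sd1|sd1] := leP (s * q ^+ d) 1.
    have b1 : normc (F a (z * Q ^+ d)) <= D by apply: Fsmall; rewrite nzd.
    apply: ler_pM; rewrite ?exprn_ge0 ?mulr_ge0 ?normc_ge0 ?exprn_ge0//.
      by apply: sqr_mono; [rewrite mulr_ge0 ?normc_ge0|rewrite expr2 ler_pM ?normc_ge0].
    rewrite trig exprD mulrA ler_wpM2r ?exprn_ge0// expr2.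
    apply: le_trans (_ : (q ^+ tri d./2 * s ^+ d./2) *
        (q ^+ tri (uphalf d) * s ^+ uphalf d) <= _).
      rewrite {1}ngd !exprD le_eqVlt; apply/orP; left; apply/eqP; ring.
    by apply: ler_pM; rewrite ?mulr_ge0 ?exprn_ge0 ?theta_ge//.
  have b1 : normc (F a (z * Q ^+ d)) <= D * theta (s * q ^+ d).
    by rewrite -nzd; exact: Fbig.
  have T'0 : 0 <= theta (s * q ^+ d) by rewrite ltW// theta_gt0// mulr_gt0// exprn_gt0.
  have b3 : normc (F a (z * Q ^+ d)) * normc (F a z^-1) <= D ^+ 2 * theta (s * q ^+ d).
    by rewrite (_ : _ * theta _ = D * theta (s * q ^+ d) * D); [rewrite ler_pM ?normc_ge0|ring].
  apply: le_trans (_ : (D ^+ 2 * theta (s * q ^+ d)) ^+ 2 * (s ^+ d * q ^+ tri d) <= _).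
    by rewrite ler_wpM2r//; apply: sqr_mono => //; rewrite mulr_ge0 ?normc_ge0.
  rewrite exprMn -mulrA ler_wpM2l ?exprn_ge0//.
  have -> : T = theta (s * q ^+ d) * (s ^+ d * q ^+ tri d) by rewrite theta_mulqX.
  rewrite exprMn -[leRHS]mulrA [X in _ <= X](_ : _ = theta (s * q ^+ d) ^+ 2 *
    (s ^+ d * q ^+ tri d * (s ^+ d * (q ^+ tri d * q ^+ g d)))); last by ring.
  rewrite ler_wpM2l ?exprn_ge0// ler_peMr// -exprD.
  apply: le_trans (_ : s ^+ d * q ^+ (d * d) <= _).
    by rewrite exprM -exprMn exprn_ege1// ltW.
  rewrite ler_wpM2l ?exprn_ge0// le_qexp//.
  by rewrite addnC half_prod_tri.
have -> : normc (F a (z * Q ^+ d) * F a z^-1 / H a z) ^+ 2 =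
    (normc (F a (z * Q ^+ d)) * normc (F a z^-1)) ^+ 2 / normc (H a z) ^+ 2.
  by rewrite !normcM normcV expr_div_n.
have hHT := hc z z0 hz; rewrite -/s -/T in hHT.
have cT0 : 0 < c * T by rewrite mulr_gt0.
have nH0 : 0 < normc (H a z) by apply: lt_le_trans hHT.
rewrite [leLHS](_ : _ = (normc (F a (z * Q ^+ d)) * normc (F a z^-1)) ^+ 2 *
  (s ^+ d * q ^+ tri d) * K ^+ d / normc (H a z) ^+ 2); last by ring.
rewrite ler_pdivrMr; last by rewrite exprn_gt0.
apply: le_trans (_ : (D ^+ 2) ^+ 2 * (T ^+ 2 * q ^+ g d) * K ^+ d <= _).
  by rewrite ler_wpM2r ?exprn_ge0.
apply: le_trans (_ : (D ^+ 2) ^+ 2 / c ^+ 2 * C2 * (c * T) ^+ 2 <= _); last first.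
  rewrite ler_wpM2l; first by [].
    by rewrite mulr_ge0// divr_ge0// ?exprn_ge0// ltW.
  by apply: sqr_mono => //; rewrite ltW.
rewrite [leRHS](_ : _ = (D ^+ 2) ^+ 2 * (T ^+ 2 * C2)); last first.
  by rewrite exprMn; field; rewrite gt_eqF.
rewrite -mulrA ler_wpM2l ?exprn_ge0// -mulrA ler_wpM2l ?exprn_ge0//; exact: hC2.
Qed.

(** At [lambda = - 1 / y] the two model solutions coincide on the orbit of [y],
    so that one solution is controlled at both ends of the orbit. As sequences in
    [k] both sides solve the recurrence [F_eq]; they agree at 0, and at 1 because
    the factor [1 + z] vanishes at [z = -1]. *)
Lemma F_selfdual (y : R[i]) k : F (- y) (- Q ^- k) = (- y) ^+ k * F (- y) (- Q ^+ k).
Proof.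
suff: F (- y) (- Q ^- k) = (- y) ^+ k * F (- y) (- Q ^+ k) /\
      F (- y) (- Q ^- k.+1) = (- y) ^+ k.+1 * F (- y) (- Q ^+ k.+1) by case.
elim: k => [|k [IH1 IH2]].
  rewrite !expr0 invr1 mul1r !expr1; split => //.
  have := F_eq q_gt0 q_lt1 (- y) (- 1); rewrite mulNr mul1r mulrN1.
  by rewrite subrr mul0r sub0r mulrN1 opprK => ->; rewrite mulNr.
split=> //.
have := F_eq q_gt0 q_lt1 (- y) (- Q ^- k.+1).
have Qk : Q ^+ k != 0 by rewrite expf_neq0.
have -> : - Q ^- k.+1 / Q = - Q ^- k.+2.
  by rewrite mulNr -invfM -exprSr.
have -> : Q * - Q ^- k.+1 = - Q ^- k.
  by rewrite exprS; field; rewrite Qk.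
move=> ->; rewrite IH1 IH2.
have := F_eq q_gt0 q_lt1 (- y) (- Q ^+ k.+1).
have -> : - Q ^+ k.+1 / Q = - Q ^+ k by rewrite exprS; field.
have -> : Q * - Q ^+ k.+1 = - Q ^+ k.+2 by rewrite mulrN -exprS.
move=> ->; rewrite !exprS.
move: (F (- y) (- (Q * Q ^+ k))) (F (- y) (- (Q * (Q * Q ^+ k)))) ((- y) ^+ k) (Q ^+ k) Qk => u v s t t0.
by field; rewrite t0.
Qed.

End kernel.

(** * Quasi-invariance of the measure under scaling *)

Lemma measurable_inv {R : realType} :
  measurable_fun [set: measurableTypeR R] (fun x : R => x^-1).
Proof.
rewrite (_ : (fun x : R => x^-1) = (fun x => x * (x ^+ 2) `^ (-1))); last first.
  apply/funext => x; rewrite powR_inv1 ?sqr_ge0//.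
  by have [->|x0] := eqVneq x 0; rewrite ?invr0 ?mul0r// expr2 invfM mulrA divff// mul1r.
apply: measurable_funM => //.
have h : measurable_fun [set: measurableTypeR R] (fun x : R => x ^+ 2) by exact: exprn_measurable.
exact: (measurableT_comp (@measurable_powR R (-1)) h).
Qed.

(** The properties of [mu] used from here on. The substitution rule is the
    integrated form of [w (x q) = x w x]. *)
Record qscaling {R : realType} (q : R)
    (mu : {measure set (measurableTypeR R) -> \bar R}) : Prop := {
  scaling_int : forall g : measurableTypeR R -> \bar R,
    measurable_fun [set: measurableTypeR R] g -> (forall x, 0 <= g x)%E ->
    (\int[mu]_x g x = \int[mu]_x ((`|x| * q)%:E * g (x * q)%R))%E;
  scaling_pos : {ae mu, forall x : measurableTypeR R, 0 < x};
  scaling_finite : (mu [set: measurableTypeR R] < +oo)%E;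
  scaling_countable : forall A : set (measurableTypeR R), countable A ->
    {ae mu, forall x, ~ A x} }.

Section measure.
Context {R : realType} (q : R) (w : R -> R).
Local Notation T := (measurableTypeR R).
Local Notation leb := (@lebesgue_measure R).
Variable mu : {measure set T -> \bar R}.
Hypotheses (q_gt0 : 0 < q) (q_lt1 : q < 1).
Hypothesis w_meas : measurable_fun (`]0, +oo[ : set T) w.
Hypothesis w_ge0 : forall x : R, 0 < x -> 0 <= w x.
Hypothesis w_int : (\int[leb]_(x in `]0%R, +oo[) (w x)%:E < +oo)%E.
Hypothesis w_q : forall x : R, 0 < x -> w (x * q) = x * w x.
Hypothesis mu_w : forall A : set T, measurable A ->
      mu A = (\int[leb]_(x in A `&` `]0%R, +oo[) (w x)%:E)%E.

Let q_ge0 : 0 <= q. Proof. exact: ltW. Qed.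
Let q_neq0 : q != 0. Proof. by rewrite gt_eqF. Qed.

Definition wpos (x : R) : R := if 0 < x then w x else 0.

Lemma wposE : (EFin \o wpos) = ((EFin \o w) \_ `]0%R, +oo[)%E.
Proof.
apply/funext => x; rewrite /wpos patchE /= mem_setE in_itv/= andbT.
by case: ifP.
Qed.

Lemma wpos_ge0 x : 0 <= wpos x.
Proof. by rewrite /wpos; case: ifPn => // /w_ge0. Qed.

Lemma measurable_wpos : measurable_fun [set: T] wpos.
Proof.
apply/measurable_EFinP; rewrite wposE; apply/(measurable_restrictT _ _).1 => //.
exact/measurable_EFinP.
Qed.

Lemma muE A : measurable A -> mu A = (\int[leb]_(x in A) (wpos x)%:E)%E.
Proof.
move=> mA; rewrite mu_w// integral_mkcondr; apply: eq_integral => x _.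
by rewrite -[RHS]/((EFin \o wpos) x) wposE.
Qed.

Import HBNNSimple.

Lemma mu_density (g : T -> \bar R) : measurable_fun [set: T] g ->
  (forall x, 0 <= g x)%E -> (\int[mu]_x g x = \int[leb]_x (g x * (wpos x)%:E))%E.
Proof.
move=> mg g0; pose g_ := nnsfun_approx measurableT mg.
have mw := measurable_wpos.
transitivity (limn (fun n => \int[mu]_x (g_ n x)%:E)%E).
  rewrite -monotone_convergence//=.
  - apply: eq_integral => x _; apply/esym/cvg_lim => //=.
    by apply: cvg_nnsfun_approx => // y _; exact: g0.
  - by move=> n; apply: measurableT_comp => //; exact: measurable_funTS.
  - by move=> n x _; rewrite lee_fin.
  - by move=> x _ a b ab; rewrite lee_fin//; exact/lefP/nd_nnsfun_approx.
transitivity (limn (fun n => \int[leb]_x ((g_ n x)%:E * (wpos x)%:E))%E); last first.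
  rewrite -monotone_convergence//=.
  - apply: eq_integral => x _; apply/cvg_lim => //=.
    have h := cvg_nnsfun_approx measurableT mg (fun y _ => g0 y) (I : [set: T] x).
    by apply: cvgeZr => //.
  - by move=> n; apply: emeasurable_funM; exact/measurable_EFinP/measurable_funTS.
  - by move=> n x _; rewrite mule_ge0 ?lee_fin// wpos_ge0.
  - move=> x _ a b ab; rewrite lee_wpmul2r ?lee_fin ?wpos_ge0//.
    exact/lefP/nd_nnsfun_approx.
congr (limn _); apply/funext => n.
have mpre r : measurable (g_ n @^-1` [set r]) by [].
transitivity (\sum_(k \in range (g_ n)) k%:E * mu (g_ n @^-1` [set k]))%E.
  under eq_integral do rewrite fimfunE -fsumEFin//.
  rewrite ge0_integral_fsum//; last 2 first.
  - by move=> y; exact/measurable_EFinP/measurable_funM.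
  - by move=> y x _; rewrite nnfun_muleindic_ge0.
  apply: eq_fsbigr => r _; rewrite integralZl_indic_nnsfun// integral_indic//=.
  by rewrite setIT.
transitivity (\int[leb]_x (\sum_(k \in range (g_ n))
    (k * \1_(g_ n @^-1` [set k]) x)%:E * (wpos x)%:E))%E; last first.
  apply: eq_integral => x _; rewrite -ge0_mule_fsuml; last first.
    by move=> k; rewrite nnfun_muleindic_ge0.
  by rewrite fsumEFin// -fimfunE.
rewrite ge0_integral_fsum//; last 2 first.
- move=> y; apply: emeasurable_funM; last exact/measurable_EFinP.
  exact/measurable_EFinP/measurable_funM.
- by move=> y x _; rewrite mule_ge0 ?nnfun_muleindic_ge0// lee_fin wpos_ge0.
apply: eq_fsbigr => k _.
have [k0|k0] := leP 0 k; last first.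
  rewrite (preimage_nnfun0 _ k0) measure0 mule0 integral0_eq// => x _.
  by rewrite indic0 mulr0 mul0e.
under [RHS]eq_integral do rewrite EFinM -muleA.
rewrite ge0_integralZl//.
- rewrite muE//; congr (_ * _)%E; rewrite [LHS]integral_mkcond; apply: eq_integral => x _.
  rewrite patchE indicE; case: ifPn => _; first by rewrite mul1e.
  by rewrite mul0e.
- apply: emeasurable_funM; last exact/measurable_EFinP.
  exact/measurable_EFinP.
- by move=> x _; rewrite mule_ge0 ?lee_fin ?wpos_ge0.
Qed.

Lemma leb_scale (g : T -> \bar R) : measurable_fun [set: T] g ->
  (forall x, 0 <= g x)%E -> (\int[leb]_x g x = q%:E * \int[leb]_x g (x * q)%R)%E.
Proof.
move=> mg g0.
pose phi : T -> T := fun x => x * q.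
have mphi : measurable_fun [set: T] phi by exact: mulrr_measurable.
pose qn := NngNum q_ge0.
have E A : measurable A -> leb A = mscale qn (pushforward leb phi) A.
  move=> mA; apply: (@lebesgue_measure_unique R (mscale qn (pushforward leb phi))) => //.
  move=> _ [[a b]] _ <-.
  transitivity (q%:E * leb (phi @^-1` [set` `]a, b]]))%E; last by [].
  rewrite (_ : phi @^-1` _ = [set` `](a / q), (b / q)]]); last first.
    by apply/seteqP; split => x; rewrite /phi/= !in_itv/= ltr_pdivrMr// ler_pdivlMr.
  rewrite !lebesgue_measure_itv/= !lte_fin ltr_pM2r ?invr_gt0//.
  case: ifP => _; last by rewrite mule0.
  by rewrite -!EFinB -EFinM; congr (_%:E); field.
rewrite (eq_measure_integral (mscale qn (pushforward leb phi))); last first.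
  by move=> A mA _; exact: E.
rewrite ge0_integral_mscale//=; congr (_ * _)%E.
by rewrite ge0_integral_pushforward// preimage_setT.
Qed.

Lemma mu_scale1 (g : T -> \bar R) : measurable_fun [set: T] g ->
  (forall x, 0 <= g x)%E ->
  (\int[mu]_x g x = \int[mu]_x ((`|x| * q)%:E * g (x * q)%R))%E.
Proof.
move=> mg g0; have mw := measurable_wpos.
have mgq : measurable_fun [set: T] (fun x => g (x * q)).
  by apply: (measurableT_comp mg); exact: mulrr_measurable.
have mx : measurable_fun [set: T] (fun x : T => (`|x| * q)%:E).
  by apply/measurable_EFinP; apply: measurable_funM => //; exact: normr_measurable.
rewrite mu_density// mu_density//; last 2 first.
- exact: emeasurable_funM.
- by move=> x; rewrite mule_ge0// lee_fin mulr_ge0.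
rewrite leb_scale; last 2 first.
- by apply: emeasurable_funM => //; exact/measurable_EFinP.
- by move=> x; rewrite mule_ge0// lee_fin wpos_ge0.
rewrite -ge0_integralZl//; last 2 first.
- have h : measurable_fun [set: T] (fun y => (g y * (wpos y)%:E)%E).
    by apply: emeasurable_funM => //; exact/measurable_EFinP.
  by apply: (measurableT_comp h); exact: mulrr_measurable.
- by move=> x _; rewrite mule_ge0// lee_fin wpos_ge0.
apply: eq_integral => x _; rewrite /wpos pmulr_lgt0//.
case: ifPn => x0; last by rewrite !mule0.
rewrite w_q// (gtr0_norm x0) !EFinM muleCA [RHS]muleAC [RHS]muleC.
by rewrite [(x%:E * q%:E)%E]muleC -!muleA.
Qed.

Lemma mu_neg : mu (`]-oo, 0%R]%classic : set T) = 0%E.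
Proof.
rewrite mu_w//; rewrite (_ : _ `&` _ = set0) ?integral_set0//.
apply/seteqP; split => x//=; rewrite !in_itv/= andbT => -[x0].
by rewrite ltNge x0.
Qed.

Lemma ae_pos : {ae mu, forall x, 0 < x}.
Proof.
exists (`]-oo, 0%R]%classic : set T); split => //; first exact: mu_neg.
by move=> x /= /negP; rewrite -leNgt in_itv/=.
Qed.

Lemma mu_finite : (mu [set: T] < +oo)%E.
Proof. by rewrite mu_w// setTI. Qed.

Lemma mu_countable (A : set T) : countable A -> {ae mu, forall x, ~ A x}.
Proof.
move=> cA; have [mA A0] : measurable A /\ leb A = 0%E.
  by split; [exact: countable_measurable|exact: countable_lebesgue_measure0].
exists A; split => //; last by move=> x /= /contrapT.
rewrite muE//; apply: null_set_integral => //.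
by apply: measurable_funTS; apply/measurable_EFinP; exact: measurable_wpos.
Qed.

Lemma qscaling_density : qscaling q mu.
Proof.
split; [exact: mu_scale1|exact: ae_pos|exact: mu_finite|exact: mu_countable].
Qed.

End measure.

Lemma measurable_floor {R : realType} :
  measurable_fun [set: measurableTypeR R] (fun x : R => (Num.floor x)%:~R : R).
Proof.
apply: nondecreasing_measurable => // x y xy.
by rewrite ler_int le_floor.
Qed.

Section scaling.
Context {R : realType} (q : R).
Local Notation T := (measurableTypeR R).
Variable mu : {measure set T -> \bar R}.
Hypotheses (q_gt0 : 0 < q) (q_lt1 : q < 1) (Hmu : qscaling q mu).

Let q_ge0 : 0 <= q. Proof. exact: ltW. Qed.
Let q_neq0 : q != 0. Proof. by rewrite gt_eqF. Qed.
Let ae_pos : {ae mu, forall x, 0 < x}. Proof. by case: Hmu. Qed.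
Let mu_finite : (mu [set: T] < +oo)%E. Proof. by case: Hmu. Qed.

(** The weight [w (x q^d) q^d / w x] picked up by the substitution [x -> x q^d]. *)
Definition orbit_weight d (x : R) : R := `|x| ^+ d * q ^+ tri d.
Local Notation Wt := orbit_weight.

Lemma Wt_ge0 d x : 0 <= Wt d x.
Proof. by rewrite mulr_ge0 ?exprn_ge0. Qed.

Lemma Wt_gt0 d x : x != 0 -> 0 < Wt d x.
Proof. by move=> x0; rewrite mulr_gt0 ?exprn_gt0 ?normr_gt0. Qed.

Lemma measurable_Wt d : measurable_fun [set: T] (Wt d).
Proof.
apply: measurable_funM => //; apply: measurable_funX; exact: normr_measurable.
Qed.

Lemma measurable_EWt d : measurable_fun [set: T] (fun x : T => (Wt d x)%:E).
Proof. by apply/measurable_EFinP; exact: measurable_Wt. Qed.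

(** Iterating the substitution [x -> x q]. *)
Lemma mu_scale d (g : T -> \bar R) : measurable_fun [set: T] g ->
  (forall x, 0 <= g x)%E ->
  (\int[mu]_x g x = \int[mu]_x ((Wt d x)%:E * g (x * q ^+ d)%R))%E.
Proof.
move=> mg g0; elim: d => [|d ->].
  apply: eq_integral => x _.
  by rewrite /orbit_weight !expr0 !mulr1 mul1e.
rewrite (scaling_int Hmu); last 2 first.
- apply: emeasurable_funM; first exact: measurable_EWt.
  by apply: (measurableT_comp mg); exact: mulrr_measurable.
- by move=> x; rewrite mule_ge0 ?lee_fin ?Wt_ge0.
apply: eq_integral => x _; rewrite muleA -EFinM exprS mulrA; congr (_%:E * _)%E.
rewrite /orbit_weight normrM (ger0_norm q_ge0) exprMn triS exprD !exprS; ring.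
Qed.

Lemma mu_scaleV d (g : T -> \bar R) : measurable_fun [set: T] g ->
  (forall x, 0 <= g x)%E ->
  (\int[mu]_x g x = \int[mu]_x (((Wt d (x / q ^+ d))^-1)%:E * g (x / q ^+ d)%R))%E.
Proof.
move=> mg g0.
have mq : measurable_fun [set: T] (fun x : T => (x / q ^+ d : T)) by exact: mulrr_measurable.
have mWV : measurable_fun [set: T] (fun x => (Wt d (x / q ^+ d))^-1).
  apply: (measurableT_comp (@measurable_inv R)).
  by apply: (measurableT_comp (measurable_Wt d)).
rewrite [RHS](mu_scale d); last 2 first.
- by apply: emeasurable_funM; [exact/measurable_EFinP|exact: (measurableT_comp mg)].
- by move=> x; rewrite mule_ge0 ?lee_fin ?invr_ge0 ?Wt_ge0.
have [N [mN N0 hN]] := ae_pos.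
apply: ge0_ae_eq_integral => //.
- apply: emeasurable_funM; first exact: measurable_EWt.
  apply: emeasurable_funM.
    apply/measurable_EFinP; apply: (measurableT_comp (@measurable_inv R)).
    apply: (measurableT_comp (measurable_Wt d)).
    by apply: measurable_funM => //; exact: mulrr_measurable.
  apply: (measurableT_comp mg).
  by apply: measurable_funM => //; exact: mulrr_measurable.
- by move=> x _; rewrite !mule_ge0 ?lee_fin ?invr_ge0 ?Wt_ge0.
exists N; split => //; apply: subset_trans hN => x /=; apply: contra_not => x0 _.
rewrite mulfK ?expf_neq0// muleA -EFinM divff ?mul1e//.
by rewrite gt_eqF// Wt_gt0// gt_eqF.
Qed.

Lemma ae_scale d (P : T -> Prop) : {ae mu, forall x, P x} ->
  {ae mu, forall x, P (x * q ^+ d)}.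
Proof.
move=> [N [mN N0 hN]].
have mi : measurable_fun [set: T] (fun x : T => (\1_N x : R)%:E) by exact/measurable_EFinP.
have := mu_scale d mi (fun x => ltac:(by rewrite lee_fin)).
rewrite integral_indic// setIT N0 => /esym h.
have h2 : ae_eq mu [set: T] (fun x => ((Wt d x)%:E * (\1_N (x * q ^+ d))%:E)%E) (cst 0%E).
  apply/ae_eq_integral_abs => //.
    apply: emeasurable_funM; first exact: measurable_EWt.
    by apply: (measurableT_comp mi); exact: mulrr_measurable.
  rewrite -[RHS]h; apply: eq_integral => x _.
  by rewrite gee0_abs// mule_ge0 ?lee_fin ?Wt_ge0.
apply: filterS2 h2 ae_pos => x h3 x0.
apply: contrapT => /(hN (x * q ^+ d)) Nx.
have := h3 I; rewrite indicE mem_set// -EFinM mulr1 => -[] /eqP.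
by rewrite gt_eqF// Wt_gt0// gt_eqF.
Qed.

Lemma ae_scaleV d (P : T -> Prop) : {ae mu, forall x, P x} ->
  {ae mu, forall x, P (x / q ^+ d)}.
Proof.
move=> [N [mN N0 hN]].
have mi : measurable_fun [set: T] (fun x : T => (\1_N x : R)%:E) by exact/measurable_EFinP.
have := mu_scaleV d mi (fun x => ltac:(by rewrite lee_fin)).
rewrite integral_indic// setIT N0 => /esym h.
have h2 : ae_eq mu [set: T] (fun x => (((Wt d (x / q ^+ d))^-1)%:E *
    (\1_N (x / q ^+ d))%:E)%E) (cst 0%E).
  apply/ae_eq_integral_abs => //.
    apply: emeasurable_funM.
      apply/measurable_EFinP; apply: (measurableT_comp (@measurable_inv R)).
      by apply: (measurableT_comp (measurable_Wt d)); exact: mulrr_measurable.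
    by apply: (measurableT_comp mi); exact: mulrr_measurable.
  rewrite -[RHS]h; apply: eq_integral => x _.
  by rewrite gee0_abs// mule_ge0 ?lee_fin ?invr_ge0 ?Wt_ge0.
apply: filterS2 h2 ae_pos => x h3 x0.
apply: contrapT => /(hN (x / q ^+ d)) Nx.
have := h3 I; rewrite indicE mem_set// -EFinM mulr1 => -[] /eqP.
by rewrite gt_eqF// invr_gt0 Wt_gt0// mulf_neq0 ?invr_eq0 ?expf_neq0// gt_eqF.
Qed.

(** A null set may be replaced by the union of the orbits meeting it. Thus an
    almost sure property holds simultaneously at all points of almost every
    orbit, and difference equations can be treated pointwise. *)
Lemma ae_orbit (P : T -> Prop) : {ae mu, forall x, P x} ->
  {ae mu, forall x, forall i : int, P (x * q ^ i)}.
Proof.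
move=> h; have h1 := ae_foralln (fun d => ae_scale d h).
have h2 := ae_foralln (fun d => ae_scaleV d h).
apply: filterS2 h1 h2 => x h1 h2 [n|n]; first exact: h1.
by rewrite NegzE -exprnN; exact: h2.
Qed.

(** The total mass computed after the substitution [x -> x q^n] is a multiple
    of the [n]-th moment. *)
Lemma moment_finite n : (\int[mu]_x (`|x| ^+ n)%:E < +oo)%E.
Proof.
have := @mu_scale n (cst 1%E) ltac:(by []) ltac:(by []).
rewrite integral_cst// mul1e => h.
have : (\int[mu]_x ((q ^+ tri n)%:E * (`|x| ^+ n)%:E) < +oo)%E.
  rewrite (_ : (\int[mu]_x _) = mu [set: T])%E ?mu_finite// h.
  by apply: eq_integral => x _; rewrite mule1 /orbit_weight mulrC EFinM.
rewrite ge0_integralZl//.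
- case: (\int[mu]_x _)%E => [r _| |]; rewrite ?ltry// ?ltNyr//.
  by rewrite gt0_muley// lte_fin exprn_gt0.
- by apply/measurable_EFinP; apply: measurable_funX; exact: normr_measurable.
- by rewrite lee_fin exprn_ge0.
Qed.

(** The complement of the support is covered by the null intervals with
    rational ends. *)
Lemma mu_support : {ae mu, forall x, msupport mu x}.
Proof.
pose I n : set R := if unpickle n is Some (a, b) then
  `]ratr a, ratr b[%classic else set0.
pose J n : set T := if (mu (I n) == 0%E) then I n else set0.
have mI n : measurable (I n : set T) by rewrite /I; case: unpickle => [[a b]|].
have mJ n : measurable (J n) by rewrite /J; case: ifP.
have mU : measurable (\bigcup_n J n) by exact: bigcupT_measurable.
exists (\bigcup_n J n); split => //.
- apply/eqP; rewrite -measure_le0; apply: le_trans.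
    by apply: (measure_sigma_subadditive mu mJ mU (@subset_refl _ _)).
  rewrite eseries0// => n _ _; rewrite /J; case: ifP => [/eqP//|_]; exact: measure0.
- move=> x /= /existsNP[U] /not_implyP[oU] /not_implyP[Ux] /negP.
  rewrite -leNgt measure_le0 => /eqP U0.
  have [e e0 eU] : exists2 e : R, 0 < e & ball x e `<=` U.
    by have /nbhs_ballP[e e0 eU] := open_nbhs_nbhs (conj oU Ux); exists e.
  have [a xa] := @rat_in_itvoo R (x - e) x ltac:(by rewrite ltrBlDr ltrDl).
  have [b xb] := @rat_in_itvoo R x (x + e) ltac:(by rewrite ltrDl).
  move: xa xb; rewrite !in_itv/= => /andP[a1 a2] /andP[b1 b2].
  exists (pickle (a, b)) => //; rewrite /J.
  have IE : I (pickle (a, b)) = `]ratr a, ratr b[%classic by rewrite /I pickleK.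
  rewrite ifT; first by rewrite IE/= in_itv/= a2 b1.
  rewrite -measure_le0 -U0; apply: le_measure.
  + by rewrite inE; exact: mI.
  + by rewrite inE; exact: open_measurable.
  + rewrite IE => y /=; rewrite in_itv/= => /andP[y1 y2]; apply: eU.
    rewrite /ball/= ltr_norml; apply/andP; split; lra.
Qed.

End scaling.

(** * Square integrable complex functions *)

Section complex_measurable.
Context {R : realType}.
Local Notation T := (measurableTypeR R).
Implicit Types f g : R -> R[i].

Definition mC f := measurable_fun [set: T] (fun x => complex.Re (f x)) /\
  measurable_fun [set: T] (fun x => complex.Im (f x)).

Lemma cReM (x y : R[i]) : complex.Re (x * y) =
  complex.Re x * complex.Re y - complex.Im x * complex.Im y.
Proof. by case: x y => [a b] [c d]. Qed.

Lemma cImM (x y : R[i]) : complex.Im (x * y) =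
  complex.Re x * complex.Im y + complex.Im x * complex.Re y.
Proof. by case: x y => [a b] [c d]. Qed.

Lemma cReD (x y : R[i]) : complex.Re (x + y) = complex.Re x + complex.Re y.
Proof. by case: x y => [a b] [c d]. Qed.

Lemma cImD (x y : R[i]) : complex.Im (x + y) = complex.Im x + complex.Im y.
Proof. by case: x y => [a b] [c d]. Qed.

Lemma mCD f g : mC f -> mC g -> mC (fun x => f x + g x).
Proof.
move=> [f1 f2] [g1 g2]; split.
  by rewrite (_ : (fun _ => _) = fun x => complex.Re (f x) + complex.Re (g x));
    [exact: measurable_funD|apply/funext => x; rewrite cReD].
by rewrite (_ : (fun _ => _) = fun x => complex.Im (f x) + complex.Im (g x));
  [exact: measurable_funD|apply/funext => x; rewrite cImD].
Qed.

Lemma mCM f g : mC f -> mC g -> mC (fun x => f x * g x).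
Proof.
move=> [f1 f2] [g1 g2]; split.
  rewrite (_ : (fun _ => _) = fun x => complex.Re (f x) * complex.Re (g x) -
      complex.Im (f x) * complex.Im (g x)).
    by apply: measurable_funB; exact: measurable_funM.
  by apply/funext => x; rewrite cReM.
rewrite (_ : (fun _ => _) = fun x => complex.Re (f x) * complex.Im (g x) +
    complex.Im (f x) * complex.Re (g x)).
  by apply: measurable_funD; exact: measurable_funM.
by apply/funext => x; rewrite cImM.
Qed.

Lemma mC_real (u : R -> R) : measurable_fun [set: T] u -> mC (fun x => (u x)%:C).
Proof. by move=> mu; split => //=; exact: measurable_cst. Qed.

Lemma mC_cst z : mC (fun=> z).
Proof. by split; exact: measurable_cst. Qed.

Lemma mCZ z f : mC f -> mC (fun x => z * f x).
Proof. by move=> mf; apply: mCM => //; exact: mC_cst. Qed.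

Lemma mCB f g : mC f -> mC g -> mC (fun x => f x - g x).
Proof.
move=> mf mg; rewrite (_ : (fun _ => _) = fun x => f x + -1 * g x); last first.
  by apply/funext => x; rewrite mulN1r.
by apply: mCD => //; exact: mCZ.
Qed.

Lemma mC_conj f : mC f -> mC (fun x => (f x)^*).
Proof.
move=> [f1 f2]; split.
  by rewrite (_ : (fun _ => _) = fun x => complex.Re (f x)) //;
    apply/funext => x; case: (f x).
rewrite (_ : (fun _ => _) = fun x => - complex.Im (f x)); last first.
  by apply/funext => x; case: (f x).
exact: measurable_funN.
Qed.

Lemma mC_comp f (phi : R -> R) : mC f -> measurable_fun [set: T] (phi : T -> T) ->
  mC (fun x => f (phi x)).
Proof.
by move=> [f1 f2] mp; split; [exact: (measurableT_comp f1 mp)|exact: (measurableT_comp f2 mp)].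
Qed.

Lemma mC_scale f c : mC f -> mC (fun x => f (x * c)).
Proof. by move=> mf; apply: mC_comp => //; exact: mulrr_measurable. Qed.

Lemma mC_sq f : mC f -> measurable_fun [set: T] (fun x => normc (f x) ^+ 2).
Proof.
move=> [f1 f2]; rewrite (_ : (fun _ => _) =
  (fun x => complex.Re (f x) ^+ 2 + complex.Im (f x) ^+ 2)).
  by apply: measurable_funD; exact: measurable_funX.
by apply/funext => x; rewrite normc_sqr.
Qed.

Lemma mC_inv f : mC f -> mC (fun x => (f x)^-1).
Proof.
move=> mf; rewrite (_ : (fun _ => _) = fun x => (f x)^* * ((normc (f x) ^+ 2)^-1)%:C).
  apply: mCM; first exact: mC_conj.
  by apply: mC_real; apply: (measurableT_comp (@measurable_inv R)); exact: mC_sq.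
apply/funext => x; have [->|fx0] := eqVneq (f x) 0; first by rewrite invr0 normc0 expr0n/= invr0 mulr0.
have e : f x * (f x)^* = (normc (f x) ^+ 2)%:C.
  by case: (f x) => a b; rewrite normc_sqr; apply/eqP; rewrite eq_complex/=; apply/andP; split; apply/eqP; ring.
have c0 : (f x)^* != 0 by rewrite conjc_eq0.
by rewrite rmorphV ?unitfE ?expf_neq0 ?gt_eqF ?normc_gt0//= -e invfM mulrA mulrAC divff// mul1r.
Qed.

Lemma mCX f n : mC f -> mC (fun x => f x ^+ n).
Proof.
move=> mf; elim: n => [|n IH]; first exact: mC_cst.
by rewrite (_ : (fun _ => _) = fun x => f x * f x ^+ n); [exact: mCM|
  apply/funext => x; rewrite exprS].
Qed.

Lemma measurable_rsum (u : R -> nat -> R) :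
  (forall n, measurable_fun [set: T] (fun x => u x n)) ->
  measurable_fun [set: T] (fun x => rsum (u x)).
Proof.
move=> mu; rewrite (_ : (fun _ => _) =
  fun x => fine (limn_esup (fun n => (\sum_(i < n) u x i)%:E))); last first.
  by apply/funext => x; rewrite rsum.unlock.
apply: (measurableT_comp (@fine_measurable R setT measurableT)).
apply: measurable_fun_limn_esup => n; apply/measurable_EFinP.
elim: n => [|n IH].
  by rewrite (_ : (fun _ => _) = fun=> 0); [exact: measurable_cst|
    apply/funext => x; rewrite big_ord0].
by rewrite (_ : (fun _ => _) = fun x => \sum_(i < n) u x i + u x n);
  [exact: measurable_funD|apply/funext => x; rewrite big_ord_recr].
Qed.

Lemma mC_csum (f : R -> nat -> R[i]) : (forall n, mC (fun x => f x n)) ->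
  mC (fun x => csum (f x)).
Proof.
move=> mf; split; rewrite /csum/=.
  by apply: (@measurable_rsum (fun x n => complex.Re (f x n))) => n; case: (mf n).
by apply: (@measurable_rsum (fun x n => complex.Im (f x n))) => n; case: (mf n).
Qed.

Lemma mC_F (q : R) a f : mC f -> mC (fun x => phi11 q a (f x)).
Proof.
move=> mf; rewrite (_ : (fun _ => _) = fun x => csum (Fterm q a (f x))); last first.
  by apply/funext => x; rewrite phi11.unlock.
apply: mC_csum => n; rewrite /Fterm; apply: mCM; first exact: mC_cst.
exact: mCX.
Qed.

Lemma mC_F2 (q : R) f g : mC f -> mC g -> mC (fun x => phi11 q (g x) (f x)).
Proof.
move=> mf mg; rewrite (_ : (fun _ => _) = fun x => csum (Fterm q (g x) (f x))); last first.
  by apply/funext => x; rewrite phi11.unlock.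
apply: mC_csum => n; rewrite /Fterm; apply: mCM; last exact: mCX.
apply: mCM; last exact: mC_cst.
rewrite /phi11_coef; apply: mCM; last exact: mC_cst.
elim: n => [|n IH].
  by rewrite (_ : (fun _ => _) = fun=> 1); [exact: mC_cst|
    apply/funext => x; rewrite /qpochhammer big_ord0].
rewrite (_ : (fun _ => _) = fun x => qpochhammer q (g x) n * (1 - g x * q%:C ^+ n)); last first.
  by apply/funext => x; rewrite qpochS.
apply: mCM => //; apply: mCB; first exact: mC_cst.
by apply: mCM => //; exact: mC_cst.
Qed.

Lemma mC_H (q : R) a f : mC f -> mC (fun x => casoratian q a (f x)).
Proof.
move=> mf; rewrite (_ : (fun _ => _) = fun x => phi11 q a (f x) * phi11 q a ((f x)^-1 / q%:C) -
    a * phi11 q a (q%:C * f x) * phi11 q a (f x)^-1); last first.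
  by apply/funext => x; rewrite casoratian.unlock.
apply: mCB; apply: mCM; try by apply: mC_F => //; exact: mC_inv.
- by apply: mC_F; apply: mCM; [exact: mC_inv|exact: mC_cst].
- by apply: mCZ; apply: mC_F; exact: mCZ.
Qed.

Lemma mC_if (P : R -> bool) f g : measurable_fun [set: T] P -> mC f -> mC g ->
  mC (fun x => if P x then f x else g x).
Proof.
move=> mP [f1 f2] [g1 g2]; split.
  rewrite (_ : (fun _ => _) = fun x => if P x then complex.Re (f x) else complex.Re (g x)).
    by apply: measurable_fun_ifT.
  by apply/funext => x; case: ifP.
rewrite (_ : (fun _ => _) = fun x => if P x then complex.Im (f x) else complex.Im (g x)).
  by apply: measurable_fun_ifT.
by apply/funext => x; case: ifP.
Qed.

Lemma mC_qdiff (q : R) f : mC f -> mC (qdiff q f).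
Proof.
move=> mf; apply: mCD; last first.
  by apply: mCM; [apply: mC_real; exact: measurable_inv|exact: mC_scale].
apply: mCB; first exact: mC_scale.
by apply: mCM => //; apply: mC_real; exact: measurable_inv.
Qed.

End complex_measurable.

Section L2theory.
Context {R : realType}.
Local Notation T := (measurableTypeR R).
Variable mu : {measure set T -> \bar R}.
Implicit Types f g h : R -> R[i].

Lemma ae_sub (P Q : set T) : P `<=` Q ->
  almost_everywhere mu P -> almost_everywhere mu Q.
Proof.
move=> PQ [N [mN N0 hN]]; exists N; split => //; apply: subset_trans hN => x /=.
by apply: contra_not => /PQ.
Qed.

(** The squared norm; working with it avoids all square roots. *)
Definition I2 f : \bar R := (\int[mu]_x (normc (f x) ^+ 2)%:E)%E.

Lemma I2_ge0 f : (0 <= I2 f)%E.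
Proof. by apply: integral_ge0 => x _; rewrite lee_fin sqr_ge0. Qed.

Lemma normL2_sqr f : (normL2 mu f `^ 2)%E = I2 f.
Proof.
rewrite /normL2 poweR_Lnorm ?pnatr_eq0//; apply: eq_integral => x _ /=.
rewrite ger0_norm ?normc_ge0//; congr (_%:E).
by rewrite -[2]/(2%:R) powR_mulrn ?normc_ge0.
Qed.

Lemma normL2_ge0 f : (0 <= normL2 mu f)%E.
Proof. exact: Lnorm_ge0. Qed.

Lemma normL2_lty f : (normL2 mu f < +oo)%E <-> (I2 f < +oo)%E.
Proof.
rewrite -normL2_sqr; split; first exact: poweR_lty.
by apply: lty_poweRy; rewrite pnatr_eq0.
Qed.

Lemma sqre_le (x y : \bar R) : (0 <= x -> 0 <= y -> x `^ 2 <= y `^ 2 -> x <= y)%E.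
Proof.
move=> x0 y0 h; rewrite leNgt; apply/negP => yx.
move: x y x0 y0 h yx => [x| |] [y| |]//; rewrite ?lee_fin ?lte_fin ?leey ?leNye// => x0 y0.
- rewrite !powR_mulrn// ler_pXn2r ?nnegrE// => xy.
  by rewrite ltNge xy.
- by rewrite poweRyr ?pnatr_eq0// poweR_EFin.
Qed.

Lemma normL2_le (M : R) f g : 0 <= M -> (I2 f <= (M ^+ 2)%:E * I2 g)%E ->
  (normL2 mu f <= M%:E * normL2 mu g)%E.
Proof.
move=> M0 h; apply: sqre_le; rewrite ?mule_ge0 ?normL2_ge0//.
rewrite poweRM ?normL2_ge0// !normL2_sqr poweR_EFin -[2]/(2%:R) powR_mulrn//.
Qed.

Lemma normL2_leW (M : R) f g : (normL2 mu f <= M%:E * normL2 mu g)%E ->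
  (I2 f <= (M ^+ 2)%:E * I2 g)%E.
Proof.
move=> h.
have h' : (normL2 mu f <= `|M|%:E * normL2 mu g)%E.
  by apply: le_trans h _; rewrite lee_wpmul2r ?normL2_ge0// lee_fin ler_norm.
rewrite -!normL2_sqr; have -> : (M ^+ 2)%:E = (`|M|%:E `^ 2)%E.
  by rewrite poweR_EFin -[2]/(2%:R) powR_mulrn// real_normK ?num_real.
rewrite -poweRM ?normL2_ge0//.
apply: gt0_ler_poweR => //; rewrite in_itv/= ?normL2_ge0 ?leey//.
by rewrite mule_ge0 ?normL2_ge0// lee_fin.
Qed.

Lemma normL2_lt (e : R) f : 0 < e -> (I2 f < (e ^+ 2)%:E)%E -> (normL2 mu f < e%:E)%E.
Proof.
move=> e0; rewrite -normL2_sqr => h; rewrite ltNge; apply/negP => eN.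
move: h; rewrite ltNge => /negP; apply.
have -> : (e ^+ 2)%:E = (e%:E `^ 2)%E.
  by rewrite poweR_EFin -[2]/(2%:R) powR_mulrn// ltW.
apply: gt0_ler_poweR => //; rewrite in_itv/= ?normL2_ge0 ?leey// lee_fin ltW//.
Qed.

Lemma L2P f : L2 mu f <-> mC f /\ (I2 f < +oo)%E.
Proof.
split=> [[m1 m2 /normL2_lty fi]|[[m1 m2] /normL2_lty fi]]; split => //.
Qed.

Lemma L2_mC f : L2 mu f -> mC f. Proof. by case/L2P. Qed.
Lemma L2_I2 f : L2 mu f -> (I2 f < +oo)%E. Proof. by case/L2P. Qed.

Lemma I2_le f g (c : R) : mC f -> mC g -> 0 <= c ->
  {ae mu, forall x, normc (f x) ^+ 2 <= c * normc (g x) ^+ 2} ->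
  (I2 f <= c%:E * I2 g)%E.
Proof.
move=> mf mg c0 fg; rewrite /I2 -ge0_integralZl//; last 2 first.
- by apply/measurable_EFinP; exact: mC_sq.
- by move=> x _; rewrite lee_fin sqr_ge0.
apply: ae_ge0_le_integral => //.
- by move=> x _; rewrite lee_fin sqr_ge0.
- by apply/measurable_EFinP; exact: mC_sq.
- by move=> x _; rewrite mule_ge0 ?lee_fin ?sqr_ge0.
- apply: emeasurable_funM; first exact: measurable_cst.
  by apply/measurable_EFinP; exact: mC_sq.
- by apply: (ae_sub _ fg) => x h _; rewrite -EFinM lee_fin.
Qed.

Lemma eq_I2 f g : mC f -> mC g -> eqL2 mu f g -> I2 f = I2 g.
Proof.
move=> mf mg fg; apply: ge0_ae_eq_integral => //.
- by apply/measurable_EFinP; exact: mC_sq.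
- by apply/measurable_EFinP; exact: mC_sq.
- by move=> x _; rewrite lee_fin sqr_ge0.
- by move=> x _; rewrite lee_fin sqr_ge0.
- by apply: (ae_sub _ fg) => x -> _.
Qed.

Lemma I2_eq0 f : mC f -> I2 f = 0%E -> eqL2 mu f (fun=> 0).
Proof.
move=> mf h.
have h2 : ae_eq mu [set: T] (fun x => (normc (f x) ^+ 2)%:E) (cst 0%E).
  apply/ae_eq_integral_abs => //; first by apply/measurable_EFinP; exact: mC_sq.
  rewrite -[RHS]h; apply: eq_integral => x _.
  by rewrite gee0_abs// lee_fin sqr_ge0.
apply: (ae_sub _ h2) => x /(_ I) [] /eqP; rewrite expf_eq0/= => /eqP.
exact: eq0_normc.
Qed.

Lemma normcD_sqr (x y : R[i]) : normc (x + y) ^+ 2 <= 2 * (normc x ^+ 2 + normc y ^+ 2).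
Proof.
have := sqr_mono (normc_ge0 _) (le_normcD x y).
have := sqr_ge0 (normc x - normc y); nra.
Qed.

Lemma I2D f g : mC f -> mC g -> (I2 (fun x => f x + g x)%R <= 2%:E * (I2 f + I2 g))%E.
Proof.
move=> mf mg; rewrite /I2 -ge0_integralD//; last 4 first.
- by move=> x _; rewrite lee_fin sqr_ge0.
- by apply/measurable_EFinP; exact: mC_sq.
- by move=> x _; rewrite lee_fin sqr_ge0.
- by apply/measurable_EFinP; exact: mC_sq.
rewrite -ge0_integralZl//; last 2 first.
- by apply: emeasurable_funD; apply/measurable_EFinP; exact: mC_sq.
- by move=> x _; rewrite adde_ge0// lee_fin sqr_ge0.
apply: ge0_le_integral => //.
- by move=> x _; rewrite lee_fin sqr_ge0.
- by apply/measurable_EFinP; apply: mC_sq; exact: mCD.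
- apply: emeasurable_funM; first exact: measurable_cst.
  by apply: emeasurable_funD; apply/measurable_EFinP; exact: mC_sq.
- by move=> x _; rewrite -EFinD -EFinM lee_fin normcD_sqr.
Qed.

Lemma L2_le f g (c : R) : mC f -> L2 mu g -> 0 <= c ->
  {ae mu, forall x, normc (f x) ^+ 2 <= c * normc (g x) ^+ 2} -> L2 mu f.
Proof.
move=> mf /L2P[mg gi] c0 fg; apply/L2P; split => //.
by apply: le_lt_trans (I2_le mf mg c0 fg) _; rewrite lte_mul_pinfty// lee_fin.
Qed.

Lemma L2D f g : L2 mu f -> L2 mu g -> L2 mu (fun x => f x + g x).
Proof.
move=> /L2P[mf fi] /L2P[mg gi]; apply/L2P; split; first exact: mCD.
apply: le_lt_trans (I2D mf mg) _; rewrite lte_mul_pinfty ?lee_fin//.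
by rewrite lte_add_pinfty.
Qed.

Lemma L2Z z f : L2 mu f -> L2 mu (fun x => z * f x).
Proof.
move=> Lf; apply: (L2_le (c := normc z ^+ 2) _ Lf); first exact/mCZ/L2_mC.
  exact: sqr_ge0.
by apply: aeW => x; rewrite normcM exprMn.
Qed.

Lemma L2B f g : L2 mu f -> L2 mu g -> L2 mu (fun x => f x - g x).
Proof.
move=> Lf Lg; rewrite (_ : (fun _ => _) = fun x => f x + -1 * g x).
  by apply: L2D => //; exact: L2Z.
by apply/funext => x; rewrite mulN1r.
Qed.

Lemma L2_ae f g : mC f -> L2 mu g -> eqL2 mu f g -> L2 mu f.
Proof.
move=> mf Lg fg; apply: (L2_le (c := 1) mf Lg) => //.
by apply: (ae_sub _ fg) => x ->; rewrite mul1r.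
Qed.

(** Complex functions with integrable real and imaginary parts. *)
Definition cint f := mC f /\ (\int[mu]_x (normc (f x))%:E < +oo)%E.

Lemma mC_normc f : mC f -> measurable_fun [set: T] (fun x => normc (f x)).
Proof.
move=> mf; rewrite (_ : (fun _ => _) = fun x => (normc (f x) ^+ 2) `^ 2^-1).
  exact: (measurableT_comp (@measurable_powR R 2^-1) (mC_sq mf)).
apply/funext => x; rewrite -powR_mulrn ?normc_ge0// -powRrM divff ?pnatr_eq0//.
by rewrite powRr1// normc_ge0.
Qed.

Lemma cint_Re f : cint f -> mu.-integrable [set: T] (EFin \o (fun x => complex.Re (f x))).
Proof.
move=> [[m1 m2] fi]; apply/integrableP; split; first exact/measurable_EFinP.
apply: le_lt_trans fi; apply: ge0_le_integral => //.
- by apply/measurable_EFinP; exact: measurableT_comp.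
- by apply/measurable_EFinP; exact: mC_normc.
- by move=> x _; rewrite lee_fin Re_le_normc.
Qed.

Lemma cint_Im f : cint f -> mu.-integrable [set: T] (EFin \o (fun x => complex.Im (f x))).
Proof.
move=> [[m1 m2] fi]; apply/integrableP; split; first exact/measurable_EFinP.
apply: le_lt_trans fi; apply: ge0_le_integral => //.
- by apply/measurable_EFinP; exact: measurableT_comp.
- by apply/measurable_EFinP; exact: mC_normc.
- by move=> x _; rewrite lee_fin Im_le_normc.
Qed.

Lemma cintD f g : cint f -> cint g -> cint (fun x => f x + g x).
Proof.
move=> [mf fi] [mg gi]; split; first exact: mCD.
apply: le_lt_trans (lte_add_pinfty fi gi); rewrite -ge0_integralD//; last 4 first.
- by move=> x _; rewrite lee_fin normc_ge0.
- by apply/measurable_EFinP; exact: mC_normc.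
- by move=> x _; rewrite lee_fin normc_ge0.
- by apply/measurable_EFinP; exact: mC_normc.
apply: ge0_le_integral => //.
- by move=> x _; rewrite lee_fin normc_ge0.
- by apply/measurable_EFinP; apply: mC_normc; exact: mCD.
- by apply: emeasurable_funD; apply/measurable_EFinP; exact: mC_normc.
- by move=> x _; rewrite -EFinD lee_fin le_normcD.
Qed.

Lemma cintN f : cint f -> cint (fun x => - f x).
Proof.
move=> [mf fi]; split.
  by rewrite (_ : (fun _ => _) = fun x => -1 * f x); [exact: mCZ|
    apply/funext => x; rewrite mulN1r].
by under eq_integral do rewrite normcN.
Qed.

Lemma cintM f g : L2 mu f -> L2 mu g -> cint (fun x => f x * g x).
Proof.
move=> /L2P[mf fi] /L2P[mg gi]; split; first exact: mCM.
apply: le_lt_trans (lte_add_pinfty fi gi); rewrite /I2 -ge0_integralD//; last 4 first.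
- by move=> x _; rewrite lee_fin sqr_ge0.
- by apply/measurable_EFinP; exact: mC_sq.
- by move=> x _; rewrite lee_fin sqr_ge0.
- by apply/measurable_EFinP; exact: mC_sq.
apply: ge0_le_integral => //.
- by move=> x _; rewrite lee_fin normc_ge0.
- by apply/measurable_EFinP; apply: mC_normc; exact: mCM.
- by apply: emeasurable_funD; apply/measurable_EFinP; exact: mC_sq.
- move=> x _; rewrite -EFinD lee_fin normcM.
  have := normc_ge0 (f x); have := normc_ge0 (g x); move: (normc _) (normc _) => a b.
  have := sqr_ge0 (b - a); nra.
Qed.

Lemma L2_conj f : L2 mu f -> L2 mu (fun x => (f x)^*).
Proof.
move=> Lf; apply: (L2_le (c := 1) _ Lf) => //; first exact/mC_conj/L2_mC.
by apply: aeW => x; rewrite mul1r normc_sqr; case: (f x) => a b /=; rewrite sqrrN sqr_sqrtr ?addr_ge0 ?sqr_ge0.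
Qed.

Lemma cintegralD f g : cint f -> cint g ->
  cintegral mu (fun x => f x + g x) = cintegral mu f + cintegral mu g.
Proof.
move=> cf cg; rewrite /cintegral.
under eq_Rintegral do rewrite cReD.
under [X in _ +i* X]eq_Rintegral do rewrite cImD.
by rewrite !RintegralD//; [exact: cint_Im|exact: cint_Im|exact: cint_Re|exact: cint_Re].
Qed.

Lemma cintegralN f : cint f -> cintegral mu (fun x => - f x) = - cintegral mu f.
Proof.
move=> cf; apply/eqP; rewrite -addr_eq0 -cintegralD//; last exact: cintN.
apply/eqP; rewrite /cintegral.
rewrite (_ : Rintegral _ _ _ = 0); last first.
  by rewrite /Rintegral; under eq_integral do rewrite addNr/=; rewrite integral0.
rewrite (_ : Rintegral _ _ _ = 0)//.
by rewrite /Rintegral; under eq_integral do rewrite addNr/=; rewrite integral0.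
Qed.

Lemma cintegralB f g : cint f -> cint g ->
  cintegral mu (fun x => f x - g x) = cintegral mu f - cintegral mu g.
Proof. by move=> cf cg; rewrite cintegralD ?cintegralN//; exact: cintN. Qed.

Lemma eq_cintegral f g : mC f -> mC g -> eqL2 mu f g -> cintegral mu f = cintegral mu g.
Proof.
move=> [f1 f2] [g1 g2] fg; rewrite /cintegral /Rintegral; congr (fine _ +i* fine _).
  apply: ae_eq_integral => //; try exact/measurable_EFinP.
  by apply: (ae_sub _ fg) => x -> _.
apply: ae_eq_integral => //; try exact/measurable_EFinP.
by apply: (ae_sub _ fg) => x -> _.
Qed.

End L2theory.

(** * The adjoint is the maximal operator *)

Section adjoint.
Context {R : realType} (q : R).
Local Notation T := (measurableTypeR R).
Variable mu : {measure set T -> \bar R}.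
Hypotheses (q_gt0 : 0 < q) (q_lt1 : q < 1) (Hmu : qscaling q mu).
Implicit Types f g h : R -> R[i].

Let q_ge0 : 0 <= q. Proof. exact: ltW. Qed.
Let q_neq0 : q != 0. Proof. by rewrite gt_eqF. Qed.
Let ae_pos : {ae mu, forall x, 0 < x}. Proof. by case: Hmu. Qed.
Let Qn0 : q%:C != 0 :> R[i]. Proof. exact: Q_neq0. Qed.

Lemma measurable_absq : measurable_fun [set: T] (fun x : T => `|x| * q).
Proof. by apply: measurable_funM => //; exact: normr_measurable. Qed.

Lemma int_scale (u : T -> R) : measurable_fun [set: T] u ->
  (\int[mu]_x (u x)%:E = \int[mu]_x ((`|x| * q) * u (x * q))%:E)%E.
Proof.
move=> mu_; have mE : measurable_fun [set: T] (EFin \o u) by exact/measurable_EFinP.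
rewrite integralE [in RHS]integralE; congr (_ - _)%E.
  rewrite (scaling_int Hmu); last 2 first.
  - exact: measurable_funepos.
  - by move=> x; rewrite funepos_ge0.
  apply: eq_integral => x _; rewrite !funeposE -!EFin_max -EFinM maxr_pMr ?mulr0//.
  by rewrite mulr_ge0.
rewrite (scaling_int Hmu); last 2 first.
- exact: measurable_funeneg.
- by move=> x; rewrite funeneg_ge0.
apply: eq_integral => x _; rewrite !funenegE -!EFinN -!EFin_max -EFinM maxr_pMr ?mulr0 ?mulrN//.
by rewrite mulr_ge0.
Qed.

Lemma ReCM (r : R) (z : R[i]) : complex.Re (r%:C * z) = r * complex.Re z.
Proof. by case: z => a b /=; rewrite mul0r subr0. Qed.

Lemma ImCM (r : R) (z : R[i]) : complex.Im (r%:C * z) = r * complex.Im z.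
Proof. by case: z => a b /=; rewrite mul0r addr0. Qed.

Lemma qdiff_conj g x : Num.conj (qdiff q g x) =
  Num.conj (g (x * q)) - (x^-1)%:C * Num.conj (g x)
  + (x^-1)%:C * Num.conj (g (x / q)).
Proof.
rewrite /qdiff; case: (g (x * q)) (g x) (g (x / q)) => a1 b1 [a2 b2] [a3 b3].
by apply/eqP; rewrite eq_complex/=; apply/andP; split; apply/eqP; ring.
Qed.

Definition rescale f : R -> R[i] := fun x => (`|x| * q)%:C * f (x * q).

Lemma mC_rescale f : mC f -> mC (rescale f).
Proof.
by move=> mf; apply: mCM; [exact: (@mC_real R (fun x => `|x| * q) measurable_absq)|exact: mC_scale].
Qed.

Lemma cint_rescale f : mC f -> cint mu (rescale f) <-> cint mu f.
Proof.
move=> mf; suff E : (\int[mu]_x (normc (f x))%:E = \int[mu]_x (normc (rescale f x))%:E)%E.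
  by split=> -[_ fi]; split => //; [rewrite E|exact: mC_rescale|rewrite -E].
rewrite int_scale; last exact: mC_normc.
by apply: eq_integral => x _; rewrite /rescale normcM normc_real normrM normr_id (ger0_norm q_ge0).
Qed.

Lemma cintegral_rescale f : mC f -> cintegral mu (rescale f) = cintegral mu f.
Proof.
move=> [f1 f2]; rewrite /cintegral /Rintegral (int_scale f1) (int_scale f2).
apply/eqP; rewrite eq_complex/=; apply/andP; split; apply/eqP; congr fine;
  by apply: eq_integral => x _; rewrite /rescale ?ReCM ?ImCM.
Qed.

Lemma cint_ae f g : mC g -> eqL2 mu f g -> cint mu f -> cint mu g.
Proof.
move=> mg fg [mf fi]; split => //; rewrite (_ : integral _ _ _ =
  (\int[mu]_x (normc (f x))%:E)%E)//.
apply: ge0_ae_eq_integral => //.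
- by apply/measurable_EFinP; exact: mC_normc.
- by apply/measurable_EFinP; exact: mC_normc.
- by move=> x _; rewrite lee_fin normc_ge0.
- by move=> x _; rewrite lee_fin normc_ge0.
- by apply: (ae_sub _ fg) => x -> _.
Qed.

Lemma ae2 (P Q S : set T) : (forall x, P x -> Q x -> S x) ->
  almost_everywhere mu P -> almost_everywhere mu Q -> almost_everywhere mu S.
Proof.
move=> h [N1 [mN1 N10 h1]] [N2 [mN2 N20 h2]]; exists (N1 `|` N2); split.
- exact: measurableU.
- by rewrite measureU0.
- move=> x /= nS; apply: contrapT => /not_orP[n1 n2]; apply: nS.
  by apply: h; apply: contrapT => /= c; [apply: n1; exact: h1|apply: n2; exact: h2].
Qed.

Section compact_support.
Variables (f : R -> R[i]) (a : R).
Hypotheses (Lf : L2 mu f) (a0 : 0 < a).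
Hypothesis fa : {ae mu, forall x : T, x < a -> f x = 0}.

Let fpos : almost_everywhere mu (fun x : T => 0 < x /\ (x < a -> f x = 0)).
Proof. by apply: ae2 ae_pos fa => x. Qed.

Let bnd : (\int[mu]_x (normc (f x) ^+ 2 / `|x|)%:E < +oo)%E.
Proof.
have [mf fi] := (L2P mu f).1 Lf.
apply: (@le_lt_trans _ _ (a^-1%:E * I2 mu f)%E); last first.
  by rewrite lte_mul_pinfty// lee_fin invr_ge0 ltW.
rewrite /I2 -ge0_integralZl//; last 3 first.
- by apply/measurable_EFinP; exact: mC_sq.
- by move=> x _; rewrite lee_fin sqr_ge0.
- by rewrite lee_fin invr_ge0 ltW.
apply: ae_ge0_le_integral => //.
- by move=> x _; rewrite lee_fin divr_ge0 ?sqr_ge0.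
- apply/measurable_EFinP; apply: measurable_funM; first exact: mC_sq.
  by apply: (measurableT_comp (@measurable_inv R)); exact: normr_measurable.
- by move=> x _; rewrite mule_ge0 ?lee_fin ?sqr_ge0// invr_ge0 ltW.
- by apply: emeasurable_funM; [exact: measurable_cst|apply/measurable_EFinP; exact: mC_sq].
- apply: (ae_sub _ fpos) => x [x0 xa] _; rewrite -EFinM lee_fin.
  have [/xa ->|ax] := ltP x a; first by rewrite normc0 expr0n/= mulr0 mul0r.
  by rewrite mulrC ler_wpM2r ?sqr_ge0// gtr0_norm// lef_pV2 ?posrE.
Qed.

Lemma L2_inv_mul : L2 mu (fun x => (x^-1)%:C * f x).
Proof.
have [mf fi] := (L2P mu f).1 Lf.
apply: (L2_le (c := a^-1 ^+ 2) _ Lf); rewrite ?sqr_ge0//.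
  by apply: mCM => //; apply: mC_real; exact: measurable_inv.
apply: (ae_sub _ fpos) => x [x0 xa]; rewrite normcM exprMn.
have [/xa ->|ax] := ltP x a; first by rewrite normc0 expr0n/= !mulr0.
rewrite ler_wpM2r ?sqr_ge0//; apply: sqr_mono; rewrite ?normc_ge0//.
by rewrite normc_real gtr0_norm ?invr_gt0// lef_pV2 ?posrE.
Qed.

Lemma L2_comp_scale : L2 mu (fun x => f (x * q)).
Proof.
have [mf fi] := (L2P mu f).1 Lf; apply/L2P; split; first exact: mC_scale.
rewrite /I2 (_ : integral _ _ _ = (\int[mu]_x (normc (f x) ^+ 2 / `|x|)%:E)%E) //.
have m1 : measurable_fun [set: T] (fun x => normc (f x) ^+ 2 / `|x|).
  apply: measurable_funM; first exact: mC_sq.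
  by apply: (measurableT_comp (@measurable_inv R)); exact: normr_measurable.
rewrite [RHS](int_scale m1); apply: ge0_ae_eq_integral => //.
- by apply/measurable_EFinP; apply: mC_sq; exact: mC_scale.
- apply/measurable_EFinP; apply: measurable_funM; first exact: measurable_absq.
  by apply: (measurableT_comp m1); exact: mulrr_measurable.
- by move=> x _; rewrite lee_fin sqr_ge0.
- by move=> x _; rewrite lee_fin !mulr_ge0 ?invr_ge0 ?normc_ge0.
- apply: (ae_sub _ ae_pos) => x x0 _; congr (_%:E).
  rewrite normrM (gtr0_norm x0) (gtr0_norm q_gt0); field.
  by rewrite q_neq0 gt_eqF.
Qed.

Lemma L2_inv_comp_scaleV : L2 mu (fun x => (x^-1)%:C * f (x / q)).
Proof.
have [mf fi] := (L2P mu f).1 Lf.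
have mm : mC (fun x => (x^-1)%:C * f (x / q)).
  by apply: mCM; [apply: mC_real; exact: measurable_inv|exact: mC_scale].
have m1 : measurable_fun [set: T] (fun x => normc (f x) ^+ 2 / `|x|).
  apply: measurable_funM; first exact: mC_sq.
  by apply: (measurableT_comp (@measurable_inv R)); exact: normr_measurable.
apply/L2P; split => //.
rewrite /I2 int_scale; last exact: mC_sq.
rewrite (_ : integral _ _ _ = (q^-1%:E * \int[mu]_x (normc (f x) ^+ 2 / `|x|)%:E)%E).
  by rewrite lte_mul_pinfty// lee_fin invr_ge0.
rewrite -ge0_integralZl//; last 3 first.
- exact/measurable_EFinP.
- by move=> x _; rewrite lee_fin divr_ge0 ?sqr_ge0.
- by rewrite lee_fin invr_ge0.
apply: ge0_ae_eq_integral => //.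
- apply/measurable_EFinP; apply: measurable_funM; first exact: measurable_absq.
  by apply: (measurableT_comp (mC_sq mm)); exact: mulrr_measurable.
- by apply: emeasurable_funM; [exact: measurable_cst|exact/measurable_EFinP].
- by move=> x _; rewrite lee_fin !mulr_ge0 ?normc_ge0.
- by move=> x _; rewrite mule_ge0 ?lee_fin ?invr_ge0// divr_ge0 ?sqr_ge0.
- apply: (ae_sub _ ae_pos) => x x0 _; rewrite -EFinM; congr (_%:E).
  rewrite mulfK// normcM normc_real exprMn real_normK ?num_real// (gtr0_norm x0).
  by field; rewrite q_neq0 gt_eqF.
Qed.

(** Summation by parts on each orbit: [L] is formally symmetric. *)
Lemma qdiff_symmetric g : L2 mu g ->
  [/\ cint mu (fun x => qdiff q f x * (g x)^*),
      cint mu (fun x => f x * (qdiff q g x)^*) &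
      cintegral mu (fun x => qdiff q f x * (g x)^*) =
      cintegral mu (fun x => f x * (qdiff q g x)^*)].
Proof.
move=> Lg; have mf := L2_mC Lf; have mg := L2_mC Lg; have Lgc := L2_conj Lg.
pose t1 x := f (x * q) * (g x)^*.
pose t2 x := (x^-1)%:C * f x * (g x)^*.
pose t3 x := (x^-1)%:C * f (x / q) * (g x)^*.
pose s1 x := (x^-1)%:C * f x * (g (x / q))^*.
pose s3 x := f x * (g (x * q))^*.
have c1 : cint mu t1 := cintM L2_comp_scale Lgc.
have c2 : cint mu t2 := cintM L2_inv_mul Lgc.
have c3 : cint mu t3 := cintM L2_inv_comp_scaleV Lgc.
have mi := mC_real (@measurable_inv R).
have m1 : mC s1.
  by apply: mCM; [exact: mCM|apply: mC_conj; exact: mC_scale].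
have m3 : mC s3 by apply: mCM => //; apply: mC_conj; exact: mC_scale.
have e1 : eqL2 mu t1 (rescale s1).
  apply: (ae_sub _ ae_pos) => x x0; rewrite /t1 /rescale /s1 mulfK// (gtr0_norm x0).
  rewrite mulrA mulrA -rmorphM/= divff ?mulf_neq0 ?gt_eqF// rmorph1 mul1r//.
have e3 : eqL2 mu s3 (rescale t3).
  apply: (ae_sub _ ae_pos) => x x0; rewrite /s3 /rescale /t3 mulfK// (gtr0_norm x0).
  rewrite mulrA mulrA -rmorphM/= divff ?mulf_neq0 ?gt_eqF// rmorph1 mul1r//.
have d1 : cint mu s1.
  by apply/(cint_rescale m1); apply: cint_ae e1 c1; exact: mC_rescale.
have d3 : cint mu s3.
  apply: (@cint_ae (rescale t3)) => //; last by apply/cint_rescale => //; case: c3.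
  by apply: (ae_sub _ e3) => x ->.
have E1 : (fun x => qdiff q f x * (g x)^*) = (fun x => t1 x - t2 x + t3 x).
  by apply/funext => x; rewrite /qdiff /t1 /t2 /t3 mulrDl mulrBl.
have E2 : (fun x => f x * (qdiff q g x)^*) = (fun x => s3 x - t2 x + s1 x).
  apply/funext => x; rewrite qdiff_conj /s3 /t2 /s1 mulrDr mulrBr.
  by rewrite ![f x * (_ * _)]mulrA ![f x * _%:C]mulrC.
rewrite E1 E2; split.
- by apply: cintD => //; apply: cintD => //; exact: cintN.
- by apply: cintD => //; apply: cintD => //; exact: cintN.
- have i12 : cint mu (fun x => t1 x - t2 x) by apply: cintD => //; exact: cintN.
  have i32 : cint mu (fun x => s3 x - t2 x) by apply: cintD => //; exact: cintN.
  rewrite !cintegralD ?cintegralN//; try exact: cintN.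
  rewrite (eq_cintegral _ _ e1) ?cintegral_rescale//; try by [case: c1|exact: mC_rescale].
  rewrite (eq_cintegral _ _ e3) ?cintegral_rescale//; try by [case: c3|apply: mC_rescale; case: c3].
  by rewrite addrAC [in RHS]addrAC [cintegral mu s1 + _]addrC.
Qed.

End compact_support.

Lemma compactly_supported_low f : compactly_supported mu f ->
  exists2 a : R, 0 < a & {ae mu, forall x : T, x < a -> f x = 0}.
Proof.
move=> [a [b [a0 ab fab]]]; exists a => //; apply: (ae_sub _ fab) => x h xa.
by apply: h => /andP[+ _]; rewrite leNgt xa.
Qed.

Lemma L2_bounded f c : mC f -> (forall x, normc (f x) ^+ 2 <= c) -> L2 mu f.
Proof.
move=> mf fc; have c0 : 0 <= c by apply: le_trans (fc 0); rewrite sqr_ge0.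
apply/L2P; split => //; apply: (@le_lt_trans _ _ (\int[mu]_x (cst c%:E x))%E).
  apply: ge0_le_integral => //.
  - by move=> x _; rewrite lee_fin sqr_ge0.
  - by apply/measurable_EFinP; exact: mC_sq.
  - by move=> x _; rewrite lee_fin.
by rewrite integral_cst// lte_mul_pinfty// ?lee_fin//; case: Hmu.
Qed.

(** The adjoint is the maximal operator: its domain consists of the [L^2]
    functions on which the difference expression is again in [L^2]. *)
Lemma adjointP g h : adjoint mu (Lop mu q) (g, h) <->
  [/\ L2 mu g, L2 mu h & eqL2 mu h (qdiff q g)].
Proof.
split=> [[/= Lg Lh adj]|[Lg Lh gh]]; last first.
  split=> //= f f' [/= Lf cf ->]; have [a a0 fa] := compactly_supported_low cf.
  have [c1 c2] := qdiff_symmetric Lf a0 fa Lg; rewrite /ipL2 => ->.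
  have mf := L2_mC Lf; have mg := L2_mC Lg; have mh := L2_mC Lh.
  apply: eq_cintegral; try by apply: mCM => //; apply: mC_conj => //; exact: mC_qdiff.
  by apply: (ae_sub _ gh) => x ->.
split=> //; have mg := L2_mC Lg; have mh := L2_mC Lh.
pose k x := qdiff q g x - h x.
have mk : mC k by apply: mCB => //; exact: mC_qdiff.
have main n : {ae mu, forall x : T, n.+1%:R^-1 <= x <= n.+2%:R -> k x = 0}.
  pose a : R := n.+1%:R^-1; pose b : R := n.+2%:R.
  (* the weight u makes the test function u k bounded *)
  pose u x : R := if a <= x <= b then (1 + normc (k x) ^+ 2)^-1 else 0.
  have ab : a < b.
    apply: (@le_lt_trans _ _ 1); first by rewrite invf_le1 ?ltr0n// ler1n.
    by rewrite ltr1n.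
  have a0 : 0 < a by rewrite invr_gt0.
  have mP : measurable_fun [set: T] (fun x : T => a <= x <= b).
    by apply: measurable_and; apply: measurable_fun_ler => //; exact: measurable_cst.
  have mu_ : measurable_fun [set: T] u.
    apply: measurable_fun_ifT => //.
    apply: (measurableT_comp (@measurable_inv R)).
    by apply: measurable_funD; [exact: measurable_cst|exact: mC_sq].
  pose f x := (u x)%:C * k x.
  have mf : mC f by apply: mCM => //; exact: mC_real.
  have u0 x : 0 <= u x.
    by rewrite /u; case: ifP => // _; rewrite invr_ge0 addr_ge0 ?sqr_ge0.
  have uk x : u x * normc (k x) ^+ 2 <= 1.
    rewrite /u; case: ifP => _; last by rewrite mul0r.
    by rewrite mulrC ler_pdivrMr ?ltr_pwDl ?sqr_ge0// mul1r lerDr.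
  have u1 x : u x <= 1.
    rewrite /u; case: ifP => // _; rewrite invf_le1 ?ltr_pwDl ?sqr_ge0//.
    by rewrite lerDl sqr_ge0.
  have fu x : normc (f x) ^+ 2 = u x * (u x * normc (k x) ^+ 2).
    by rewrite /f normcM normc_real ger0_norm// exprMn; ring.
  have Lf : L2 mu f.
    apply: (@L2_bounded _ 1) => // x; rewrite fu mulr_ile1// mulr_ge0 ?sqr_ge0//.
  have cf : compactly_supported mu f.
    exists a, b; split => //; apply: aeW => x /negP/negbTE xab.
    by rewrite /f /u xab mul0r.
  have [a' a'0 fa] := compactly_supported_low cf.
  have [c1 c2 c3] := qdiff_symmetric Lf a'0 fa Lg.
  have := adj f (qdiff q f) (And3 Lf cf erefl); rewrite /ipL2 c3.
  have cfh : cint mu (fun x => f x * (h x)^*) := cintM Lf (L2_conj Lh).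
  move=> /eqP; rewrite -subr_eq0 -cintegralB// => /eqP.
  have -> : (fun x => f x * (qdiff q g x)^* - f x * (h x)^*) =
      (fun x => (u x * normc (k x) ^+ 2)%:C).
    apply/funext => x; rewrite -mulrBr -rmorphB/= -/(k x) /f -mulrA rmorphM/=.
    congr (_ * _); case: (k x) => r s; rewrite normc_sqr.
    by apply/eqP; rewrite eq_complex/=; apply/andP; split; apply/eqP; ring.
  rewrite /cintegral/= => -[+ _]; rewrite /Rintegral => h0.
  have m2 : measurable_fun [set: T] (fun x => u x * normc (k x) ^+ 2).
    by apply: measurable_funM => //; exact: mC_sq.
  have h1 : (\int[mu]_x (u x * normc (k x) ^+ 2)%:E = 0)%E.
    move/eqP: h0; rewrite fine_eq0; first by move/eqP.
    rewrite ge0_fin_numE; last by apply: integral_ge0 => x _; rewrite lee_fin mulr_ge0 ?sqr_ge0.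
    apply: (@le_lt_trans _ _ (\int[mu]_x (cst 1%E x))%E).
      apply: ge0_le_integral => //.
      - by move=> x _; rewrite lee_fin mulr_ge0 ?sqr_ge0.
      - exact/measurable_EFinP.
      - by move=> x _; rewrite lee_fin.
    by rewrite integral_cst// mul1e; case: Hmu.
  have h2 : ae_eq mu [set: T] (fun x => (u x * normc (k x) ^+ 2)%:E) (cst 0%E).
    apply/ae_eq_integral_abs => //; first exact/measurable_EFinP.
    rewrite -[RHS]h1; apply: eq_integral => x _.
    by rewrite gee0_abs// lee_fin mulr_ge0 ?sqr_ge0.
  apply: (ae_sub _ h2) => x /(_ I) [] /eqP + xab; rewrite /u xab.
  rewrite mulf_eq0 invr_eq0 gt_eqF ?ltr_pwDl ?sqr_ge0//= expf_eq0/= => /eqP.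
  exact: eq0_normc.
apply: (ae2 _ ae_pos (ae_foralln main)) => x x0 hx; apply/eqP.
rewrite eq_sym -subr_eq0; apply/eqP.
pose n := (Num.bound x + Num.bound x^-1)%N; apply: (hx n); apply/andP; split.
  rewrite -[x]invrK lef_pV2 ?posrE ?invr_gt0//.
  apply: le_trans (ltW (archi_boundP _)) _; first by rewrite invr_ge0 ltW.
  by rewrite ler_nat /n; lia.
apply: le_trans (ltW (archi_boundP (ltW x0))) _.
by rewrite ler_nat /n; lia.
Qed.

End adjoint.

(** * The resolvent as a Green operator *)

Section series.
Context {R : realType}.
Local Notation T := (measurableTypeR R).
Variable mu : {measure set T -> \bar R}.

Lemma sum_half_le n : \sum_(i < n) (2^-1 : R) ^+ i <= 2.
Proof.
have -> : \sum_(i < n) (2^-1 : R) ^+ i = 2 - 2 * 2^-1 ^+ n.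
  elim: n => [|n IH]; first by rewrite big_ord0 expr0 mulr1 subrr.
  by rewrite big_ord_recr/= IH exprS; field.
by rewrite gerBl mulr_ge0// exprn_ge0// invr_ge0.
Qed.

(** Terms decaying geometrically in [L^2] may be summed pointwise: with weights
    [4^d] their squares still have an integrable sum, so that for almost every
    [x] they are bounded by a multiple of [2^-d]. *)
Lemma L2_series (u : nat -> R -> R[i]) (B : R) : (forall d, mC (u d)) ->
  (forall d, I2 mu (u d) <= (16^-1 ^+ d * B)%:E)%E ->
  {ae mu, forall x, summ (fun d => u d x)} /\
  (I2 mu (fun x => csum (fun d => u d x)) <= (8 * B)%:E)%E.
Proof.
move=> mu_ uB.
pose g d x := (4 ^+ d * normc (u d x) ^+ 2)%:E.
have g0 d x : (0 <= g d x)%E by rewrite lee_fin mulr_ge0 ?sqr_ge0 ?exprn_ge0.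
have mg d : measurable_fun [set: T] (g d).
  by apply/measurable_EFinP; apply: measurable_funM => //; exact: mC_sq.
have B0 : 0 <= B.
  by have := le_trans (I2_ge0 mu _) (uB 0); rewrite lee_fin expr0 mul1r.
pose G x := (\sum_(0 <= d <oo) g d x)%E.
have mG : measurable_fun [set: T] G by apply: ge0_emeasurable_sum.
have G0 x : (0 <= G x)%E by apply: nneseries_ge0.
have IG : (\int[mu]_x G x <= (2 * B)%:E)%E.
  rewrite /G integral_nneseries//.
  apply: lime_le; first by apply: is_cvg_nneseries => n _ _; exact: integral_ge0.
  apply: nearW => n.
  apply: (@le_trans _ _ (\sum_(0 <= d < n) (2^-1 ^+ d * B)%:E)%E).
    apply: lee_sum => d _; rewrite /g.
    under eq_integral do rewrite EFinM.
    rewrite ge0_integralZl//; last 2 first.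
    - by apply/measurable_EFinP; exact: mC_sq.
    - by move=> x _; rewrite lee_fin sqr_ge0.
    apply: (@le_trans _ _ ((4 ^+ d)%:E * (16^-1 ^+ d * B)%:E)%E).
      by rewrite lee_wpmul2l ?lee_fin ?exprn_ge0//; exact: uB.
    rewrite -EFinM lee_fin mulrA ler_wpM2r// -exprMn lerXn2r// ?nnegrE; lra.
  rewrite sumEFin lee_fin -mulr_suml ler_wpM2r// big_mkord; exact: sum_half_le.
have iG : mu.-integrable [set: T] G.
  apply/integrableP; split => //.
  under eq_integral do rewrite gee0_abs//.
  exact: le_lt_trans IG (ltry _).
have pt x (r : R) : G x = r%:E ->
    summ (fun d => u d x) /\ normc (csum (fun d => u d x)) ^+ 2 <= 4 * r.
  move=> Gr; have r0 : 0 <= r by rewrite -lee_fin -Gr.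
  have hd d : normc (u d x) <= Num.sqrt r * 2^-1 ^+ d.
    have : (g d x <= r%:E)%E.
      rewrite -Gr /G (@nneseriesD1 _ _ d)//.
      by apply: leeDl; apply: nneseries_ge0 => *.
    rewrite lee_fin exprVn ler_pdivlMr ?exprn_gt0// => h.
    rewrite -[leLHS]ger0_norm ?mulr_ge0 ?normc_ge0 ?exprn_ge0//.
    rewrite -sqrtr_sqr ler_wsqrtr// exprMn mulrC -exprM mulnC exprM.
    by rewrite (_ : 2 ^+ 2 = 4 :> R)//; ring.
  have s : summ (fun d => u d x) by exists (Num.sqrt r).
  split => //; have : normc (csum (fun d => u d x)) <= Num.sqrt r * 2.
    apply: csum_le => // n; apply: le_trans (_ : \sum_(i < n) Num.sqrt r * 2^-1 ^+ i <= _).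
      exact: ler_sum.
    by rewrite -mulr_sumr ler_wpM2l ?sqrtr_ge0// sum_half_le.
  move/(sqr_mono (normc_ge0 _)) => /le_trans; apply.
  by rewrite exprMn sqr_sqrtr//; lra.
have aG := integrable_ae measurableT iG.
split; first by apply: (ae_sub _ aG) => x /(_ I) /fineK /esym/pt[].
have mS : mC (fun x => csum (fun d => u d x)) by exact: mC_csum.
apply: (@le_trans _ _ (4%:E * (2 * B)%:E)%E); last first.
  by rewrite -EFinM lee_fin mulrA ler_wpM2r//; lra.
apply: le_trans (_ : (4%:E * \int[mu]_x G x)%E <= _)%E; last first.
  by rewrite lee_wpmul2l.
rewrite -ge0_integralZl//; apply: ae_ge0_le_integral => //.
- by move=> x _; rewrite lee_fin sqr_ge0.
- by apply/measurable_EFinP; exact: mC_sq.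
- by move=> x _; rewrite mule_ge0.
- exact: emeasurable_funM.
- apply: (ae_sub _ aG) => x /(_ I) /fineK Gf _; have [_] := pt _ _ (esym Gf).
  by rewrite -Gf -EFinM lee_fin.
Qed.

End series.

Section green.
Context {R : realType} (q : R).
Local Notation T := (measurableTypeR R).
Variable lam : R[i].
Hypotheses (q_gt0 : 0 < q) (q_lt1 : q < 1) (lam0 : lam != 0).
Local Notation Q := (q%:C).
Local Notation F := (phi11 q lam^-1).
Local Notation H := (casoratian q lam^-1).
Local Notation Wt := (orbit_weight q).
Implicit Types (x : R) (h : R -> R[i]).

Let q_ge0 : 0 <= q. Proof. exact: ltW. Qed.
Let q_neq0 : q != 0. Proof. by rewrite gt_eqF. Qed.
Let Qn0 : Q != 0. Proof. exact: Q_neq0. Qed.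
Let C0 x : x != 0 -> x%:C != 0 :> R[i].
Proof. by apply: contra => /eqP[] /eqP. Qed.

(** The solution recessive at infinity, divided by the Casoratian; this quotient
    does not depend on the numbering of the orbit. *)
Definition gminus x : R[i] := F (lam * x%:C)^-1 / (lam * H (lam * x%:C)).

(** [kern d x] is the Green kernel between [x] and [x q^d], up to the weight. *)
Definition kern d x : R[i] := F (lam * x%:C * Q ^+ d) * gminus x.

Definition up h d x : R[i] := kern d x * (Wt d x)%:C * h (x * q ^+ d).

Definition dn h d x : R[i] := kern d (x / q ^+ d) * h (x / q ^+ d).

(** The terms [up] and [dn] sum the contributions of [h] at the points of the
    orbit below [x] and above [x]; the diagonal is counted in [dn] only. *)
Definition green h x : R[i] :=
  - (csum (fun d => up h d.+1 x) + csum (fun d => dn h d x)).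

(** The instance [z = lam x] of [F_eq]. *)
Lemma phi_rec x : x != 0 -> F (lam * (x * q)%:C) =
  (lam + (x^-1)%:C) * F (lam * x%:C) - (x^-1)%:C * F (lam * (x / q)%:C).
Proof.
move=> x0; have e := F_eq q_gt0 q_lt1 lam^-1 (lam * x%:C).
rewrite !rmorphM/= !fmorphV/=.
rewrite !(mulrA lam) e (_ : lam^-1 * (lam * _) = x%:C); last by rewrite mulKf.
rewrite (mulrC Q).
by move: (F _) (F _) => u v; field; rewrite C0.
Qed.

Lemma gminus_rec x : x != 0 -> H (lam * x%:C) != 0 -> gminus (x * q) =
  (x * q)%:C * ((lam + (x^-1)%:C) * gminus x - gminus (x / q)).
Proof.
move=> x0 Hx; rewrite /gminus.
have lx0 : lam * x%:C != 0 by rewrite mulf_neq0 ?C0.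
have lq0 : lam * x%:C * Q != 0 by rewrite mulf_neq0.
have := H_div q_gt0 q_lt1 lam^-1 lx0; have := H_div q_gt0 q_lt1 lam^-1 lq0.
rewrite mulfK// !rmorphM/= !fmorphV/= !(mulrA lam) => e1 e2.
have e3 : H (lam * x%:C * Q) = H (lam * x%:C) / (lam * x%:C * Q).
  by rewrite e1 [RHS]mulrC mulKf.
rewrite e2 e3; have := F_eq q_gt0 q_lt1 lam^-1 (lam * x%:C)^-1.
rewrite (_ : (lam * x%:C / Q)^-1 = Q * (lam * x%:C)^-1); last first.
  by rewrite invfM invrK mulrC.
rewrite (_ : (lam * x%:C * Q)^-1 = (lam * x%:C)^-1 / Q); last by rewrite [LHS]invfM.
move=> ->; move: (F _) (F _) (H _) Hx => u v w w0; field.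
by rewrite w0 lam0 Qn0 C0.
Qed.

(** The normalization of the Green kernel: the jump on the diagonal. *)
Lemma casorati x : x != 0 -> H (lam * x%:C) != 0 ->
  gminus (x / q) * F (lam * x%:C) =
  (x^-1)%:C * F (lam * (x / q)%:C) * gminus x - 1.
Proof.
move=> x0 Hx; rewrite /gminus.
have lx0 : lam * x%:C != 0 by rewrite mulf_neq0 ?C0.
have := H_div q_gt0 q_lt1 lam^-1 lx0.
rewrite !rmorphM/= !fmorphV/= !(mulrA lam) => e2; rewrite e2.
move: e2; rewrite {1}casoratian.unlock.
rewrite (_ : (lam * x%:C / Q)^-1 / Q = (lam * x%:C)^-1); last first.
  by rewrite invfM invrK mulfK.
rewrite (_ : Q * (lam * x%:C / Q) = lam * x%:C); last by rewrite mulrCA divff// mulr1.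
move: (F (lam * x%:C / Q)) (F (lam * x%:C)^-1) (F (lam * x%:C)).
move: (F (lam * x%:C / Q)^-1) (H _) Hx => g2 w w0 f2 g f e.
have {e} e : g2 * f = lam * (f2 * g - lam * x%:C * w).
  by rewrite -e; field.
rewrite mulrAC e; field.
by rewrite w0 lam0 C0.
Qed.

Lemma csum_lin3 (u v w : nat -> R[i]) b c : summ u -> summ v -> summ w ->
  (forall d, u d = b * v d - c * w d) -> csum u = b * csum v - c * csum w.
Proof.
move=> su sv sw e; rewrite (eq_csum e) csumD ?csumZ//; last 2 first.
- exact: summZ.
- by under eq_fun do rewrite -mulNr; exact: summZ.
by congr (_ + _); under eq_csum do rewrite -mulNr; rewrite csumZ// mulNr.
Qed.

Lemma WtS_div d x : 0 < x -> Wt d.+1 (x / q) = x * Wt d x.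
Proof.
move=> x0; rewrite /orbit_weight !gtr0_norm ?divr_gt0// triS exprD expr_div_n !exprS.
by field; rewrite expf_neq0.
Qed.

Lemma WtS x d : 0 < x -> Wt d.+1 x = x * q * Wt d (x * q).
Proof.
move=> x0; have := WtS_div d (mulr_gt0 x0 q_gt0); rewrite mulfK//.
Qed.

Variable h : R -> R[i].
Let F1 x := F (lam * x%:C).
Let E x d := F1 (x * q ^+ d) * (Wt d x)%:C * h (x * q ^+ d).
Let D x d := gminus (x / q ^+ d) * h (x / q ^+ d).

Let upE d x : up h d x = gminus x * E x d.
Proof. by rewrite /up /kern /E /F1 QE -(mulrA lam) -rmorphM/=; ring. Qed.

Let upE_div d x : 0 < x -> up h d.+1 (x / q) = x%:C * gminus (x / q) * E x d.
Proof.
move=> x0; rewrite upE /E WtS_div// (_ : x / q * q ^+ d.+1 = x * q ^+ d); last first.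
  by rewrite exprS mulrA divfK.
by rewrite rmorphM/=; ring.
Qed.

Let upE_mul d x : 0 < x ->
  up h d (x * q) = gminus (x * q) / (x * q)%:C * E x d.+1.
Proof.
move=> x0; have e : x * q * q ^+ d = x * q ^+ d.+1 by rewrite exprS mulrA.
rewrite upE /E e WtS// !rmorphM/=; move: (F1 _) => f1.
by field; rewrite Qn0 C0// gt_eqF.
Qed.

Let dnE d x : dn h d x = F1 x * D x d.
Proof.
rewrite /dn /kern /D /F1 mulrA QE -(mulrA lam) -rmorphM/= divfK ?expf_neq0//.
Qed.

Let D_div d x : D (x / q) d = D x d.+1.
Proof. by rewrite /D -mulrA -invfM -exprS. Qed.

(** Off the zeros of the Casoratian, [green] inverts [L - lam]. Shifting the
    summation indices aligns the values at [x q], [x] and [x / q]; the bulk terms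
    cancel as both factors of the kernel solve the homogeneous equation, and the
    few terms near the diagonal add up to [h x] by [casorati]. *)
Lemma green_eq x : 0 < x -> H (lam * x%:C) != 0 ->
  (forall i : int, summ (fun d => up h d (x * q ^ i)) /\
                   summ (fun d => dn h d (x * q ^ i))) ->
  qdiff q (green h) x - lam * green h x = h x.
Proof.
move=> x0 Hx hs; have xn0 : x != 0 by rewrite gt_eqF.
have [ux dx] := hs 0; have [uq dq] := hs 1; have [uV dV] := hs (-1).
rewrite expr0z mulr1 in ux dx; rewrite expr1z in uq dq; rewrite exprN1 in uV dV.
pose l := lam + (x^-1)%:C.
(* X and X' are the bulk cancellations, below and above x *)
have X : csum (fun d => up h d.+1 (x * q)) =
    l * csum (fun d => up h d.+2 x) - (x^-1)%:C * csum (fun d => up h d.+3 (x / q)).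
  apply: csum_lin3 (summS uq) (summS (summS ux)) (summS (summS (summS uV))) _.
  move=> d; rewrite upE_mul// upE upE_div// gminus_rec// !(rmorphM, fmorphV)/=.
  by rewrite /l fmorphV/=; field; rewrite Qn0 C0.
have X' : csum (fun d => dn h d.+2 (x * q)) =
    l * csum (fun d => dn h d.+1 x) - (x^-1)%:C * csum (fun d => dn h d (x / q)).
  apply: csum_lin3 (summS (summS dq)) (summS dx) dV _.
  move=> d; rewrite !dnE -[in D (x * q) _]D_div mulfK// D_div.
  by rewrite /F1 phi_rec// /l; ring.
rewrite /qdiff /green.
rewrite (csum_recl dq) (csum_recl (summS dq)) X'.
rewrite (csum_recl (summS uV)) (csum_recl (summS (summS uV))).
rewrite (csum_recl (summS ux)) (csum_recl dx) X.
rewrite !upE_div// upE !dnE.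
have -> : D (x * q) 1 = D x 0 by rewrite -D_div mulfK.
have -> : E x 1 = F1 (x * q) * (x * q)%:C * h (x * q).
  rewrite /E !expr1 WtS// /orbit_weight expr0 mul1r bin_small// expr0 mulr1//.
have -> : E x 0 = F1 x * h x.
  by rewrite /E /orbit_weight !expr0 !mulr1.
have -> : D (x * q) 0 = gminus (x * q) * h (x * q) by rewrite /D expr0 divr1.
have -> : D x 0 = gminus x * h x by rewrite /D expr0 divr1.
rewrite gminus_rec//.
move: (csum _) (csum _) (csum _) (csum _) => A1 A2 A3 A4.
have := casorati xn0 Hx; rewrite -/(F1 x) -/(F1 (x / q)) => cas.
have := phi_rec xn0; rewrite -/(F1 x) -/(F1 (x / q)) -/(F1 (x * q)) => ph.
rewrite -[RHS]mul1r -[1 in RHS](subKr ((x^-1)%:C * F1 (x / q) * gminus x)) -cas /l ph.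
move: (F1 _) (F1 _) (gminus _) (gminus _) => f1 f2 g1 g2.
by rewrite fmorphV/=; field; rewrite C0.
Qed.

End green.

Section resolvent.
Context {R : realType} (q : R).
Local Notation T := (measurableTypeR R).
Variable mu : {measure set T -> \bar R}.
Hypotheses (q_gt0 : 0 < q) (q_lt1 : q < 1) (Hmu : qscaling q mu).
Variable lam : R[i].
Hypotheses (lam0 : lam != 0) (lamQ : forall i, lam^-1 * q%:C ^+ i != 1).
Local Notation Q := (q%:C).
Local Notation F := (phi11 q lam^-1).
Local Notation H := (casoratian q lam^-1).
Local Notation Wt := (orbit_weight q).
Implicit Types (x : R) (h : R -> R[i]).

Let q_ge0 : 0 <= q. Proof. exact: ltW. Qed.
Let q_neq0 : q != 0. Proof. by rewrite gt_eqF. Qed.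
Let Qn0 : Q != 0. Proof. exact: Q_neq0. Qed.
Let C0 x : x != 0 -> x%:C != 0 :> R[i].
Proof. by apply: contra => /eqP[] /eqP. Qed.
Let ae_pos : {ae mu, forall x, 0 < x}. Proof. by case: Hmu. Qed.

Lemma away_mulqz (eps : R) (z : R[i]) (j : int) :
  away q eps z -> away q eps (z * (q ^ j)%:C).
Proof.
move=> h i; have := h (j + i); rewrite expfzDr// rmorphM/= !mulrA.
by rewrite normcM normc_real ger0_norm ?exprz_ge0.
Qed.

Variable eps : R.
Hypotheses (eps0 : 0 < eps) (eps1 : eps <= 1).

Lemma kern_bound : exists2 c, 0 <= c & forall d x, 0 < x -> away q eps (lam * x%:C) ->
  normc (kern q lam d x) ^+ 2 * Wt d x <= c * 16^-1 ^+ d.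
Proof.
have nl : 0 < normc lam by exact: normc_gt0.
have K0 : 0 <= 16 / normc lam by rewrite divr_ge0// ltW.
have [C C_0 hC] := kernel_bound q_gt0 q_lt1 eps0 eps1 lamQ K0.
exists (C / normc lam ^+ 2); first by rewrite divr_ge0// exprn_ge0// ltW.
move=> d x x0 hx; have lx0 : lam * x%:C != 0 by rewrite mulf_neq0 ?C0// gt_eqF.
have := hC _ d lx0 hx; rewrite exprVn ler_pdivlMr ?exprn_gt0//.
rewrite ler_pdivlMr ?exprn_gt0//.
rewrite (_ : _ / H _ = lam * kern q lam d x); last first.
  by rewrite /kern /gminus (invfM lam (H _)) 2!(mulrCA lam) mulVKf// mulrA.
move=> /(le_trans _); apply.
rewrite (normcM lam (kern _ _ _ _)) (normcM lam x%:C) normc_real /orbit_weight (gtr0_norm x0).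
set n := normc lam in nl *; set k := normc _; rewrite !exprMn exprVn.
rewrite le_eqVlt; apply/orP; left; apply/eqP; move: (16 ^+ d) => s.
by field; rewrite expf_neq0// gt_eqF.
Qed.

Let good h := forall x, h x != 0 -> 0 < x /\ away q eps (lam * x%:C).

Lemma good_orbit h x : good h -> ~ (0 < x /\ away q eps (lam * x%:C)) ->
  forall i : int, h (x * q ^ i) = 0.
Proof.
move=> gh nx i; apply/eqP; apply: contra_notT nx => /gh[].
rewrite pmulr_lgt0 ?exprz_gt0// => x0 /(away_mulqz (- i)).
by rewrite -mulrA -rmorphM/= -mulrA -expfzDr// subrr expr0z mulr1.
Qed.

Lemma mC_gminus : mC (gminus q lam).
Proof.
have m : mC (fun x : R => lam * x%:C) by apply: mCZ; apply: mC_real; exact: measurable_id.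
apply: mCM; first by apply: mC_F; exact: mC_inv.
by apply: mC_inv; apply: mCZ; exact: mC_H.
Qed.

Lemma mC_kern d : mC (kern q lam d).
Proof.
apply: mCM; last exact: mC_gminus.
apply: mC_F; apply: mCM; last exact: mC_cst.
by apply: mCZ; apply: mC_real; exact: measurable_id.
Qed.

Lemma mC_up h d : mC h -> mC (up q lam h d).
Proof.
move=> mh; apply: mCM; last exact: mC_scale.
by apply: mCM; [exact: mC_kern|apply: mC_real; exact: measurable_Wt].
Qed.

Lemma mC_dn h d : mC h -> mC (dn q lam h d).
Proof. by move=> mh; apply: mCM; apply: mC_scale => //; exact: mC_kern. Qed.

Lemma mC_green h : mC h -> mC (green q lam h).
Proof.
move=> mh; rewrite /green.
under eq_fun do rewrite -mulN1r.
apply: mCZ; apply: mCD.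
- by apply: (@mC_csum R (fun x d => up q lam h d.+1 x)) => d; exact: mC_up.
- by apply: (@mC_csum R (fun x d => dn q lam h d x)) => d; exact: mC_dn.
Qed.

(** By [kern_bound] the integrands are dominated pointwise by geometric
    multiples of the transported density of [h], whose integral does not depend
    on [d]. *)
Lemma I2_up_dn : exists2 c, 0 <= c & forall h d, mC h -> good h ->
  (I2 mu (up q lam h d) <= (c * 16^-1 ^+ d)%:E * I2 mu h)%E /\
  (I2 mu (dn q lam h d) <= (c * 16^-1 ^+ d)%:E * I2 mu h)%E.
Proof.
have [c c0 hc] := kern_bound; exists c => // h d mh gh.
have c16 : 0 <= c * 16^-1 ^+ d by rewrite mulr_ge0// exprn_ge0.
have mE : measurable_fun [set: T] (fun x => (normc (h x) ^+ 2)%:E).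
  by apply/measurable_EFinP; exact: mC_sq.
have mE0 x : (0%R <= (normc (h x) ^+ 2)%:E)%E by rewrite lee_fin sqr_ge0.
have mc (s : R) : measurable_fun [set: T] (fun x : T => (x * s : T)).
  exact: mulrr_measurable.
split.
- rewrite [in leRHS]/I2 (mu_scale q_gt0 Hmu d mE mE0) -ge0_integralZl//; last 2 first.
  + apply: emeasurable_funM; first exact: measurable_EWt.
    exact: (measurableT_comp mE (mc _)).
  + by move=> x _; rewrite mule_ge0 ?lee_fin ?sqr_ge0 ?Wt_ge0.
  apply: ge0_le_integral => //.
  + by move=> x _; rewrite lee_fin sqr_ge0.
  + by apply/measurable_EFinP; apply: mC_sq; exact: mC_up.
  + apply: emeasurable_funM; first exact: measurable_cst.
    apply: emeasurable_funM; first exact: measurable_EWt.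
    exact: (measurableT_comp mE (mc _)).
  + move=> x _; rewrite -!EFinM lee_fin /up normcM (normcM (kern _ _ _ _)) normc_real ger0_norm ?Wt_ge0//.
    have [[x0 ax]|nx] := pselect (0 < x /\ away q eps (lam * x%:C)); last first.
      have := good_orbit gh nx d; rewrite -exprnP => ->.
      by rewrite normc0 mulr0 expr0n/= !mulr0.
    set k := normc (kern _ _ _ _); set n := normc _.
    rewrite (_ : _ ^+ 2 = k ^+ 2 * Wt d x * (Wt d x * n ^+ 2)); last by ring.
    by rewrite ler_wpM2r ?hc// mulr_ge0 ?Wt_ge0 ?sqr_ge0.
- rewrite [in leRHS]/I2 (mu_scaleV q_gt0 Hmu d mE mE0) -ge0_integralZl//; last 2 first.
  + apply: emeasurable_funM; last exact: (measurableT_comp mE (mc _)).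
    apply/measurable_EFinP; apply: (measurableT_comp (@measurable_inv R)).
    exact: (measurableT_comp (measurable_Wt q d) (mc _)).
  + by move=> x _; rewrite mule_ge0 ?lee_fin ?invr_ge0 ?sqr_ge0 ?Wt_ge0.
  apply: ge0_le_integral => //.
  + by move=> x _; rewrite lee_fin sqr_ge0.
  + by apply/measurable_EFinP; apply: mC_sq; exact: mC_dn.
  + apply: emeasurable_funM; first exact: measurable_cst.
    apply: emeasurable_funM; last exact: (measurableT_comp mE (mc _)).
    apply/measurable_EFinP; apply: (measurableT_comp (@measurable_inv R)).
    exact: (measurableT_comp (measurable_Wt q d) (mc _)).
  + move=> x _; rewrite -!EFinM lee_fin /dn normcM exprMn; set y := x / q ^+ d.
    have [->|hy] := eqVneq (h y) 0; first by rewrite normc0 expr0n/= !mulr0.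
    have [y0 ay] := gh _ hy; rewrite mulrA ler_wpM2r ?sqr_ge0//.
    by rewrite ler_pdivlMr ?Wt_gt0 ?gt_eqF// hc.
Qed.

(** By [I2_up_dn] both sums of [green] converge in [L^2] and, on almost every
    orbit, at all points. On an orbit that is too close to [- 1 / lam] both [h]
    and [green h] vanish; on the others [green_eq] applies. *)
Lemma green_resolvent : exists2 M, 0 <= M & forall h, L2 mu h -> good h ->
  [/\ L2 mu (green q lam h), (I2 mu (green q lam h) <= (M ^+ 2)%:E * I2 mu h)%E &
      eqL2 mu h (fun x => qdiff q (green q lam h) x - lam * green q lam h x)].
Proof.
have [c c0 hc] := I2_up_dn; exists (Num.sqrt (32 * c)); first exact: sqrtr_ge0.
move=> h Lh gh; have mh := L2_mC Lh; rewrite sqr_sqrtr ?mulr_ge0//.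
have /fineK hfin : I2 mu h \is a fin_num by rewrite ge0_fin_numE ?L2_I2// I2_ge0.
set r := fine (I2 mu h) in hfin; have r0 : 0 <= r by rewrite fine_ge0// I2_ge0.
have [s1 b1] : _ /\ _ := @L2_series R mu (fun d => up q lam h d) (c * r)
  (fun d => mC_up d mh) ltac:(by move=> d; rewrite mulrCA mulrA EFinM hfin; apply: (hc h d mh gh).1).
have [_ b2] : _ /\ _ := @L2_series R mu (fun d => up q lam h d.+1) (c * r)
  (fun d => mC_up d.+1 mh) ltac:(
    move=> d; apply: le_trans (hc h d.+1 mh gh).1 _;
    rewrite -hfin -EFinM lee_fin mulrCA mulrA ler_wpM2r// ler_wpM2l//;
    rewrite exprS ler_piMl ?exprn_ge0//; lra).
have [s3 b3] : _ /\ _ := @L2_series R mu (fun d => dn q lam h d) (c * r)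
  (fun d => mC_dn d mh) ltac:(by move=> d; rewrite mulrCA mulrA EFinM hfin; apply: (hc h d mh gh).2).
have mg := mC_green mh.
have bnd : (I2 mu (green q lam h) <= (32 * c)%:E * I2 mu h)%E.
  rewrite -hfin -EFinM (_ : I2 mu (green q lam h) = I2 mu (fun x =>
    csum (fun d => up q lam h d.+1 x) + csum (fun d => dn q lam h d x))); last first.
    by apply: eq_integral => x _; rewrite /green normcN.
  apply: le_trans (I2D _ _ _) _.
  - by apply: (@mC_csum R (fun x d => up q lam h d.+1 x)) => d; exact: mC_up.
  - by apply: (@mC_csum R (fun x d => dn q lam h d x)) => d; exact: mC_dn.
  apply: (@le_trans _ _ (2%:E * ((8 * (c * r))%:E + (8 * (c * r))%:E))%E).
    by rewrite lee_wpmul2l// leeD.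
  by rewrite -EFinD -EFinM lee_fin; lra.
split => //.
  by apply/L2P; split => //; apply: le_lt_trans bnd _; rewrite -hfin -EFinM ltry.
have s13 : {ae mu, forall x, forall i : int,
    summ (fun d => up q lam h d (x * q ^ i)) /\ summ (fun d => dn q lam h d (x * q ^ i))}.
  apply: (ae2 _ (ae_orbit q_gt0 Hmu s1) (ae_orbit q_gt0 Hmu s3)) => x u v i.
  by split; [exact: u|exact: v].
apply: (ae2 _ ae_pos s13) =>  x x0 hs; have [ax|nx] := pselect (away q eps (lam * x%:C)).
    apply/esym; apply: green_eq => //.
    by apply: (H_neq0 q_gt0 q_lt1 eps0 eps1 lamQ) ax; rewrite mulf_neq0 ?C0// gt_eqF.
  have oz := @good_orbit h x gh (fun c => nx c.2).
  have gz i : green q lam h (x * q ^ i) = 0.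
    rewrite /green !(@csum_finite _ _ 0%N) ?big_ord0 ?addr0 ?oppr0// => d _.
      rewrite /dn (_ : _ / q ^+ d = x * q ^ (i - d%:Z)); first by rewrite oz mulr0.
      by rewrite expfzDr// mulrA exprnN.
    rewrite /up (_ : _ * q ^+ d.+1 = x * q ^ (i + d.+1%:Z)); first by rewrite oz mulr0.
    by rewrite expfzDr// mulrA.
  have := gz 0; have := gz 1; have := gz (-1); have := oz 0.
  rewrite /qdiff !expr0z !mulr1 expr1z exprN1 => -> -> -> ->.
  by rewrite !mulr0 subrr addr0 subrr.
Qed.

End resolvent.

(** * Orbits of the scaling, and uniqueness of eigenfunctions *)

Section orbit.
Context {R : realType} (q : R).
Local Notation T := (measurableTypeR R).
Hypotheses (q_gt0 : 0 < q) (q_lt1 : q < 1).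
Implicit Types (x : R) (lam : R[i]).

Let q_ge0 : 0 <= q. Proof. exact: ltW. Qed.
Let q_neq0 : q != 0. Proof. by rewrite gt_eqF. Qed.

Lemma le_qexpz (i j : int) : i <= j -> q ^ j <= q ^ i.
Proof.
move=> ij; have -> : j = i + `|j - i|%N by lia.
rewrite expfzDr// ler_piMr ?exprz_ge0// -exprnP exprn_ile1// ltW//.
Qed.

Lemma lnq_lt0 : ln q < 0. Proof. by rewrite ln_lt0// q_gt0. Qed.

Lemma exprz_expR (i : int) : q ^ i = expR (i%:~R * ln q).
Proof.
case: i => n; first by rewrite -exprnP -pmulrn expRM_natl lnK.
by rewrite NegzE -exprnN mulrNz mulNr expRN -pmulrn expRM_natl lnK.
Qed.

(** The number of powers of [q] separating [x] from the fundamental interval. *)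
Definition qlog x : int := Num.floor (ln x / ln q).

(** The representative in [(q, 1]] of the orbit of [x]. *)
Definition base x : R := x * q ^ (- qlog x).

Lemma base_itv x : 0 < x -> q < base x <= 1.
Proof.
move=> x0; have /andP[h1 h2] := floor_itv (ln x / ln q).
rewrite ler_ndivlMr ?lnq_lt0// in h1; rewrite ltr_ndivrMr ?lnq_lt0// in h2.
have b0 : 0 < base x by rewrite mulr_gt0 ?exprz_gt0.
have E : ln (base x) = ln x - (qlog x)%:~R * ln q.
  by rewrite lnM ?posrE ?exprz_gt0// exprz_expR expRK mulrNz mulNr.
rewrite -ltr_ln ?posrE// -ler_ln ?posrE// ln1 E; rewrite /qlog.
move: h1 h2; rewrite intrD mulrDl mul1r; lra.
Qed.

Lemma base_gt0 x : 0 < x -> 0 < base x.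
Proof. by move=> x0; rewrite mulr_gt0 ?exprz_gt0. Qed.

Lemma baseE x : 0 < x -> x = base x * q ^ qlog x.
Proof. by move=> x0; rewrite /base -mulrA -expfzDr// addNr expr0z mulr1. Qed.

Lemma base_scale x (i : int) : 0 < x -> base (x * q ^ i) = base x.
Proof.
move=> x0; suff -> : base (x * q ^ i) = x * q ^ i * q ^ (- (qlog x + i)).
  by rewrite -mulrA -expfzDr// /base; congr (_ * q ^ _); lia.
rewrite /base /qlog lnM ?posrE ?exprz_gt0// exprz_expR expRK mulrDl.
rewrite mulfK ?lt_eqF ?lnq_lt0// floorDrz ?intr_int//.
by rewrite intrKfloor.
Qed.

Lemma measurable_base : measurable_fun [set: T] (base : T -> T).
Proof.
have -> : base = fun x => x * expR (- (Num.floor (ln x / ln q))%:~R * ln q).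
  by apply/funext => x; rewrite /base exprz_expR mulrNz.
apply: measurable_funM => //.
apply: (measurableT_comp (@measurable_expR R)); apply: measurable_funM => //.
apply: measurableT_comp; first exact: oppr_measurable.
by apply: (measurableT_comp (@measurable_floor R)); apply: measurable_funM.
Qed.

Let C0 x : x != 0 -> x%:C != 0 :> R[i].
Proof. by apply: contra => /eqP[] /eqP. Qed.

(** Far out on the orbit the distance between [lam] and [- 1 / (x q^i)] is
    comparable to the larger of the two moduli; so an absolute distance gives a
    relative one. *)
Lemma away_of_gap lam x (delta : R) : lam != 0 -> 0 < x -> 0 < delta ->
  (forall i : int, delta <= normc (lam + ((x * q ^ i)^-1)%:C)) ->
  away q (Num.min 3^-1 (delta / (3 * normc lam))) (lam * x%:C).
Proof.
move=> l0 x0 d0 hd i; have n0 := normc_gt0 l0.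
have s0 : 0 < x * q ^ i by rewrite mulr_gt0 ?exprz_gt0.
have := hd i; set t := (x * q ^ i)^-1 => ht.
have t0 : 0 < t by rewrite invr_gt0.
have sE : x * q ^ i = t^-1 by rewrite invrK.
have -> : normc (1 + lam * x%:C * (q ^ i)%:C) = t^-1 * normc (lam + t%:C).
  have -> : t^-1 = normc (t^-1)%:C by rewrite normc_real gtr0_norm// invr_gt0.
  rewrite -normcM.
  congr normc; rewrite -mulrA -rmorphM/= sE mulrDr -rmorphM/= mulVf ?gt_eqF// rmorph1.
  by rewrite addrC mulrC.
rewrite normcM normc_real (gtr0_norm x0) -mulrA sE.
rewrite [leRHS]mulrC ler_pdivlMr// -mulrA (_ : (1 + normc lam / t) * t = t + normc lam); last first.
  by rewrite mulrDl mul1r divfK ?gt_eqF.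
have tri : t - normc lam <= normc (lam + t%:C).
  have := normc_triB t%:C (- lam); rewrite normcN normc_real gtr0_norm// opprK.
  by rewrite (addrC lam).
have [tl|lt] := leP t (2 * normc lam).
  apply: le_trans ht; apply: (@le_trans _ _ (delta / (3 * normc lam) * (t + normc lam))).
    by rewrite ler_wpM2r ?ge_min ?lexx ?orbT// addr_ge0// ltW.
  rewrite mulrAC ler_pdivrMr ?mulr_gt0// ler_wpM2l ?(ltW d0)//.
  lra.
apply: le_trans tri; apply: (@le_trans _ _ (3^-1 * (t + normc lam))).
  by rewrite ler_wpM2r ?ge_min ?lexx// addr_ge0// ltW.
lra.
Qed.

(** Only two consecutive points of the sequence [1 / (x q^i)] have a modulus
    between [q |lam|] and [|lam| / q]; the others are at a distance at least
    [(1 - q) |lam|]. *)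
Lemma orbit_gap lam x : lam != 0 -> 0 < x ->
  (forall i : int, lam + ((x * q ^ i)^-1)%:C != 0) ->
  exists2 delta, 0 < delta & forall i : int, delta <= normc (lam + ((x * q ^ i)^-1)%:C).
Proof.
move=> l0 x0 hx; have n0 := normc_gt0 l0.
have := base_itv (mulr_gt0 n0 x0); rewrite /base; move: (- qlog _) => j /andP[j1 j2].
set n := normc lam in n0 j1 j2 *.
pose t i := (x * q ^ i)^-1.
have t0 i : 0 < t i by rewrite invr_gt0 mulr_gt0 ?exprz_gt0.
have tn i : n * x * q ^ i = n / t i by rewrite /t invrK mulrA.
pose d := Num.min (n * (1 - q)) (Num.min (normc (lam + (t j)%:C)) (normc (lam + (t (j - 1))%:C))).
exists d; first by rewrite !lt_min !normc_gt0 ?hx// mulr_gt0// subr_gt0.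
move=> i; rewrite -/(t i).
have [->|ij] := eqVneq i j; first by rewrite /d !ge_min lexx !orbT.
have [->|ij1] := eqVneq i (j - 1); first by rewrite /d !ge_min lexx !orbT.
apply: (@le_trans _ _ (n * (1 - q))); first by rewrite /d ge_min lexx.
have tri1 : t i - n <= normc (lam + (t i)%:C).
  have := normc_triB (t i)%:C (- lam); rewrite normcN normc_real gtr0_norm// opprK.
  by rewrite (addrC lam).
have tri2 : n - t i <= normc (lam + (t i)%:C).
  have := normc_triB lam (- (t i)%:C); rewrite normcN normc_real gtr0_norm// opprK//.
have [ji|ij2] := leP (j + 1) i.
  apply: le_trans tri1.
  have : n * x * q ^ i <= q * 1.
    apply: (@le_trans _ _ (n * x * q ^ (j + 1))).
      by rewrite ler_wpM2l ?le_qexpz// mulr_ge0// ltW.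
    by rewrite expfzDr// expr1z mulrA mulrC ler_wpM2l.
  rewrite mulr1 tn ler_pdivrMr// => h.
  have nt : n <= t i by apply: le_trans h _; rewrite ler_piMl ?ltW.
  apply: (@le_trans _ _ (t i * (1 - q))); first by rewrite ler_wpM2r// subr_ge0 ltW.
  by rewrite mulrBr mulr1 lerD2l lerN2 mulrC.
apply: le_trans tri2.
have : 1 < q * (n * x * q ^ i).
  apply: (@lt_le_trans _ _ (q * (n * x * q ^ (j - 2)))); last first.
    rewrite ler_wpM2l ?ler_wpM2l ?le_qexpz ?mulr_ge0 ?(ltW n0) ?(ltW x0)//.
    by clear - ij ij1 ij2; lia.
  have e : q ^ j = q ^ (j - 2) * (q * q).
    by rewrite -expr2 exprnP -expfzDr// subrK.
  rewrite -(ltr_pM2l q_gt0) mulr1 (_ : q * (q * _) = n * x * q ^ j)//.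
  by rewrite e; ring.
rewrite tn mulrA ltr_pdivlMr// mul1r => h.
by rewrite mulrBr mulr1 lerD2l lerN2 mulrC ltW.
Qed.

Lemma mem_orbit_lattice lam (A : set T) : A = [set x | exists i : int,
    lam + ((x * q ^ i)^-1)%:C = 0] -> countable A.
Proof.
move=> ->; apply: (@sub_countable _ _ _ (range (fun i : int =>
  (- complex.Re lam)^-1 * q ^ (- i)))); last first.
  exact: sub_countable (card_image_le _ _) (countableP _).
apply: subset_card_le => x /= [i e]; exists i => //.
have {}e : - complex.Re lam = (x * q ^ i)^-1.
  by move: e; case: (lam) => a b [/eqP]; rewrite addr_eq0 => /eqP -> _; rewrite opprK.
by rewrite e invrK -mulrA -expfzDr// subrr expr0z mulr1.
Qed.

End orbit.

Section injectivity.
Context {R : realType} (q : R).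
Local Notation T := (measurableTypeR R).
Variable mu : {measure set T -> \bar R}.
Hypotheses (q_gt0 : 0 < q) (q_lt1 : q < 1) (Hmu : qscaling q mu).
Local Notation Q := (q%:C).
Local Notation Wt := (orbit_weight q).
Implicit Types (x : R) (f h : R -> R[i]).

Let q_ge0 : 0 <= q. Proof. exact: ltW. Qed.
Let q_neq0 : q != 0. Proof. by rewrite gt_eqF. Qed.
Let Qn0 : Q != 0. Proof. exact: Q_neq0. Qed.
Let C0 x : x != 0 -> x%:C != 0 :> R[i].
Proof. by apply: contra => /eqP[] /eqP. Qed.
Let ae_pos : {ae mu, forall x, 0 < x}. Proof. by case: Hmu. Qed.

(** The growth that square integrability allows along almost every orbit, up to
    geometric factors. *)
Definition orbit_growth f x (C : R) := forall d,
  normc (f (x * q ^+ d)) ^+ 2 * Wt d x <= C * 4 ^+ d /\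
  normc (f (x / q ^+ d)) ^+ 2 <= C * 4 ^+ d * Wt d (x / q ^+ d).

Let predz d : d.+1%:Z - 1 = d. Proof. lia. Qed.
Let succz d : d%:Z + 1 = d.+1. Proof. lia. Qed.
Let predNz d : - d%:Z - 1 = - d.+1%:Z. Proof. lia. Qed.
Let subz1 d : 1 - d.+1%:Z = - d%:Z. Proof. lia. Qed.
Let subz1_le d : 1 - d%:Z <= 1 :> int. Proof. lia. Qed.

Let unscale (a n C : R) d : n <= C * 2^-1 ^+ d -> 0 <= n ->
  n ^+ 2 = 16^-1 ^+ d * a -> a <= C ^+ 2 * 4 ^+ d.
Proof.
move=> nC n0 e; have := sqr_mono n0 nC; rewrite e exprMn -exprM mulnC exprM.
rewrite (_ : 2^-1 ^+ 2 = 4^-1 :> R); last by field.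
rewrite (_ : 16^-1 = 4^-1 * 4^-1 :> R); last by field.
have s0 : 0 < 4 ^+ d :> R by rewrite exprn_gt0.
rewrite exprMn !exprVn; move: (4 ^+ d) s0 => s s0 h.
rewrite -ler_pdivrMr//; rewrite ler_pdivlMr// in h.
rewrite (_ : a / s = s^-1 / s * a * s)//.
by field; rewrite gt_eqF.
Qed.

Let small_zero (z : R[i]) (A B : R) : 0 <= A -> 0 <= B ->
  (forall d, normc z ^+ 2 <= A * (q ^+ 'C(d.+1, 2) * B ^+ d)) -> z = 0.
Proof.
move=> A0 B0 hz; have [C C_0 hC] := tri_superexp q_gt0 q_lt1 B0.
suff : normc z ^+ 2 <= 0.
  by rewrite le_eqVlt ltNge sqr_ge0 orbF sqrf_eq0 => /eqP/eq0_normc.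
apply: (@le_geo_half _ _ _ (A * C)) => d; rewrite add0r -mulrA.
by apply: le_trans (hz d) _; rewrite ler_wpM2l.
Qed.

(** The values of [f] along the orbit, normalized by the weights, have the same
    [L^2] norm for all [d]; [L2_series] bounds them pointwise after damping by
    [4^-d]. *)
Lemma L2_orbit_growth f : L2 mu f -> {ae mu, forall x, exists C, orbit_growth f x C}.
Proof.
move=> Lf; have mf := L2_mC Lf.
have /fineK hfin : I2 mu f \is a fin_num by rewrite ge0_fin_numE ?L2_I2// I2_ge0.
set r := fine (I2 mu f) in hfin.
have mE : measurable_fun [set: T] (fun x => (normc (f x) ^+ 2)%:E).
  by apply/measurable_EFinP; exact: mC_sq.
have mE0 x : (0%R <= (normc (f x) ^+ 2)%:E)%E by rewrite lee_fin sqr_ge0.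
have mc (s : R) : measurable_fun [set: T] (fun x : T => (x * s : T)).
  exact: mulrr_measurable.
have msqrt : measurable_fun [set: R] (Num.sqrt : R -> R).
  by apply: continuous_measurable_fun; exact: sqrt_continuous.
pose u d x : R[i] := (4^-1 ^+ d * Num.sqrt (Wt d x))%:C * f (x * q ^+ d).
pose v d x : R[i] := (4^-1 ^+ d * Num.sqrt (Wt d (x / q ^+ d))^-1)%:C * f (x / q ^+ d).
have mu_ d : mC (u d).
  apply: mCM; last exact: mC_scale.
  apply: mC_real; apply: measurable_funM => //.
  by apply: (measurableT_comp msqrt); exact: measurable_Wt.
have mv d : mC (v d).
  apply: mCM; last exact: mC_scale.
  apply: mC_real; apply: measurable_funM => //.
  apply: (measurableT_comp msqrt); apply: (measurableT_comp (@measurable_inv R)).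
  exact: (measurableT_comp (measurable_Wt q d) (mc _)).
have sq (s t : R) (z : R[i]) d : 0 <= t ->
    normc ((4^-1 ^+ d * Num.sqrt t)%:C * z) ^+ 2 = 16^-1 ^+ d * (t * normc z ^+ 2).
  move=> t0; rewrite normcM normc_real exprMn real_normK ?num_real// exprMn sqr_sqrtr//.
  by rewrite -exprM mulnC exprM (_ : 4^-1 ^+ 2 = 16^-1 :> R) ?mulrA//; field.
have Iu d : (I2 mu (u d) <= (16^-1 ^+ d * r)%:E)%E.
  rewrite EFinM hfin [in leRHS]/I2 (mu_scale q_gt0 Hmu d mE mE0) -ge0_integralZl//; last 2 first.
  - by apply: emeasurable_funM; [exact: measurable_EWt|exact: (measurableT_comp mE (mc _))].
  - by move=> x _; rewrite mule_ge0 ?lee_fin ?sqr_ge0 ?Wt_ge0.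
  by rewrite le_eqVlt; apply/orP; left; apply/eqP; apply: eq_integral => x _;
    rewrite -!EFinM sq ?Wt_ge0.
have Iv d : (I2 mu (v d) <= (16^-1 ^+ d * r)%:E)%E.
  rewrite EFinM hfin [in leRHS]/I2 (mu_scaleV q_gt0 Hmu d mE mE0) -ge0_integralZl//; last 2 first.
  - apply: emeasurable_funM; last exact: (measurableT_comp mE (mc _)).
    apply/measurable_EFinP; apply: (measurableT_comp (@measurable_inv R)).
    exact: (measurableT_comp (measurable_Wt q d) (mc _)).
  - by move=> x _; rewrite mule_ge0 ?lee_fin ?invr_ge0 ?sqr_ge0 ?Wt_ge0.
  by rewrite le_eqVlt; apply/orP; left; apply/eqP; apply: eq_integral => x _;
    rewrite -!EFinM sq ?invr_ge0 ?Wt_ge0.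
have [su _] := L2_series mu_ Iu; have [sv _] := L2_series mv Iv.
apply: (ae2 _ ae_pos (ae2 (fun x => @conj _ _) su sv)) => x x0 [[C1 h1] [C2 h2]].
exists (C1 ^+ 2 + C2 ^+ 2) => d; rewrite mulrDl; split.
  apply: (@le_trans _ _ (C1 ^+ 2 * 4 ^+ d)).
    rewrite mulrC; apply: unscale (h1 d) (normc_ge0 _) _.
    by rewrite sq ?Wt_ge0.
  by rewrite lerDl mulr_ge0 ?sqr_ge0 ?exprn_ge0.
have y0 : 0 < Wt d (x / q ^+ d).
  by rewrite Wt_gt0// gt_eqF// divr_gt0// exprn_gt0.
rewrite -ler_pdivrMr//; apply: (@le_trans _ _ (C2 ^+ 2 * 4 ^+ d)).
  rewrite mulrC; apply: unscale (h2 d) (normc_ge0 _) _.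
  by rewrite sq ?invr_ge0 ?Wt_ge0.
by rewrite lerDr mulr_ge0 ?sqr_ge0 ?exprn_ge0.
Qed.

(** The Casoratian of [f] with a bounded solution. *)
Let cas_bound (a b u v : R[i]) (K : R) : normc u <= K -> normc v <= K ->
  normc (a * u - b * v) ^+ 2 <= 2 * K ^+ 2 * (normc a ^+ 2 + normc b ^+ 2).
Proof.
move=> uK vK; apply: le_trans (normcD_sqr _ _) _; rewrite normcN !normcM -mulrA ler_wpM2l//.
have hu := sqr_mono (normc_ge0 u) uK; have hv := sqr_mono (normc_ge0 v) vK.
by rewrite !exprMn mulrDr ![K ^+ 2 * _]mulrC; apply: lerD; rewrite ler_wpM2l ?sqr_ge0.
Qed.

(** A solution of the eigenvalue equation with the growth of an [L^2] function
    has vanishing Casoratians with both model solutions: these Casoratians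
    scale by the weight [Wt], while the growth of [f] allows only its square
    root. As the model solutions are independent at [x], [f x] vanishes. *)
Lemma eigen_zero lam f x : lam != 0 -> (forall i, lam^-1 * Q ^+ i != 1) -> 0 < x ->
  (forall i : int, qdiff q f (x * q ^ i) = lam * f (x * q ^ i)) ->
  (forall i : int, exists C, orbit_growth f (x * q ^ i) C) ->
  (forall i : int, lam + ((x * q ^ i)^-1)%:C != 0) -> f x = 0.
Proof.
move=> l0 lQ x0 fe fg nz; have xn0 : x != 0 by rewrite gt_eqF.
have xi0 (i : int) : 0 < x * q ^ i by rewrite mulr_gt0 ?exprz_gt0.
pose Fl z := phi11 q lam^-1 z.
have rec i : f (x * q ^ (i + 1)) = (lam + ((x * q ^ i)^-1)%:C) * f (x * q ^ i) -
    ((x * q ^ i)^-1)%:C * f (x * q ^ (i - 1)).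
  have := fe i; rewrite /qdiff !expfzDr// expr1z exprN1 !mulrA => e.
  by rewrite mulrDl -e; ring.
pose p i := Fl (lam * (x * q ^ i)%:C).
have precq i : p (i + 1) = (lam + ((x * q ^ i)^-1)%:C) * p i -
    ((x * q ^ i)^-1)%:C * p (i - 1).
  have := phi_rec q_gt0 q_lt1 l0 (lt0r_neq0 (xi0 i)).
  by rewrite /p !expfzDr// expr1z exprN1 !mulrA.
pose m i := Fl (lam * (x * q ^ i)%:C)^-1.
have mrec i : lam * m (i + 1) = (lam + ((x * q ^ i)^-1)%:C) * m i -
    (lam * (x * q ^ i)%:C)^-1 * m (i - 1).
  have x'0 : (x * q ^ i)%:C != 0 :> R[i] by rewrite C0// gt_eqF.
  rewrite /m !expfzDr// expr1z exprN1 !mulrA !(rmorphM _ (x * q ^ i)) !fmorphV/= !mulrA.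
  rewrite (_ : (lam * (x * q ^ i)%:C / Q)^-1 = Q * (lam * (x * q ^ i)%:C)^-1); last first.
    by rewrite [LHS]invfM invrK mulrC.
  rewrite (_ : (lam * (x * q ^ i)%:C * Q)^-1 = (lam * (x * q ^ i)%:C)^-1 / Q); last first.
    by rewrite [LHS]invfM.
  rewrite /Fl F_eq//; move: ((x * q ^ i)%:C) x'0 (phi11 _ _ _) (phi11 _ _ _) => xi x'0 u v.
  by field; rewrite l0 x'0.
have [Cf hf] := fg 0; rewrite expr0z mulr1 in hf.
have [Cq hq] := fg 1; rewrite expr1z in hq.
have Cf0 : 0 <= Cf.
  have := (hf 0%N).2; rewrite /orbit_weight !expr0 !mulr1; apply: le_trans; exact: sqr_ge0.
have Cq0 : 0 <= Cq.
  have := (hq 0%N).2; rewrite /orbit_weight !expr0 !mulr1; apply: le_trans; exact: sqr_ge0.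
have [C C1 hC] := F_le q_gt0 q_lt1 (normc_ge0 lam^-1).
have C_0 : 0 <= C by apply: le_trans C1.
have nl := normc_gt0 l0.
pose w i := f (x * q ^ (i + 1)) * p i - f (x * q ^ i) * p (i + 1).
have wrec i : w (i - 1) = (x * q ^ i)%:C * w i.
  rewrite /w subrK rec precq fmorphV/=; field; rewrite !C0 ?expfz_neq0//.
have wd (d : nat) : w 0 = (Wt d x)%:C * w d.
  elim: d => [|d ->]; first by rewrite /orbit_weight !expr0 !mulr1 rmorph1 mul1r.
  have := wrec d.+1; rewrite predz => ->; rewrite mulrA -rmorphM/=; congr (_%:C * _).
  by rewrite /orbit_weight gtr0_norm// triS exprD -exprnP !exprS; ring.
have w0 : w 0 = 0.
  pose K := C * ptheta q (normc lam * x).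
  have pK (d : nat) : normc (p d) <= K.
    apply: le_trans (hC _ _ (lexx _)) _; rewrite ler_wpM2l// le_ptheta// ?normc_ge0//.
    rewrite normcM normc_real gtr0_norm// ler_wpM2l ?normc_ge0// ler_piMr ?(ltW x0)//.
    by rewrite -exprnP exprn_ile1// ltW.
  apply: (@small_zero _ (2 * K ^+ 2 * (Cq + Cf)) (4 * x / q)) => [||d].
  - by rewrite mulr_ge0 ?addr_ge0// mulr_ge0// sqr_ge0.
  - by rewrite divr_ge0 ?mulr_ge0// ltW.
  have W0 : 0 < Wt d x by apply: Wt_gt0.
  have qd0 : 0 < q ^+ d by rewrite exprn_gt0.
  have h1 : normc (f (x * q ^ (d%:Z + 1))) ^+ 2 * Wt d x <= Cq * (4 / q) ^+ d.
    have := (hq d).1; rewrite (_ : Wt d (x * q) = Wt d x * q ^+ d); last first.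
      by rewrite /orbit_weight normrM exprMn (gtr0_norm q_gt0); ring.
    rewrite -mulrA (mulrC q) -exprSr exprMn exprVn.
    by move=> hh; rewrite [leRHS]mulrA ler_pdivlMr// succz -mulrA.
  have h2 : normc (f (x * q ^ d)) ^+ 2 * Wt d x <= Cf * (4 / q) ^+ d.
    apply: le_trans (hf d).1 _; rewrite ler_wpM2l// lerXn2r ?nnegrE ?divr_ge0//.
    by rewrite ler_pdivlMr// ler_piMr// ltW.
  rewrite (wd d) normcM normc_real gtr0_norm// exprMn.
  have h3 : normc (w d) ^+ 2 <= 2 * K ^+ 2 *
      (normc (f (x * q ^ (d%:Z + 1))) ^+ 2 + normc (f (x * q ^ d)) ^+ 2).
    apply: cas_bound; first exact: pK.
    by rewrite succz; exact: pK.
  apply: (@le_trans _ _ (Wt d x * (2 * K ^+ 2 * (Cq * (4 / q) ^+ d + Cf * (4 / q) ^+ d)))).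
    rewrite expr2 -mulrA ler_wpM2l ?(ltW W0)//.
    apply: le_trans (ler_wpM2l (ltW W0) h3) _.
    rewrite mulrCA; apply: ler_wpM2l; first by rewrite mulr_ge0// sqr_ge0.
    rewrite [leLHS]mulrDr.
    by apply: lerD; rewrite mulrC.
  rewrite /orbit_weight gtr0_norm// le_eqVlt; apply/orP; left; apply/eqP.
  by rewrite !exprMn; ring.
pose v i := f (x * q ^ (i + 1)) * m i - lam * f (x * q ^ i) * m (i + 1).
have vrec i : v i = (lam * (x * q ^ i)%:C)^-1 * v (i - 1).
  rewrite /v subrK rec mulrAC mrec fmorphV/=; field.
  by rewrite l0 !C0 ?expfz_neq0//.
have vd (d : nat) : v 0 * (lam ^+ d * (Wt d (x / q ^+ d))%:C) = v (- d%:Z).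
  elim: d => [|d IH].
    by rewrite oppr0 /orbit_weight !expr0 !mulr1.
  have -> : v (- d.+1%:Z) = lam * (x / q ^+ d)%:C * v (- d%:Z).
    rewrite (vrec (- d%:Z)) predNz.
    by rewrite -exprnN mulrA divff ?mul1r// mulf_neq0 ?C0 ?mulf_neq0 ?invr_eq0 ?expf_neq0.
  rewrite -IH (_ : x / q ^+ d.+1 = x / q ^+ d / q); last by rewrite -mulrA -invfM -exprSr.
  rewrite WtS_div//; last by rewrite divr_gt0 ?exprn_gt0.
  by rewrite exprS rmorphM/=; ring.
have v0 : v 0 = 0.
  pose K := C * ptheta q (normc lam * (x * q))^-1.
  have mK (d : nat) : normc (m (1 - d%:Z)) <= K.
    apply: le_trans (hC _ _ (lexx _)) _; rewrite ler_wpM2l// le_ptheta// ?normc_ge0//.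
    rewrite normcV normcM normc_real gtr0_norm//.
    rewrite lef_pV2 ?posrE ?mulr_gt0 ?exprz_gt0// ler_wpM2l ?normc_ge0//.
    by rewrite ler_wpM2l ?(ltW x0)// -{1}[q]expr1z le_qexpz.
  apply: (@small_zero _ (2 * K ^+ 2 * (Cq + normc lam ^+ 2 * Cf))
      (4 / (normc lam ^+ 2 * (x * q)))) => [||d].
  - apply: mulr_ge0; first by apply: mulr_ge0 => //; exact: sqr_ge0.
    by apply: addr_ge0 => //; apply: mulr_ge0 => //; exact: sqr_ge0.
  - by rewrite divr_ge0// !mulr_ge0 ?sqr_ge0// ltW.
  have y0 : 0 < x / q ^+ d by rewrite divr_gt0 ?exprn_gt0.
  have W0 : 0 < Wt d (x / q ^+ d) by rewrite Wt_gt0// gt_eqF.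
  have WV : q ^+ 'C(d.+1, 2) * (x * q)^-1 ^+ d = (Wt d (x / q ^+ d))^-1.
    rewrite /orbit_weight gtr0_norm//.
    have e2 : q ^+ 'C(d.+1, 2) * q ^+ 'C(d.+1, 2) = q ^+ d * (q ^+ d) ^+ d.
      by rewrite -exprD addnn tri_double mulnS exprD exprM.
    rewrite !exprMn !exprVn !exprMn.
    have [n1 n2] : q ^+ 'C(d.+1, 2) != 0 /\ (q ^+ d) ^+ d != 0 by rewrite !expf_neq0.
    have n3 : q ^+ d != 0 by rewrite expf_neq0.
    have n4 : x ^+ d != 0 by rewrite expf_neq0.
    move: (q ^+ 'C(_, _)) (q ^+ d) ((q ^+ d) ^+ d) (x ^+ d) e2 n1 n2 n3 n4 => t s u z e2 n1 n2 n3 n4.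
    apply: (mulfI n1); rewrite mulrA e2; field; by rewrite n1 n2 n3 n4.
  have h1 : normc (f (x * q ^ (- d%:Z + 1))) ^+ 2 <= Cq * 4 ^+ d * Wt d (x / q ^+ d).
    have := (hq d).2; rewrite (_ : x * q / q ^+ d = x * q ^ (- d%:Z + 1)); last first.
      by rewrite expfzDr// expr1z -exprnN; ring.
    move=> /le_trans; apply; rewrite ler_wpM2l ?mulr_ge0 ?exprn_ge0//.
    rewrite /orbit_weight ler_wpM2r ?exprn_ge0// lerXn2r ?nnegrE ?normr_ge0//.
    rewrite expfzDr// expr1z -exprnN mulrA normrM (gtr0_norm q_gt0).
    by rewrite ler_piMr// ltW.
  have h2 : normc (f (x * q ^ (- d%:Z))) ^+ 2 <= Cf * 4 ^+ d * Wt d (x / q ^+ d).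
    by rewrite -exprnN; exact: (hf d).2.
  have h3 : normc (v (- d%:Z)) ^+ 2 <= 2 * K ^+ 2 * (Cq + normc lam ^+ 2 * Cf) *
      (4 ^+ d * Wt d (x / q ^+ d)).
    have m0 : normc (m (- d%:Z)) <= K by rewrite -subz1; exact: mK.
    have m1 : normc (m (- d%:Z + 1)) <= K by rewrite addrC; exact: mK.
    apply: le_trans (cas_bound _ _ m0 m1) _; rewrite -[leRHS]mulrA ler_wpM2l//.
      by rewrite mulr_ge0// sqr_ge0.
    rewrite normcM exprMn mulrDl; apply: lerD; first by rewrite mulrA.
    rewrite -[leRHS]mulrA; apply: ler_wpM2l; first exact: sqr_ge0.
    by rewrite mulrA.
  move: h3; rewrite -vd normcM exprMn normcM exprMn normc_exp normc_real gtr0_norm//.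
  rewrite [(_ * (x * q))^-1]invfM.
  rewrite (_ : 4 * _ = (4 / normc lam ^+ 2) * (x * q)^-1); last by rewrite mulrA.
  rewrite (exprMn d _ (x * q)^-1) (mulrCA (q ^+ _)) WV expr_div_n -!exprM (mulnC 2%N).
  set W := Wt _ _ in W0 *; set A := 2 * _ * _ => h3.
  have ln0 : 0 < normc lam ^+ (d * 2) by rewrite exprn_gt0.
  rewrite [leRHS]mulrA ler_pdivlMr// [leRHS]mulrA ler_pdivlMr//.
  rewrite -(ler_pM2r W0); apply: le_trans (le_trans h3 _).
    by rewrite le_eqVlt; apply/orP; left; apply/eqP; ring.
  by rewrite le_eqVlt; apply/orP; left; apply/eqP; ring.
have away1 : exists2 eps, 0 < eps <= 1 & away q eps (lam * x%:C).
  have [dl dl0 hdl] := orbit_gap q_gt0 q_lt1 l0 x0 nz.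
  exists (Num.min 3^-1 (dl / (3 * normc lam))); last exact: away_of_gap.
  rewrite lt_min divr_gt0 ?mulr_gt0// invr_gt0 ltr0n/= ge_min invf_le1//.
  by rewrite ler1n.
have [eps /andP[e0 e1] ha] := away1.
have xC0 := C0 xn0.
have Hn0 := H_neq0 q_gt0 q_lt1 e0 e1 lQ (mulf_neq0 l0 xC0) ha.
move: w0 v0; rewrite /w /v !add0r expr0z mulr1 expr1z => w0 v0.
have : f x * (lam * casoratian q lam^-1 (lam * x%:C)) = 0.
  have -> : lam * casoratian q lam^-1 (lam * x%:C) = lam * p 0 * m 1 - p 1 * m 0.
    rewrite casoratian.unlock /p /m /Fl expr0z mulr1 expr1z rmorphM/=.
    rewrite (_ : (lam * (x%:C * Q))^-1 = (lam * x%:C)^-1 / Q); last first.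
      by rewrite mulrA [LHS]invfM.
    rewrite (_ : Q * (lam * x%:C) = lam * (x%:C * Q)); last by ring.
    move: (phi11 _ _ _) (phi11 _ _ _) (phi11 _ _ _) (phi11 _ _ _) => u1 u2 u3 u4.
    by field.
  rewrite (_ : _ * _ = m 0 * (f (x * q) * p 0 - f x * p 1) -
    p 0 * (f (x * q) * m 0 - lam * f x * m 1)); last by ring.
  by rewrite w0 v0 !mulr0 subrr.
by move/eqP; rewrite !mulf_eq0 (negbTE l0) (negbTE Hn0) !orbF => /eqP.
Qed.

(** The exceptional points form a countable set. *)
Lemma ae_off_lattice lam :
  {ae mu, forall x, forall i : int, lam + ((x * q ^ i)^-1)%:C != 0}.
Proof.
have cA := @mem_orbit_lattice R q q_gt0 lam _ erefl.
apply: (ae2 _ ae_pos (scaling_countable Hmu cA)) => x x0 h i.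
by apply/eqP => e; apply: h; exists i.
Qed.

Lemma eigen_eq0 lam f : lam != 0 -> (forall i, lam^-1 * Q ^+ i != 1) -> L2 mu f ->
  eqL2 mu (qdiff q f) (fun x => lam * f x) -> eqL2 mu f (fun=> 0).
Proof.
move=> l0 lQ Lf fe.
have a1 := ae_orbit q_gt0 Hmu fe.
have a2 := ae_orbit q_gt0 Hmu (L2_orbit_growth Lf).
have a3 := ae_off_lattice lam.
have a12 := ae2 (fun x => @conj _ _) a1 a2.
have a123 := ae2 (fun x => @conj _ _) a12 a3.
by apply: (ae2 _ ae_pos a123) => x x0 [[h1 h2] h3]; exact: eigen_zero h1 h2 h3.
Qed.

End injectivity.

(** * Eigenfunctions *)

Section eigenfunctions.
Context {R : realType} (q : R).
Local Notation T := (measurableTypeR R).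
Variable mu : {measure set T -> \bar R}.
Hypotheses (q_gt0 : 0 < q) (q_lt1 : q < 1) (Hmu : qscaling q mu).
Local Notation Q := (q%:C).
Implicit Types (x : R) (f h : R -> R[i]).

Let q_ge0 : 0 <= q. Proof. exact: ltW. Qed.
Let q_neq0 : q != 0. Proof. by rewrite gt_eqF. Qed.
Let Qn0 : Q != 0. Proof. exact: Q_neq0. Qed.
Let C0 x : x != 0 -> x%:C != 0 :> R[i].
Proof. by apply: contra => /eqP[] /eqP. Qed.
Let ae_pos : {ae mu, forall x, 0 < x}. Proof. by case: Hmu. Qed.

Lemma ae_false : {ae mu, forall x : T, False} -> mu [set: T] = 0%E.
Proof.
move=> [N [mN N0 hN]]; apply/eqP; rewrite -measure_le0 -N0; apply: le_measure.
- by rewrite inE.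
- by rewrite inE.
- by move=> x _; apply: hN => /=.
Qed.

Lemma L2_monomial k : L2 mu (fun x => (x ^+ k)%:C).
Proof.
apply/L2P; split; first by apply: mC_real; apply: measurable_funX; exact: measurable_id.
rewrite /I2 (_ : (\int[mu]_x _)%E = (\int[mu]_x (`|x| ^+ (k * 2))%:E)%E).
  exact: moment_finite q_gt0 Hmu _.
by apply: eq_integral => x _; rewrite normc_real normrX exprM.
Qed.

Lemma L2_zero : L2 mu (fun=> 0).
Proof.
have := L2Z 0 (L2_monomial 0); rewrite (_ : (fun _ => _) = (fun=> 0))//.
by apply/funext => x; rewrite mul0r.
Qed.

Lemma L2_sum n (f : nat -> R -> R[i]) : (forall i, L2 mu (f i)) ->
  L2 mu (fun x => \sum_(i < n) f i x).
Proof.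
move=> Lf; elim: n => [|n IH].
  by under eq_fun do rewrite big_ord0; exact: L2_zero.
by under eq_fun do rewrite big_ord_recr/=; exact: L2D.
Qed.

(** At [a = q^-n] the q-Pochhammer symbol contains a zero factor. *)
Lemma acoef_eq0 n k : (n < k)%N -> phi11_coef q (Q ^+ n)^-1 k = 0.
Proof.
move=> nk; rewrite /phi11_coef /qpochhammer (bigD1 (Ordinal nk))//= mulVf ?expf_neq0//.
by rewrite subrr !mul0r.
Qed.

(** The polynomial solution for the eigenvalue [q^n]. *)
Definition phi n x : R[i] := phi11 q (Q ^+ n)^-1 (Q ^+ n * x%:C).

(** All moments of [mu] are finite. *)
Lemma L2_phi n : L2 mu (phi n).
Proof.
pose g k x : R[i] := phi11_coef q (Q ^+ n)^-1 k * (q ^+ 'C(k.+1, 2))%:C * Q ^+ n ^+ k * (x ^+ k)%:C.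
have -> : phi n = fun x => \sum_(k < n.+1) g k x.
  apply/funext => x; rewrite /phi FE (@csum_finite _ _ n.+1).
    apply: eq_bigr => k _; by rewrite /Fterm /g exprMn !rmorphXn/= !mulrA.
  by move=> k nk; rewrite /Fterm acoef_eq0// !mul0r.
by apply: L2_sum => k; apply: L2Z; exact: L2_monomial.
Qed.

(** Multiplying by a function that is constant on orbits preserves solutions. *)
Definition eigenfun n j x : R[i] := (base q x)%:C ^+ j * phi n x.

Lemma mC_base : mC (fun x => (base q x)%:C).
Proof. by apply: mC_real; exact: measurable_base. Qed.

Lemma L2_eigenfun n j : L2 mu (eigenfun n j).
Proof.
apply: (@L2_le _ _ _ (phi n) 1) => //; last 2 first.
- exact: L2_phi.
- apply: (ae_sub _ ae_pos) => x x0; rewrite mul1r normcM exprMn ler_piMl ?sqr_ge0//.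
  have /andP[b0 b1] := base_itv q_gt0 q_lt1 x0.
  rewrite normc_exp normc_real gtr0_norm ?base_gt0// -exprM exprn_ile1//.
  by rewrite ltW// base_gt0.
- by apply: mCM; [apply: mCX; exact: mC_base|exact: (L2_mC (L2_phi n))].
Qed.

Lemma eigenfun_eq n j : eqL2 mu (fun x => Q ^+ n * eigenfun n j x) (qdiff q (eigenfun n j)).
Proof.
apply: (ae_sub _ ae_pos) => x x0; have xn0 : x != 0 by rewrite gt_eqF.
rewrite /eigenfun /qdiff.
have := base_scale q_gt0 q_lt1 1 x0; rewrite expr1z => ->.
have := base_scale q_gt0 q_lt1 (-1) x0; rewrite exprN1 => ->.
have ln0 : Q ^+ n != 0 by rewrite expf_neq0.
by have := phi_rec q_gt0 q_lt1 ln0 xn0; rewrite /phi => ->; ring.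
Qed.

(** The polynomial is close to 1 near 0, and every orbit accumulates there. *)
Lemma phi_orbit_neq0 n x : exists d : nat, phi n (x * q ^+ d) != 0.
Proof.
have [C C_0 hC] := F_near0 q_gt0 q_lt1 (normc_ge0 (Q ^+ n)^-1).
pose z := Q ^+ n * x%:C.
have K0 : 0 < (C + 1) * (normc z + 1) by rewrite mulr_gt0// ltr_wpDl// normc_ge0.
have [d hd] := @qexp_small R q q_gt0 q_lt1 ((C + 1) * (normc z + 1))^-1 ltac:(by rewrite invr_gt0).
exists d; apply/eqP => p0.
have zd : normc (Q ^+ n * (x * q ^+ d)%:C) = normc z * q ^+ d.
  by rewrite rmorphM/= mulrA normcM normc_real ger0_norm ?exprn_ge0.
have qd0 : 0 <= q ^+ d by rewrite exprn_ge0.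
rewrite -(ltr_pM2l K0) divff ?gt_eqF// in hd.
have N0 := normc_ge0 z.
have CN : 0 <= C * (normc z * q ^+ d) by rewrite !mulr_ge0.
have NN : 0 <= normc z * q ^+ d by rewrite mulr_ge0.
have Cq : 0 <= C * q ^+ d by rewrite mulr_ge0.
have N1 : normc z * q ^+ d <= 1 by lra.
have := hC _ _ (lexx _) (_ : normc (Q ^+ n * (x * q ^+ d)%:C) <= 1); rewrite zd => /(_ N1).
rewrite -[phi11 _ _ _]/(phi n (x * q ^+ d)) p0 sub0r normcN normc1.
lra.
Qed.

(** A linear relation makes almost every [base q x] a root of one nonzero
    polynomial, which confines [x] to a countable set. *)
Lemma eigenfun_free n m (c : 'I_m -> R[i]) : mu [set: T] <> 0%E ->
  eqL2 mu (fun x => \sum_(i < m) c i * eigenfun n i x) (fun=> 0) -> forall i, c i = 0.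
Proof.
move=> mu0 h; pose P : {poly R[i]} := \sum_(i < m) c i *: 'X^i.
have Pc (i : 'I_m) : P`_i = c i.
  rewrite coef_sum (bigD1 i)//= coefZ coefXn eqxx mulr1 big1 ?addr0// => j ji.
  by rewrite coefZ coefXn eq_sym (inj_eq val_inj) (negbTE ji) mulr0.
suff P0 : P = 0 by move=> i; rewrite -Pc P0 coef0.
apply/eqP; apply: contra_notT mu0 => Pn0.
apply: ae_false.
have [s Ps] := closed_field_poly_normal P.
have hs z : root P z -> z \in s.
  by rewrite Ps rootZ ?lead_coef_eq0// root_prod_XsubC.
pose A : set T := \bigcup_(z in [set` s]) (range (fun i : int => complex.Re z * q ^ i)).
have cA : countable A.
  apply: bigcup_countable => [|z _]; first exact: finite_set_countable.
  exact: sub_countable (card_image_le _ _) (countableP _).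
apply: (ae2 _ (ae2 (fun x => @conj _ _) ae_pos (ae_orbit q_gt0 Hmu h)) (scaling_countable Hmu cA)).
move=> x [x0 hx] nA; apply: nA.
have [d pd] := phi_orbit_neq0 n x.
have rP : root P (base q x)%:C.
  have := hx d; rewrite -exprnP.
  under eq_bigr do rewrite /eigenfun mulrA exprnP base_scale//.
  rewrite -mulr_suml => /eqP; rewrite mulf_eq0 (negbTE pd) orbF /root => /eqP <-.
  rewrite horner_sum; apply/eqP; apply: eq_bigr => i _.
  by rewrite hornerZ hornerXn.
exists (base q x)%:C; first exact: hs.
by exists (qlog q x) => //=; rewrite -baseE.
Qed.

Lemma eigenspace_infinite n : mu [set: T] <> 0%E ->
  infinite_dimL2 mu (op_eigenspace (adjoint mu (Lop mu q)) (q ^+ n)%:C).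
Proof.
move=> mu0 m; exists (fun i => eigenfun n i) => [i|c hc]; last exact: eigenfun_free hc.
rewrite -QE; apply/adjointP => //; split.
- exact: L2_eigenfun.
- by apply: L2Z; exact: L2_eigenfun.
- exact: eigenfun_eq.
Qed.

End eigenfunctions.

(** * Density of the range at 0 *)

Section truncation.
Context {R : realType}.
Local Notation T := (measurableTypeR R).
Variable mu : {measure set T -> \bar R}.

Lemma mC_trunc (P : nat -> R -> bool) f n : (forall n, measurable_fun [set: T] (P n)) ->
  mC f -> mC (fun x => if P n x then 0 else f x).
Proof. by move=> mP mf; apply: mC_if => //; exact: mC_cst. Qed.

Lemma I2_trunc (P : nat -> R -> bool) f (e : R) : (forall n, measurable_fun [set: T] (P n)) ->
  L2 mu f -> {ae mu, forall x, exists m, forall n, (m <= n)%N -> P n x} -> 0 < e ->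
  exists n, (I2 mu (fun x => if P n x then 0 else f x)%R < e%:E)%E.
Proof.
move=> mP Lf aeP e0; have mf := L2_mC Lf.
pose u n x := (normc (if P n x then 0 else f x) ^+ 2)%:E.
have mf2 : measurable_fun [set: T] (fun x => (normc (f x) ^+ 2)%:E).
  by apply/measurable_EFinP; exact: mC_sq.
have mu_ n : measurable_fun [set: T] (u n).
  by apply/measurable_EFinP; apply: mC_sq; exact: mC_trunc.
have [|||||_ _] := @dominated_convergence _ T R mu [set: T] measurableT u (cst 0%E)
  (fun x => (normc (f x) ^+ 2)%:E) => //.
- apply: (ae_sub _ aeP) => x [m hm] _; apply: cvg_near_cst; exists m => // n /= mn.
  by rewrite /u hm// normc0 expr0n.
- apply/integrableP; split => //.
  under eq_integral do rewrite gee0_abs ?lee_fin ?sqr_ge0//.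
  exact: L2_I2.
- apply: aeW => x n _; rewrite gee0_abs ?lee_fin ?sqr_ge0//.
  by case: ifP => // _; rewrite normc0 expr0n/= sqr_ge0.
rewrite integral0 => /fine_cvgP[fin /cvgr_lt/(_ e e0) small].
have [n [/= fn sn]] := filter_ex (filterI fin small).
by exists n; rewrite /I2 -(fineK fn) lte_fin.
Qed.

(** The factor [C q^d] is eventually smaller than the slack [1 - theta], and
    then the maximum of two consecutive terms decreases geometrically. *)
Lemma two_step_decay (q : R) (n : nat -> R) (theta C : R) d0 : 0 < q -> q < 1 ->
  0 <= theta < 1 -> 0 <= C -> (forall d, 0 <= n d) ->
  (forall d, (d0 <= d)%N -> n d.+2 <= theta * n d + C * q ^+ d * n d.+1) ->
  forall e, 0 < e -> exists N, [/\ (d0 <= N)%N, n N < e & n N.+1 < e].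
Proof.
move=> q_gt0 q_lt1 /andP[th0 th1] C0 n0 hn e e0.
have [d1' hd1'] := @qexp_small R q q_gt0 q_lt1 ((1 - theta) / 2 / (C + 1))
  ltac:(by rewrite !divr_gt0// ?subr_gt0// ltr_wpDl).
pose d1 := maxn d0 d1'; have C1 : 0 < C + 1 by rewrite ltr_wpDl.
have hC d : (d1 <= d)%N -> C * q ^+ d <= (1 - theta) / 2.
  rewrite geq_max => /andP[_ d1d]; apply: (@le_trans _ _ ((C + 1) * q ^+ d1')); last first.
    by rewrite mulrC -ler_pdivlMr// ltW.
  by apply: ler_pM => //; rewrite ?exprn_ge0 ?(ltW q_gt0)// ?lerDl// le_qexp.
pose rho := (1 + theta) / 2.
have rho0 : 0 < rho by rewrite /rho; lra.
have rho1 : rho < 1 by rewrite /rho; lra.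
pose M d := Num.max (n d) (n d.+1).
have M0 d : 0 <= M d by rewrite le_max n0.
have step d : (d1 <= d)%N -> n d.+2 <= rho * M d.
  move=> d1d; apply: le_trans (hn d _) _; first by apply: leq_trans d1d; exact: leq_maxl.
  have h1 : theta * n d <= theta * M d by rewrite ler_wpM2l// le_max lexx.
  have h2 : C * q ^+ d * n d.+1 <= (1 - theta) / 2 * M d.
    by apply: ler_pM => //; rewrite ?mulr_ge0 ?exprn_ge0 ?(ltW q_gt0)// ?hC// le_max lexx orbT.
  by rewrite /rho; lra.
have step2 d : (d1 <= d)%N -> M d.+2 <= rho * M d.
  move=> d1d; rewrite {1}/M ge_max step//=; apply: le_trans (step _ (leqW d1d)) _.
  rewrite ler_wpM2l ?(ltW rho0)// {1}/M ge_max le_max lexx orbT/=.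
  by apply: le_trans (step _ d1d) _; rewrite ler_piMl ?(ltW rho1).
have iter k : M (d1 + k.*2)%N <= rho ^+ k * M d1.
  elim: k => [|k IH]; first by rewrite addn0 mul1r.
  rewrite doubleS !addnS exprS -mulrA; apply: le_trans (step2 _ (leq_addr _ _)) _.
  by rewrite ler_wpM2l ?(ltW rho0).
have M1 : 0 < M d1 + 1 by rewrite ltr_wpDl.
have [k hk] := @qexp_small R rho rho0 rho1 (e / (M d1 + 1)) ltac:(by rewrite divr_gt0).
have Me : M (d1 + k.*2)%N < e.
  apply: le_lt_trans (iter k) _; rewrite ltr_pdivlMr// in hk.
  by apply: le_lt_trans hk; rewrite ler_wpM2l ?exprn_ge0 ?(ltW rho0)// lerDl.
exists (d1 + k.*2)%N; split.
- by apply: leq_trans (leq_maxl _ _) (leq_addr _ _).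
- by apply: le_lt_trans Me; rewrite le_max lexx.
- by apply: le_lt_trans Me; rewrite le_max lexx orbT.
Qed.

End truncation.

Section zero.
Context {R : realType} (q : R).
Local Notation T := (measurableTypeR R).
Variable mu : {measure set T -> \bar R}.
Hypotheses (q_gt0 : 0 < q) (q_lt1 : q < 1) (Hmu : qscaling q mu).
Implicit Types (x : R) (f h : R -> R[i]).

Let q_ge0 : 0 <= q. Proof. exact: ltW. Qed.
Let q_neq0 : q != 0. Proof. by rewrite gt_eqF. Qed.
Let C0 x : x != 0 -> x%:C != 0 :> R[i].
Proof. by apply: contra => /eqP[] /eqP. Qed.
Let ae_pos : {ae mu, forall x, 0 < x}. Proof. by case: Hmu. Qed.

(** The substitution rule, solved for the integral of [k (x q)]. *)
Lemma int_comp_scale (k : R -> R) : measurable_fun [set: T] k -> (forall x, 0 <= k x) ->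
  (\int[mu]_x (k (x * q))%:E = \int[mu]_x (k x / `|x|)%:E)%E.
Proof.
move=> mk k0.
have mi : measurable_fun [set: T] (fun x : T => `|x|^-1).
  by apply: (measurableT_comp (@measurable_inv R)); exact: normr_measurable.
have m1 : measurable_fun [set: T] (fun x => k x / `|x|) by exact: measurable_funM.
rewrite [RHS](int_scale q_gt0 Hmu)//.
apply: ge0_ae_eq_integral => //.
- by apply/measurable_EFinP; apply: (measurableT_comp mk); exact: mulrr_measurable.
- apply/measurable_EFinP; apply: measurable_funM; first exact: measurable_absq.
  by apply: (measurableT_comp m1); exact: mulrr_measurable.
- by move=> x _; rewrite lee_fin.
- by move=> x _; rewrite lee_fin !mulr_ge0 ?invr_ge0.
- apply: (ae_sub _ ae_pos) => x x0 _; congr (_%:E).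
  rewrite normrM (gtr0_norm q_gt0) mulrCA divff ?mulr1//.
  by rewrite mulf_neq0// normr_eq0 gt_eqF.
Qed.

Section truncated_solution.
Variables (a b : R) (h : R -> R[i]).
Hypotheses (a0 : 0 < a) (ab : a < b) (Lh : L2 mu h)
  (h_supp : forall x, ~~ (a <= x <= b) -> h x = 0).

(** The solution of [L f = h] vanishing near 0, cut off above [a q^-n]. The
    equation [L f = h] at [x q] expresses [f x] by values closer to 0. *)
Fixpoint tsol n x : R[i] := if n is m.+1 then
    if (a < x) && (x <= a / q ^+ n) then
      (x * q)%:C * h (x * q) + tsol m (x * q) - (x * q)%:C * tsol m (x * q ^+ 2)
    else 0
  else 0.

Arguments tsol : simpl never.

Lemma tsolE n x : tsol n.+1 x = if (a < x) && (x <= a / q ^+ n.+1) then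
    (x * q)%:C * h (x * q) + tsol n (x * q) - (x * q)%:C * tsol n (x * q ^+ 2) else 0.
Proof. by []. Qed.

Let aq n : a <= a / q ^+ n.
Proof. by rewrite ler_pdivlMr ?exprn_gt0// ler_piMr ?(ltW a0)// exprn_ile1// ltW. Qed.

Let aqS n x : (x <= a / q ^+ n.+1) = (x * q <= a / q ^+ n).
Proof. by rewrite exprSr invfM mulrA ler_pdivlMr. Qed.

Lemma tsol_low n x : x <= a -> tsol n x = 0.
Proof. by case: n => // n xa; rewrite tsolE ltNge xa. Qed.

Lemma tsol_high n x : a / q ^+ n < x -> tsol n x = 0.
Proof. by case: n => // n xa; rewrite tsolE leNgt xa andbF. Qed.

Lemma tsolS n x : x <= a / q ^+ n -> tsol n.+1 x = tsol n x.
Proof.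
elim: n x => [|n IH] x xn.
  by rewrite expr0 divr1 in xn; rewrite !tsol_low.
have xn2 : x <= a / q ^+ n.+2.
  apply: le_trans xn _; rewrite ler_pM2l// lef_pV2 ?posrE ?exprn_gt0//.
  by rewrite [leLHS]exprS ler_piMl ?exprn_ge0// ltW.
rewrite [LHS]tsolE [RHS]tsolE xn xn2; have [ax|//] := ltP a x.
have xq : x * q <= a / q ^+ n by rewrite -aqS.
rewrite /= !IH//; apply: le_trans xq.
by rewrite expr2 mulrA ler_piMr ?(ltW q_lt1)// mulr_ge0// ltW// (lt_trans a0).
Qed.

Lemma tsol_rec n x : a * q < x -> x <= a / q ^+ n * q ->
  tsol n (x / q) = x%:C * h x + tsol n x - x%:C * tsol n (x * q).
Proof.
case: n => [|n] ax xn; first by move: (lt_le_trans ax xn); rewrite expr0 divr1 ltxx.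
have xn1 : x <= a / q ^+ n by move: xn; rewrite exprSr invfM mulrA divfK.
have x0 : 0 < x by apply: lt_trans ax; rewrite mulr_gt0.
have xqx : x * q <= x by rewrite ler_piMr ?ltW.
have e : x / q * q ^+ 2 = x * q by rewrite expr2 mulrA divfK.
rewrite [LHS]tsolE e divfK// ltr_pdivlMr// ax aqS divfK// xn1/=.
by rewrite -(tsolS xn1) -(tsolS (le_trans xqx xn1)).
Qed.

Lemma mC_tsol n : mC (tsol n).
Proof.
have [mh _] := (L2P mu h).1 Lh.
elim: n => [|n IH]; first exact: mC_cst.
apply: (@mC_if _ (fun x => (a < x) && (x <= a / q ^+ n.+1))); last exact: mC_cst.
  by apply: measurable_and; [exact: measurable_fun_ltr|exact: measurable_fun_ler].
have mx : mC (fun x => (x * q)%:C).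
  by apply: mC_real; exact: mulrr_measurable.
apply: mCB; first by apply: mCD; [apply: mCM => //|]; exact: mC_scale.
by apply: mCM => //; exact: mC_scale.
Qed.

Lemma L2_bmul (p : R -> R) (K : R) f : measurable_fun [set: T] p ->
  {ae mu, forall x, `|p x| <= K} -> L2 mu f -> L2 mu (fun x => (p x)%:C * f x).
Proof.
move=> mp pK Lf; apply: (@L2_le _ _ _ f (K ^+ 2)); rewrite ?sqr_ge0//.
  by apply: mCM; [exact: mC_real|exact: L2_mC Lf].
apply: (ae_sub _ pK) => x h1; rewrite normcM exprMn normc_real ler_wpM2r ?sqr_ge0//.
exact: sqr_mono.
Qed.

Let low f : (forall x, x < a -> f x = 0) -> {ae mu, forall x : T, x < a -> f x = 0}.
Proof. by move=> h1; apply: aeW. Qed.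

Lemma L2_tsol n : L2 mu (tsol n).
Proof.
elim: n => [|n IH]; first exact: L2_zero q_gt0 Hmu.
pose c x : bool := (a < x) && (x <= a / q ^+ n.+1).
have mc : measurable_fun [set: T] c.
  by apply: measurable_and; [exact: measurable_fun_ltr|exact: measurable_fun_ler].
pose p x : R := if c x then x * q else 0.
pose r x : R := if c x then 1 else 0.
have mp : measurable_fun [set: T] p.
  by apply: measurable_fun_ifT => //; exact: mulrr_measurable.
have mr : measurable_fun [set: T] r by apply: measurable_fun_ifT.
have pK : {ae mu, forall x, `|p x| <= a / q ^+ n}.
  apply: aeW => x; rewrite /p /c; case: ifP => [/andP[ax xn]|_]; last first.
    by rewrite normr0 divr_ge0 ?exprn_ge0 ?ltW.
  by rewrite gtr0_norm -?aqS// mulr_gt0// (lt_trans a0).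
have rK : {ae mu, forall x, `|r x| <= 1}.
  by apply: aeW => x; rewrite /r; case: ifP; rewrite ?normr1 ?normr0.
have Lhq : L2 mu (fun x => h (x * q)).
  apply: (L2_comp_scale q_gt0 Hmu Lh a0); apply: low => x xa.
  by apply: h_supp; rewrite leNgt xa.
have Ltq : L2 mu (fun x => tsol n (x * q)).
  apply: (L2_comp_scale q_gt0 Hmu IH a0); apply: low => x xa.
  by rewrite tsol_low// ltW.
have Ltq2 : L2 mu (fun x => tsol n (x * q * q)).
  apply: (L2_comp_scale q_gt0 Hmu Ltq a0); apply: low => x xa.
  rewrite tsol_low//; have [x0|x0] := leP 0 x.
    by apply: le_trans (ltW xa); rewrite ler_piMr// ltW.
  by apply: le_trans (ltW a0); rewrite nmulr_rle0.
have -> : tsol n.+1 = fun x => (p x)%:C * h (x * q) + (r x)%:C * tsol n (x * q)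
    - (p x)%:C * tsol n (x * q * q).
  apply/funext => x; rewrite tsolE -/(c x) /p /r; case: ifP => _.
    by rewrite mul1r expr2 mulrA.
  by rewrite !mul0r addr0 subr0.
by apply: L2B; [apply: L2D|]; [exact: (L2_bmul mp pK)|exact: (L2_bmul mr rK)|exact: (L2_bmul mp pK)].
Qed.

Let shell n x : bool := (a / q ^+ n * q < x) && (x <= a / q ^+ n).

Let mshell n : measurable_fun [set: T] (shell n).
Proof. by apply: measurable_and; [exact: measurable_fun_ltr|exact: measurable_fun_ler]. Qed.

Let shell_gt0 n x : shell n x -> 0 < x.
Proof.
by move=> /andP[+ _]; apply: lt_trans; rewrite mulr_gt0// divr_gt0// exprn_gt0.
Qed.

Let shellS n x : shell n.+1 x = shell n (x * q).
Proof. by rewrite /shell aqS ltr_pM2r// exprSr invfM mulrA divfK. Qed.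

(** The energy of the truncated solution on its last shell. *)
Let dens n x : R := if shell n x then normc (tsol n x) ^+ 2 / `|x| else 0.
Let energy n : \bar R := (\int[mu]_x (dens n x)%:E)%E.

Let dens_ge0 n x : 0 <= dens n x.
Proof. by rewrite /dens; case: ifP => // _; rewrite divr_ge0 ?sqr_ge0. Qed.

Let mdens n : measurable_fun [set: T] (dens n).
Proof.
apply: measurable_fun_ifT => //; apply: measurable_funM; first exact: mC_sq (mC_tsol n).
by apply: (measurableT_comp (@measurable_inv R)); exact: normr_measurable.
Qed.

Let shell_low n x : shell n.+1 x -> a < x.
Proof.
by move=> /andP[+ _]; apply: le_lt_trans; rewrite exprSr invfM mulrA divfK.
Qed.

Lemma energy_fin n : energy n \is a fin_num.
Proof.
rewrite ge0_fin_numE ?integral_ge0//; last by move=> x _; rewrite lee_fin.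
have Lt := L2_tsol n; have s0 : 0 < a / q ^+ n * q by rewrite mulr_gt0// divr_gt0 ?exprn_gt0.
apply: (@le_lt_trans _ _ ((a / q ^+ n * q)^-1%:E * I2 mu (tsol n))%E); last first.
  by rewrite lte_mul_pinfty// ?lee_fin ?invr_ge0 ?(ltW s0)//; exact: L2_I2.
rewrite -ge0_integralZl//; last 3 first.
- by apply/measurable_EFinP; exact: mC_sq (mC_tsol n).
- by move=> x _; rewrite lee_fin sqr_ge0.
- by rewrite lee_fin invr_ge0 ltW.
apply: ge0_le_integral => //.
- by move=> x _; rewrite lee_fin.
- exact/measurable_EFinP.
- by apply: emeasurable_funM => //; apply/measurable_EFinP; exact: mC_sq (mC_tsol n).
- move=> x _; rewrite -EFinM lee_fin /dens; case: ifP => [sx|_]; last first.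
    by rewrite mulr_ge0 ?sqr_ge0// invr_ge0 ltW.
  have x0 := shell_gt0 sx; rewrite mulrC ler_wpM2r ?sqr_ge0// gtr0_norm//.
  by rewrite lef_pV2 ?posrE//; move/andP: sx => [/ltW].
Qed.

Let sq n x : R := if shell n x then normc (tsol n x) ^+ 2 else 0.

Let sq_ge0 n x : 0 <= sq n x.
Proof. by rewrite /sq; case: ifP => // _; rewrite sqr_ge0. Qed.

Let msq n : measurable_fun [set: T] (sq n).
Proof. by apply: measurable_fun_ifT => //; exact: mC_sq (mC_tsol n). Qed.

Let msq_scale n : measurable_fun [set: T] (fun x => sq n (x * q)).
Proof. by apply: (measurableT_comp (msq n)); exact: mulrr_measurable. Qed.

Let sqE n x : sq n x / `|x| = dens n x.
Proof. by rewrite /sq /dens; case: ifP => // _; rewrite mul0r. Qed.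

Let int_sq n : (\int[mu]_x (sq n (x * q))%:E = energy n)%E.
Proof. by rewrite int_comp_scale//; apply: eq_integral => x _; rewrite sqE. Qed.

Let sq2 n x := (`|x| * q) * sq n (x * q).

Let msq2 n : measurable_fun [set: T] (sq2 n).
Proof. by apply: measurable_funM => //; exact: measurable_absq. Qed.

Let sq2_ge0 n x : 0 <= sq2 n x. Proof. by rewrite !mulr_ge0. Qed.

Let int_sq2 n : (\int[mu]_x (sq2 n (x * q))%:E = q%:E * energy n)%E.
Proof.
rewrite int_comp_scale// -int_sq -ge0_integralZl//; last 2 first.
- exact/measurable_EFinP.
- by move=> x _; rewrite lee_fin.
apply: ge0_ae_eq_integral => //.
- apply/measurable_EFinP; apply: measurable_funM => //.
  by apply: (measurableT_comp (@measurable_inv R)); exact: normr_measurable.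
- by apply: emeasurable_funM => //; exact/measurable_EFinP.
- by move=> x _; rewrite lee_fin divr_ge0.
- by move=> x _; rewrite mule_ge0 ?lee_fin.
- apply: (ae_sub _ ae_pos) => x x0 _; rewrite -EFinM; congr (_%:E).
  by rewrite /sq2 gtr0_norm//; field; rewrite gt_eqF.
Qed.

Let normcB_weighted (u v : R[i]) (t : R) : 0 < t ->
  normc (u - v) ^+ 2 <= (1 + t^-1) * normc u ^+ 2 + (1 + t) * normc v ^+ 2.
Proof.
move=> t0; apply: (@le_trans _ _ ((normc u + normc v) ^+ 2)).
  apply: sqr_mono; first exact: normc_ge0.
  by apply: le_trans (le_normcD _ _) _; rewrite normcN.
move: (normc u) (normc v) => r s.
have hh : 0 <= t^-1 * (r - t * s) ^+ 2 by rewrite mulr_ge0 ?sqr_ge0// invr_ge0 ltW.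
rewrite -subr_ge0; apply: le_trans hh _; rewrite le_eqVlt; apply/orP; left; apply/eqP.
by field; rewrite gt_eqF.
Qed.

(** On the new shell the recursion combines the values on the last two. The
    value two shells below carries a factor [x q], and after the substitution it
    contributes the previous energy times [q], which is less than 1; the value
    one shell below has an additional factor [1 / x], of order [q^n]. The
    parameter [t] splits the square of the difference so that the main factor
    [(1 + t) q] stays below 1. *)
Let energy_rec n t : 0 < t -> b <= a / q ^+ n ->
  (energy n.+2 <= ((1 + t^-1) * (q / a) * q ^+ n)%:E * energy n.+1 +
     ((1 + t) * q)%:E * energy n)%E.
Proof.
move=> t0 bn; have t1 : 0 <= 1 + t by rewrite addr_ge0// ltW.
have t2 : 0 <= 1 + t^-1 by rewrite addr_ge0// invr_ge0 ltW.
have c0 : 0 <= (1 + t^-1) * (q / a) * q ^+ n.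
  by rewrite !mulr_ge0 ?exprn_ge0 ?invr_ge0// ltW.
rewrite -(int_sq n.+1) (EFinM (1 + t) q) -(muleA (1 + t)%:E) -int_sq2.
rewrite -!ge0_integralZl//; last 4 first.
- by apply/measurable_EFinP; apply: (measurableT_comp (msq2 n)); exact: mulrr_measurable.
- by move=> x _; rewrite lee_fin.
- exact/measurable_EFinP.
- by move=> x _; rewrite lee_fin.
rewrite -ge0_integralD//; last 4 first.
- by move=> x _; rewrite mule_ge0 ?lee_fin.
- by apply: emeasurable_funM => //; exact/measurable_EFinP.
- by move=> x _; rewrite mule_ge0 ?lee_fin.
- apply: emeasurable_funM => //; apply/measurable_EFinP.
  by apply: (measurableT_comp (msq2 n)); exact: mulrr_measurable.
apply: ae_ge0_le_integral => //.
- by move=> x _; rewrite lee_fin.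
- exact/measurable_EFinP.
- by move=> x _; rewrite adde_ge0// mule_ge0 ?lee_fin.
- apply: emeasurable_funD; apply: emeasurable_funM => //; apply/measurable_EFinP => //.
  by apply: (measurableT_comp (msq2 n)); exact: mulrr_measurable.
apply: aeW => x _; rewrite -!EFinM -EFinD lee_fin /dens.
case: ifP => [sx|_]; last by apply: addr_ge0; apply: mulr_ge0.
have x0 := shell_gt0 sx; have ax := shell_low sx; have xn : x <= a / q ^+ n.+2 by case/andP: sx.
have sx1 : shell n.+1 (x * q) by rewrite -shellS.
have sx2 : shell n (x * q * q) by rewrite -shellS.
have hx : h (x * q) = 0.
  apply: h_supp; rewrite negb_and -!ltNge; apply/orP; right; apply: le_lt_trans bn _.
  by case/andP: sx1 => + _; rewrite exprSr invfM mulrA divfK.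
have e2 : x * q ^+ 2 = x * q * q by rewrite expr2 mulrA.
rewrite tsolE ax xn /= hx mulr0 add0r e2.
have xqn : x * q * q <= a / q ^+ n by case/andP: sx2.
rewrite /sq2 /sq sx1 sx2 (tsolS xqn).
rewrite ler_pdivrMr ?gtr0_norm ?mulr_gt0//.
apply: le_trans (normcB_weighted _ _ t0) _.
rewrite normcM normc_real gtr0_norm ?mulr_gt0// [leRHS]mulrDl; apply: lerD; last first.
  by rewrite le_eqVlt; apply/orP; left; apply/eqP; ring.
have xa : a / q ^+ n < x * q by case/andP: sx1 => + _; rewrite exprSr invfM mulrA divfK.
set s := normc _ ^+ 2.
rewrite (_ : _ * x = (1 + t^-1) * s * (q / a * q ^+ n * x)); last by ring.
apply: ler_peMr; first by apply: mulr_ge0 => //; exact: sqr_ge0.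
rewrite ltr_pdivrMr ?exprn_gt0// in xa.
rewrite (_ : _ * x = x * q * q ^+ n / a); last by ring.
by rewrite ler_pdivlMr// mul1r ltW.
Qed.

Lemma energy_small e : 0 < e -> exists N, [/\ b <= a / q ^+ N, q ^+ N <= a,
  (energy N < e%:E)%E & (energy N.+1 < e%:E)%E].
Proof.
move=> e0; have b0 : 0 < b by apply: lt_trans ab.
have [d0 hd0] := @qexp_small R q q_gt0 q_lt1 (Num.min a (a / b)) ltac:(by rewrite lt_min a0 divr_gt0).
(* this choice makes (1 + t) q = (1 + q) / 2 *)
pose t : R := (1 - q) / (2 * q).
have t0 : 0 < t by rewrite divr_gt0 ?mulr_gt0// subr_gt0.
have tq : (1 + t) * q = (1 + q) / 2 by rewrite /t; field; rewrite q_neq0.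
have th : 0 <= (1 + t) * q < 1 by rewrite tq divr_ge0 ?addr_ge0// ltr_pdivrMr// mul1r (_ : 2 = 1 + 1)// ltrD2l.
have C0' : 0 <= (1 + t^-1) * (q / a).
  by apply: mulr_ge0; [rewrite addr_ge0// invr_ge0 ltW|rewrite divr_ge0// ltW].
have hb d : (d0 <= d)%N -> b <= a / q ^+ d /\ q ^+ d <= a.
  move=> d0d; have := le_qexp q_gt0 q_lt1 d0d; rewrite lt_min in hd0.
  case/andP: hd0 => h1 h2 h3; split; last by apply: le_trans h3 (ltW h1).
  rewrite ler_pdivlMr ?exprn_gt0// mulrC -ler_pdivlMr//.
  by apply: le_trans h3 (ltW h2).
have fe d : (fine (energy d))%:E = energy d by rewrite fineK// energy_fin.
have f0 d : 0 <= fine (energy d).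
  by rewrite -lee_fin fe; apply: integral_ge0 => x _; rewrite lee_fin.
have hrec d : (d0 <= d)%N -> fine (energy d.+2) <=
    (1 + t) * q * fine (energy d) + (1 + t^-1) * (q / a) * q ^+ d * fine (energy d.+1).
  move=> /hb[bd _]; rewrite -lee_fin EFinD !EFinM !fe addeC.
  by have := energy_rec t0 bd; rewrite !EFinM.
have [N [N0 h1 h2]] := two_step_decay q_gt0 q_lt1 th C0' f0 hrec e0.
by have [bN qN] := hb _ N0; exists N; split => //; rewrite -fe lte_fin.
Qed.

(** The cut-off solution satisfies the equation except on the last shell and on
    the one after it; the error there is controlled by the energies, because the
    last shell lies beyond 1. *)
Lemma tsol_residual n : b <= a / q ^+ n -> q ^+ n <= a ->
  (I2 mu (fun x => h x - qdiff q (tsol n.+1) x)%R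
    <= 3%:E * energy n.+1 + 2%:E * energy n)%E.
Proof.
move=> bn qa.
have mh := L2_mC Lh; have mt := mC_tsol.
pose B x := sq n.+1 (x * q) + (2 * sq n (x * q) + 2 * dens n.+1 x).
have mB : measurable_fun [set: T] B.
  by apply: measurable_funD => //; apply: measurable_funD; apply: measurable_funM.
have B0 x : 0 <= B x by rewrite !addr_ge0// mulr_ge0.
have IB : (\int[mu]_x (B x)%:E = 3%:E * energy n.+1 + 2%:E * energy n)%E.
  have m2 : measurable_fun [set: T] (fun x => 2 * sq n (x * q)) by exact: measurable_funM.
  have m3 : measurable_fun [set: T] (fun x => 2 * dens n.+1 x) by exact: measurable_funM.
  under eq_integral do rewrite EFinD.
  rewrite ge0_integralD//; last 4 first.
  - by move=> x _; rewrite lee_fin.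
  - exact/measurable_EFinP.
  - by move=> x _; rewrite lee_fin addr_ge0// mulr_ge0.
  - by apply/measurable_EFinP; exact: measurable_funD.
  under [X in (_ + X)%E]eq_integral do rewrite EFinD.
  rewrite ge0_integralD//; last 4 first.
  - by move=> x _; rewrite lee_fin mulr_ge0.
  - exact/measurable_EFinP.
  - by move=> x _; rewrite lee_fin mulr_ge0.
  - exact/measurable_EFinP.
  under [X in (_ + (X + _))%E]eq_integral do rewrite EFinM.
  under [X in (_ + (_ + X))%E]eq_integral do rewrite EFinM.
  rewrite !ge0_integralZl//; try by [exact/measurable_EFinP|move=> x _; rewrite lee_fin].
  rewrite !int_sq -/(energy n.+1) -(fineK (energy_fin n)) -(fineK (energy_fin n.+1)).
  by rewrite -!EFinM -!EFinD; congr (_%:E); ring.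
rewrite -IB; apply: ae_ge0_le_integral => //.
- by move=> x _; rewrite lee_fin sqr_ge0.
- by apply/measurable_EFinP; apply: mC_sq; apply: mCB => //; exact: mC_qdiff.
- by move=> x _; rewrite lee_fin.
- exact/measurable_EFinP.
apply: (ae_sub _ ae_pos) => x x0 _; rewrite lee_fin.
have xn0 : x != 0 by rewrite gt_eqF.
have xq0 : 0 < x * q by rewrite mulr_gt0.
have xqx : x * q <= x by rewrite ler_piMr ?ltW.
have xxq : x <= x / q by rewrite ler_pdivlMr.
have [xa|ax] := leP x (a * q).
  rewrite /qdiff !tsol_low ?ler_pdivrMr//; last 2 first.
  - by apply: le_trans xa _; rewrite ler_piMr ?ltW.
  - by apply: le_trans xqx (le_trans xa _); rewrite ler_piMr ?ltW.
  rewrite h_supp; first by rewrite !mulr0 !subr0 addr0 subrr normc0 expr0n/=.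
  rewrite negb_and -ltNge; apply/orP; left; apply: le_lt_trans xa _.
  by rewrite gtr_pMr.
have aqn : a / q ^+ n.+1 * q = a / q ^+ n by rewrite exprSr invfM mulrA divfK.
have [xn|nx] := leP x (a / q ^+ n).
  rewrite /qdiff tsol_rec ?aqn//.
  rewrite (_ : _ - _ = 0) ?normc0 ?expr0n//=.
  by rewrite fmorphV/=; field; exact: C0.
have hx : h x = 0.
  by apply: h_supp; rewrite negb_and -!ltNge (le_lt_trans bn nx) orbT.
have hi : tsol n.+1 (x / q) = 0.
  by apply: tsol_high; rewrite ltr_pdivlMr// aqn.
rewrite hx sub0r normcN /qdiff hi mulr0 addr0.
have [xn1|n1x] := leP x (a / q ^+ n.+1).
  have sx : shell n.+1 x by rewrite /shell aqn nx.
  have xqn : x * q <= a / q ^+ n by rewrite -aqS.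
  apply: (@le_trans _ _ (2 * sq n (x * q) + 2 * dens n.+1 x)); last by rewrite lerDr.
  rewrite -mulrDr (tsolS xqn) /sq -shellS sx /dens sx.
  apply: le_trans (normcD_sqr _ _) _; rewrite ler_wpM2l// normcN normcM exprMn lerD2l.
  rewrite mulrC ler_wpM2l ?sqr_ge0// normc_real !gtr0_norm ?invr_gt0//.
  rewrite expr2 ler_piMr ?invr_ge0 ?(ltW x0)// invf_le1//.
  by apply: le_trans (ltW nx); rewrite ler_pdivlMr ?exprn_gt0// mul1r.
rewrite (tsol_high n1x) mulr0 subr0.
apply: (@le_trans _ _ (sq n.+1 (x * q))); last by rewrite lerDl addr_ge0// mulr_ge0.
rewrite /sq -shellS; case: ifP => // /negbT sN; rewrite tsol_high ?normc0 ?expr0n//=.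
move: sN; rewrite /shell negb_and -leNgt -ltNge => /orP[|].
  by rewrite exprSr invfM mulrA divfK// leNgt n1x.
by rewrite !ltNge aqS.
Qed.

End truncated_solution.
(** The range of the minimal operator is dense: solve [L f = h] from the left
    and cut the solution off far to the right. *)
Lemma range0_dense h (e : R) : L2 mu h -> 0 < e -> exists f,
  [/\ L2 mu f, compactly_supported mu f & (I2 mu (fun x => h x - qdiff q f x)%R < e%:E)%E].
Proof.
move=> Lh e0; have mh := L2_mC Lh.
pose P n x : bool := (n.+1%:R^-1 <= x) && (x <= n.+2%:R).
have mP n : measurable_fun [set: T] (P n).
  by apply: measurable_and; exact: measurable_fun_ler.
have [||n hn] := @I2_trunc R mu P h (e / 4) mP Lh; last 1 first.
  - pose h0 x := if P n x then h x else 0.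
    have mh0 : mC h0 by apply: mC_if => //; exact: mC_cst.
    have Lh0 : L2 mu h0.
      apply: (@L2_le _ _ _ h 1) => //; apply: aeW => x; rewrite mul1r /h0.
      by case: ifP => // _; rewrite normc0 expr0n/= sqr_ge0.
    pose a : R := n.+1%:R^-1; pose b : R := n.+2%:R.
    have a0 : 0 < a by rewrite invr_gt0.
    have ab : a < b.
      apply: (@le_lt_trans _ _ 1); first by rewrite invf_le1 ?ltr0n// ler1n.
      by rewrite ltr1n.
    have h0s x : ~~ (a <= x <= b) -> h0 x = 0 by rewrite /h0 /P => /negbTE ->.
    have e40 : 0 < e / 40 by rewrite divr_gt0.
    have [N [bN qN e1 e2]] := energy_small a0 ab Lh0 h0s e40.
    have mt : mC (tsol a h0 N.+1) by exact: mC_tsol.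
    exists (tsol a h0 N.+1); split.
    + exact: L2_tsol h0s _.
    + exists a, (a / q ^+ N.+1); split => //.
        by rewrite ltr_pdivlMr ?exprn_gt0// gtr_pMr// exprn_ilt1.
      apply: aeW => x /negP; rewrite negb_and -!ltNge => /orP[xa|xa].
        by rewrite tsol_low// ltW.
      exact: tsol_high.
    + rewrite (_ : (fun x => _) = (fun x => (if P n x then 0 else h x) +
          (h0 x - qdiff q (tsol a h0 N.+1) x))); last first.
        by apply/funext => x; rewrite /h0; case: ifP => _; rewrite ?add0r ?sub0r.
      have mr : mC (fun x => h0 x - qdiff q (tsol a h0 N.+1) x).
        by apply: mCB => //; exact: mC_qdiff.
      apply: le_lt_trans (I2D _ (mC_trunc n mP mh) mr) _.
      have h5 : (I2 mu (fun x => h0 x - qdiff q (tsol a h0 N.+1) x)%R <= (e / 8)%:E)%E.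
        apply: le_trans (tsol_residual a0 Lh0 h0s bN qN) _.
        apply: (@le_trans _ _ (3%:E * (e / 40)%:E + 2%:E * (e / 40)%:E)%E).
          by apply: leeD; rewrite lee_wpmul2l// ltW.
        by rewrite -!EFinM -EFinD lee_fin; lra.
      apply: (@le_lt_trans _ _ (2%:E * ((e / 4)%:E + (e / 8)%:E))%E).
        by rewrite lee_wpmul2l// leeD// ltW.
      by rewrite -EFinD -EFinM lte_fin; lra.
- apply: (ae_sub _ ae_pos) => x x0.
  exists (Num.bound x + Num.bound x^-1)%N => n hn; apply/andP; split.
    rewrite -[x]invrK lef_pV2 ?posrE ?invr_gt0//.
    apply: le_trans (ltW (archi_boundP _)) _; first by rewrite invr_ge0 ltW.
    by rewrite ler_nat; lia.
  apply: le_trans (ltW (archi_boundP (ltW x0))) _.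
  by rewrite ler_nat; lia.
- by rewrite divr_gt0.
Qed.

Lemma I2_pythagoras f g : L2 mu f -> L2 mu g -> ipL2 mu f g = 0 ->
  (I2 mu g <= I2 mu (fun x => g x - f x)%R)%E.
Proof.
move=> Lf Lg; have [mf fi] := (L2P mu f).1 Lf; have [mg gi] := (L2P mu g).1 Lg.
have cfg := cintM Lf (L2_conj Lg).
have iR := cint_Re cfg.
rewrite /ipL2 /cintegral => -[+ _]; rewrite /Rintegral => h0.
pose u x := complex.Re (f x * (g x)^*).
have u0 : (\int[mu]_x (u x)%:E = 0)%E.
  move/eqP: h0; rewrite fine_eq0; first by move/eqP.
  exact: (integrable_fin_num measurableT iR).
have e x : normc (g x - f x) ^+ 2 = (normc (g x) ^+ 2 + normc (f x) ^+ 2) - 2 * u x.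
  rewrite /u !normc_sqr; case: (f x) (g x) => a b [c d] /=; ring.
have iG h1 : L2 mu h1 -> mu.-integrable [set: T] (EFin \o (fun x => normc (h1 x) ^+ 2)).
  move=> /L2P[m i]; apply/integrableP; split; first by apply/measurable_EFinP; exact: mC_sq.
  rewrite (_ : integral _ _ _ = I2 mu h1)//; apply: eq_integral => x _ /=.
  by rewrite ger0_norm ?sqr_ge0.
have iu : mu.-integrable [set: T] (fun x => (u x)%:E) by exact: iR.
have i2u : mu.-integrable [set: T] (fun x => (2%:E * (u x)%:E)%E).
  exact: integrableZl.
have E : I2 mu (fun x => g x - f x) = (I2 mu g + I2 mu f)%E.
  transitivity (\int[mu]_x ((normc (g x) ^+ 2)%:E + (normc (f x) ^+ 2)%:E
      - 2%:E * (u x)%:E))%E.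
    by apply: eq_integral => x _; rewrite e EFinB EFinD EFinM.
  rewrite integralB//; last exact: integrableD (iG _ Lg) (iG _ Lf).
  rewrite integralZl// u0 mule0 sube0 integralD//; exact: iG.
by rewrite E leeDl// I2_ge0.
Qed.

(** The kernel of the adjoint is orthogonal to the range of [L], which comes
    arbitrarily close to [g] itself. *)
Lemma kernel0 g h : adjoint mu (Lop mu q) (g, h) -> eqL2 mu h (fun=> 0) ->
  eqL2 mu g (fun=> 0).
Proof.
move=> [/= Lg Lh adj] h0; have mg := L2_mC Lg.
apply: I2_eq0 => //; apply/eqP; rewrite eq_le I2_ge0 andbT.
apply/lee_addgt0Pr => e e0; rewrite add0e.
have [f [Lf cf small]] := range0_dense Lg e0.
apply: le_trans (ltW small); apply: I2_pythagoras => //.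
  have [a a0 fa] := compactly_supported_low cf.
  rewrite /qdiff; apply: L2D; [apply: L2B|].
  - exact: (L2_comp_scale q_gt0 Hmu Lf a0 fa).
  - exact: (L2_inv_mul Hmu Lf a0 fa).
  - exact: (L2_inv_comp_scaleV q_gt0 Hmu Lf a0 fa).
rewrite (adj f (qdiff q f)) // /ipL2 (@eq_cintegral _ _ _ (fun=> 0)).
- by rewrite /cintegral /Rintegral integral0.
- by apply: mCM; [exact: L2_mC Lf|apply: mC_conj; exact: L2_mC Lh].
- exact: mC_cst.
- apply: (ae_sub _ h0) => x ->.
  by rewrite rmorph0 mulr0.
Qed.

End zero.

(** * Density of the range off 0, and approximate eigenfunctions *)

Section density.
Context {R : realType} (q : R).
Local Notation T := (measurableTypeR R).
Variable mu : {measure set T -> \bar R}.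
Hypotheses (q_gt0 : 0 < q) (q_lt1 : q < 1) (Hmu : qscaling q mu).
Local Notation Lstar := (adjoint mu (Lop mu q)).
Implicit Types (x : R) (f h : R -> R[i]) (lam : R[i]).

Let q_ge0 : 0 <= q. Proof. exact: ltW. Qed.
Let q_neq0 : q != 0. Proof. by rewrite gt_eqF. Qed.
Let C0 x : x != 0 -> x%:C != 0 :> R[i].
Proof. by apply: contra => /eqP[] /eqP. Qed.
Let ae_pos : {ae mu, forall x, 0 < x}. Proof. by case: Hmu. Qed.

Lemma measurable_forall (J : countType) (P : J -> R -> bool) :
  (forall i, measurable_fun [set: T] (P i)) ->
  measurable_fun [set: T] (fun x => `[< forall i, P i x >]).
Proof.
move=> mP; apply: (measurable_fun_bool true).
pose B n : set T := if unpickle n is Some i then [set x | P i x] else setT.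
rewrite setTI (_ : _ @^-1` _ = \bigcap_n B n).
  apply: bigcapT_measurable => n; rewrite /B; case: unpickle => [i|//].
  by have := mP i measurableT [set true] ltac:(by []); rewrite setTI.
apply/seteqP; split => x /=.
  move=> /eqP; rewrite eqb_id => /asboolP h n _; rewrite /B.
  by case: unpickle => //= i; exact: h.
move=> h; apply/eqP; rewrite eqb_id; apply/asboolP => i.
by have := h (pickle i) I; rewrite /B pickleK.
Qed.

Lemma measurable_away lam eps :
  measurable_fun [set: T] (fun x => `[< away q eps (lam * x%:C) >]).
Proof.
have ml : mC (fun x => lam * x%:C) by apply: mCZ; apply: mC_real; exact: measurable_id.
apply: (@measurable_forall int (fun i x =>
  eps * (1 + normc (lam * x%:C) * q ^ i) <= normc (1 + lam * x%:C * (q ^ i)%:C))) => i.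
apply: measurable_fun_ler.
  apply: measurable_funM => //; apply: measurable_funD => //.
  by apply: measurable_funM => //; exact: mC_normc.
by apply: mC_normc; apply: mCD; [exact: mC_cst|apply: mCM => //; exact: mC_cst].
Qed.

Lemma away_le (e1 e2 : R) (z : R[i]) : e1 <= e2 -> away q e2 z -> away q e1 z.
Proof.
move=> e12 h i; apply: le_trans (h i); rewrite ler_wpM2r// addr_ge0// mulr_ge0 ?normc_ge0//.
exact: exprz_ge0.
Qed.

(** The sets on which the resolvent is available for [1 / (n + 1)] exhaust the
    half-line, whether or not [lam] belongs to the spectrum. *)
Lemma away_ae lam : lam != 0 ->
  {ae mu, forall x, exists m, forall n, (m <= n)%N ->
    (0 < x) && `[< away q n.+1%:R^-1 (lam * x%:C) >]}.
Proof.
move=> l0; apply: (ae2 _ ae_pos (ae_off_lattice q_gt0 Hmu lam)) => x x0 nz.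
have [d d0 hd] := orbit_gap q_gt0 q_lt1 l0 x0 nz.
have := away_of_gap q_gt0 l0 x0 d0 hd; set e := Num.min _ _ => he.
have e0 : 0 < e by rewrite lt_min invr_gt0 ltr0n/= divr_gt0// mulr_gt0// normc_gt0.
exists (Num.bound e^-1) => n hn; rewrite x0/=; apply/asboolP.
apply: away_le he; rewrite -[e]invrK lef_pV2 ?posrE ?invr_gt0//.
apply: le_trans (ltW (archi_boundP _)) _; first by rewrite invr_ge0 ltW.
by rewrite ler_nat; lia.
Qed.

Lemma resolvent_range lam eps h : lam != 0 -> (forall i, lam^-1 * q%:C ^+ i != 1) ->
  0 < eps -> eps <= 1 -> L2 mu h ->
  (forall x, h x != 0 -> 0 < x /\ away q eps (lam * x%:C)) -> range_sub mu Lstar lam h.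
Proof.
move=> l0 lQ e0 e1 Lh gh.
have [M M0 hM] := green_resolvent q_gt0 q_lt1 Hmu l0 lQ e0 e1.
have [Lf _ fe] := hM h Lh gh; split => //.
exists (green q lam h), (qdiff q (green q lam h)); split => //.
apply/adjointP => //; split => //; last by apply: aeW.
apply: (@L2_ae _ _ _ (fun x => h x + lam * green q lam h x)).
- by apply: mC_qdiff; exact: L2_mC Lf.
- by apply: L2D => //; exact: L2Z.
- by apply: (ae_sub _ fe) => x ->; rewrite subrK.
Qed.

(** Cut [h] down to the set where the Green operator is bounded. *)
Lemma range_dense lam : lam != 0 -> (forall i, lam^-1 * q%:C ^+ i != 1) ->
  denseL2 mu (range_sub mu Lstar lam).
Proof.
move=> l0 lQ h Lh e e0; have mh := L2_mC Lh.
pose P n x := (0 < x) && `[< away q n.+1%:R^-1 (lam * x%:C) >].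
have mP n : measurable_fun [set: T] (P n).
  by apply: measurable_and; [exact: measurable_fun_ltr|exact: measurable_away].
have [n hn] := I2_trunc mP Lh (away_ae l0) (exprn_gt0 2 e0).
exists (fun x => if P n x then h x else 0).
  apply: (@resolvent_range _ n.+1%:R^-1) => //.
  - by rewrite invf_le1 ?ler1n.
  - apply: (@L2_le _ _ _ h 1) => //.
      by apply: mC_if => //; exact: mC_cst.
    apply: aeW => x; rewrite mul1r.
    by case: ifP => // _; rewrite normc0 expr0n/= sqr_ge0.
  - by move=> x; rewrite /P; case: ifP => [/andP[x0 /asboolP]|]; rewrite ?eqxx.
apply: normL2_lt => //; rewrite (_ : (fun x => _) = fun x => if P n x then 0 else h x)//.
by apply/funext => x; case: ifP => _; rewrite ?subrr ?subr0.
Qed.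

Lemma range_dense0 : denseL2 mu (range_sub mu Lstar 0).
Proof.
move=> h Lh e e0; have [f [Lf cf hf]] := range0_dense q_gt0 q_lt1 Hmu Lh (exprn_gt0 2 e0).
have [a a0 fa] := compactly_supported_low cf.
have Lq : L2 mu (qdiff q f).
  rewrite /qdiff; apply: L2D; [apply: L2B|].
  - exact: (L2_comp_scale q_gt0 Hmu Lf a0 fa).
  - exact: (L2_inv_mul Hmu Lf a0 fa).
  - exact: (L2_inv_comp_scaleV q_gt0 Hmu Lf a0 fa).
exists (qdiff q f); last exact: normL2_lt.
split => //; exists f, (qdiff q f); split.
  by apply/adjointP => //; split => //; apply: aeW.
by apply: aeW => x; rewrite mul0r subr0.
Qed.

End density.

Section approximate_eigenvalues.
Context {R : realType} (q : R).
Local Notation T := (measurableTypeR R).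
Variable mu : {measure set T -> \bar R}.
Hypotheses (q_gt0 : 0 < q) (q_lt1 : q < 1) (Hmu : qscaling q mu).
Local Notation Q := (q%:C).
Local Notation Lstar := (adjoint mu (Lop mu q)).
Implicit Types (x : R) (f h : R -> R[i]) (lam : R[i]).

Let q_ge0 : 0 <= q. Proof. exact: ltW. Qed.
Let q_neq0 : q != 0. Proof. by rewrite gt_eqF. Qed.
Let Qn0 : Q != 0. Proof. exact: Q_neq0. Qed.
Let C0 x : x != 0 -> x%:C != 0 :> R[i].
Proof. by apply: contra => /eqP[] /eqP. Qed.
Let ae_pos : {ae mu, forall x, 0 < x}. Proof. by case: Hmu. Qed.

Lemma base_id x : q < x -> x <= 1 -> base q x = x.
Proof.
move=> qx x1; have x0 : 0 < x by apply: lt_trans qx.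
suff n0 : qlog q x = 0 by rewrite /base n0 oppr0 expr0z mulr1.
apply: floor_def; rewrite /= add0r ler_ndivlMr ?lnq_lt0// mul0r.
by rewrite ltr_ndivrMr ?lnq_lt0// mul1r ltr_ln ?posrE// qx ln_le0.
Qed.

Section eigenpacket.
Variables (c lo hi : R) (l : int).
Hypotheses (c0 : 0 < c) (lo_gt : c * q < lo) (hi_lt : hi < c).

(** The point of the orbit of [x] in the interval [(c q, c]]. *)
Definition rep x : R := c * base q (x / c).

Let rep_gt0 x : 0 < x -> 0 < rep x.
Proof. by move=> x0; rewrite mulr_gt0// base_gt0// divr_gt0. Qed.

Let rep_le x : 0 < x -> rep x <= c.
Proof.
move=> x0; have /andP[_ h] := base_itv q_gt0 q_lt1 (divr_gt0 x0 c0).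
by rewrite ler_piMr// ltW.
Qed.

Let rep_gt x : 0 < x -> c * q < rep x.
Proof.
move=> x0; have /andP[h _] := base_itv q_gt0 q_lt1 (divr_gt0 x0 c0).
by rewrite ltr_pM2l.
Qed.

Let rep_scale x (i : int) : 0 < x -> rep (x * q ^ i) = rep x.
Proof. by move=> x0; rewrite /rep mulrAC base_scale// divr_gt0. Qed.

Let repE x : 0 < x -> exists k : int, x = rep x * q ^ k.
Proof.
move=> x0; exists (qlog q (x / c)); rewrite /rep -mulrA -baseE ?divr_gt0//.
by rewrite mulrC divfK// gt_eqF.
Qed.

Let rep_id x : lo < x -> x < hi -> rep x = x.
Proof.
move=> lx xh; rewrite /rep base_id ?ltr_pdivlMr ?ler_pdivrMr// ?mul1r.
- by rewrite mulrC divfK// gt_eqF.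
- by rewrite mulrC (lt_trans lo_gt).
- by rewrite ltW// (lt_trans xh).
Qed.

Let mrep : measurable_fun [set: T] (rep : T -> T).
Proof.
apply: measurable_funM => //.
by apply: (measurableT_comp (measurable_base q_gt0)); exact: mulrr_measurable.
Qed.

Definition eigv x : R := - (q ^ l / rep x).

(** A superposition of formal eigenfunctions, one for each orbit through
    [(lo, hi)], with eigenvalue [eigv]; it is an approximate eigenfunction when
    the interval is short. *)
Definition packet x : R[i] :=
  if (lo < rep x) && (rep x < hi) then
    phi11 q ((eigv x)^-1)%:C ((eigv x * x)%:C)
  else 0.

Lemma mC_packet : mC packet.
Proof.
have mrepV : measurable_fun [set: T] (fun x => (rep x)^-1).
  exact: (measurableT_comp (@measurable_inv R) mrep).
have me : measurable_fun [set: T] eigv.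
  by apply: measurableT_comp; [exact: oppr_measurable|exact: measurable_funM].
apply: mC_if; last exact: mC_cst.
  by apply: measurable_and; exact: measurable_fun_ltr.
apply: mC_F2; apply: mC_real.
  exact: measurable_funM.
exact: (measurableT_comp (@measurable_inv R) me).
Qed.

Lemma packet_eq : eqL2 mu (qdiff q packet) (fun x => (eigv x)%:C * packet x).
Proof.
apply: (ae_sub _ ae_pos) => x x0; have xn0 : x != 0 by rewrite gt_eqF.
have r0 := rep_gt0 x0.
have e1 : rep (x * q) = rep x by have := rep_scale 1 x0; rewrite expr1z.
have e2 : rep (x / q) = rep x by have := rep_scale (-1) x0; rewrite exprN1.
rewrite /qdiff /packet /eigv e1 e2; case: ifP => _; last by rewrite !mulr0 subr0 addr0.
rewrite -/(eigv x); have ln0 : (eigv x)%:C != 0 :> R[i].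
  by rewrite C0// oppr_eq0 mulf_neq0 ?invr_eq0 ?expfz_neq0// gt_eqF.
rewrite !(rmorphM _ (eigv x)) (fmorphV _ (eigv x))/= phi_rec//.
by ring.
Qed.

(** Near 0 the series is bounded. At the other end of the orbit the argument is
    [- q^-m], and self-duality turns the value into a bounded one times
    [y^m], which grows like a power of [x]. *)
Lemma packet_bound : exists K p, {ae mu, forall x, normc (packet x) <= K * (1 + x ^+ p)}.
Proof.
have ql0 : 0 < q ^ l by rewrite exprz_gt0.
pose Y := c / q ^ l; have Y0 : 0 < Y by rewrite divr_gt0.
have [p hp] := @qexp_small R q q_gt0 q_lt1 Y^-1 ltac:(by rewrite invr_gt0).
have [C C1 hC] := F_le q_gt0 q_lt1 (ltW Y0).
have C_0 : 0 <= C by apply: le_trans C1.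
pose K0 := C * ptheta q 1.
have K00 : 0 <= K0 by rewrite mulr_ge0// (le_trans ler01)// ptheta_ge1.
exists (K0 * (1 + (q ^ l / (c * q)) ^+ p)), p.
apply: (ae_sub _ ae_pos) => x x0; have r0 := rep_gt0 x0.
have B0 : 0 <= (q ^ l / (c * q)) ^+ p by rewrite exprn_ge0// divr_ge0 ?mulr_ge0 ?ltW.
have xp0 : 0 <= x ^+ p by rewrite exprn_ge0// ltW.
rewrite /packet; case: ifP => _; last first.
  by rewrite normc0; apply: mulr_ge0; [apply: mulr_ge0 => //|]; exact: addr_ge0.
set y := rep x / q ^ l.
have y0 : 0 < y by rewrite divr_gt0.
have yY : y <= Y by rewrite ler_pM2r ?invr_gt0// rep_le.
have -> : ((eigv x)^-1)%:C = - y%:C :> R[i].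
  by rewrite /eigv invrN invfM invrK mulrC rmorphN.
have yC : normc (- y%:C) <= Y by rewrite normcN normc_real gtr0_norm.
have [k xk] := repE x0.
have ez : eigv x * x = - q ^ (l + k).
  by rewrite {2}xk /eigv expfzDr// mulNr mulrA divfK// gt_eqF.
have hK j : normc (phi11 q (- y%:C) (- Q ^+ j)) <= K0.
  apply: le_trans (hC _ _ yC) _; rewrite ler_wpM2l// le_ptheta ?normc_ge0//.
  by rewrite normcN normcQ// exprn_ile1// ltW.
rewrite ez; case ej : (l + k) => [j|j].
  rewrite -exprnP (_ : (- q ^+ j)%:C = - Q ^+ j); last by rewrite QE rmorphN.
  apply: le_trans (hK j) _.
  by rewrite -mulrA ler_peMr// mulrDl mul1r -addrA lerDl addr_ge0 ?mulr_ge0// addr_ge0.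
rewrite NegzE -exprnN; set m := j.+1.
rewrite (_ : (- q ^- m)%:C = - Q ^- m); last by rewrite QE rmorphN fmorphV.
rewrite F_selfdual// normcM normc_exp normcN normc_real gtr0_norm//.
have qm : q ^+ m != 0 by rewrite expf_neq0.
have ym : y ^+ m <= (q ^ l / (c * q)) ^+ p * x ^+ p.
  apply: (@le_trans _ _ ((q ^- m) ^+ p)).
    rewrite -exprVn -exprM mulnC exprM lerXn2r ?nnegrE ?(ltW y0) ?exprn_ge0 ?invr_ge0//.
    apply: le_trans yY _; rewrite exprVn -[Y]invrK lef_pV2 ?posrE ?invr_gt0 ?exprn_gt0//.
    exact: ltW.
  rewrite -exprMn lerXn2r ?nnegrE ?invr_ge0 ?exprn_ge0 ?mulr_ge0 ?invr_ge0 ?mulr_ge0 ?(ltW x0) ?(ltW c0) ?(ltW ql0)//.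
  have -> : q ^- m = q ^ l * x / rep x.
    rewrite {1}xk mulrCA mulrAC divff ?gt_eqF// mul1r -expfzDr// ej NegzE -exprnN//.
  have cq0 : 0 < c * q by rewrite mulr_gt0.
  have lx0 : 0 < q ^ l * x by rewrite mulr_gt0.
  rewrite [leRHS]mulrAC ler_pM2l// lef_pV2 ?posrE//.
  by rewrite ltW// rep_gt.
apply: (@le_trans _ _ ((q ^ l / (c * q)) ^+ p * x ^+ p * K0)).
  by apply: ler_pM => //; rewrite ?exprn_ge0 ?normc_ge0 ?(ltW y0).
rewrite mulrC -[leRHS]mulrA ler_wpM2l// mulrDl mul1r mulrDr mulr1.
by rewrite addrA lerDr !addr_ge0.
Qed.

Lemma L2_packet : L2 mu packet.
Proof.
have [K [p hK]] := packet_bound.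
apply: (@L2_le _ _ _ (fun x => (1 + x ^+ p)%:C) (K ^+ 2)).
- exact: mC_packet.
- under eq_fun do rewrite rmorphD/=.
  apply: L2D; last exact: (L2_monomial q_gt0 Hmu).
  exact: (L2_monomial q_gt0 Hmu 0).
- exact: sqr_ge0.
- apply: (ae2 _ ae_pos hK) => x x0 h; rewrite -exprMn; apply: sqr_mono.
    exact: normc_ge0.
  by rewrite normc_real ger0_norm// addr_ge0// exprn_ge0// ltW.
Qed.

(** On an orbit through [(lo, hi)] the packet tends to 1 at 0, so it can vanish
    only if almost no orbit passes there. *)
Lemma packet_neq0 : eqL2 mu packet (fun=> 0) -> mu `]lo, hi[%classic = 0%E.
Proof.
move=> h.
have [C C_0 hC] := F_near0 q_gt0 q_lt1 (ltW (divr_gt0 c0 (exprz_gt0 l q_gt0))).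
have [N [mN N0 hN]] : {ae mu, forall x, ~ (`]lo, hi[%classic x)}.
  apply: (ae2 _ ae_pos (ae_orbit q_gt0 Hmu h)) => x x0 hx /=.
  rewrite in_itv/= => /andP[lx xh].
  have [d hd] := @qexp_small R q q_gt0 q_lt1 ((C + 1) * (q ^ l + 1))^-1
    ltac:(by rewrite invr_gt0 mulr_gt0// ltr_wpDl// exprz_ge0).
  have ql0 : 0 < q ^ l by rewrite exprz_gt0.
  have qd0 : 0 < q ^+ d by rewrite exprn_gt0.
  have := hx d; rewrite /packet /eigv rep_scale// rep_id// lx xh/=.
  have -> : - (q ^ l / x) * (x * q ^ d) = - (q ^ l * q ^+ d).
    by rewrite exprnP; field; rewrite gt_eqF.
  set A := (_^-1)%:C; set z := (- _)%:C => F0.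
  have nA : normc A <= c / q ^ l.
    rewrite /A normc_real invrN normrN invfM invrK gtr0_norm ?mulr_gt0 ?invr_gt0//.
    by rewrite mulrC ler_pM2r ?invr_gt0// ltW// (lt_trans xh).
  have nz : normc z = q ^ l * q ^+ d by rewrite /z normc_real normrN gtr0_norm ?mulr_gt0.
  have K0 : 0 < (C + 1) * (q ^ l + 1).
    by apply: mulr_gt0; [rewrite ltr_wpDl|rewrite addr_gt0].
  rewrite -(ltr_pM2l K0) divff ?gt_eqF// in hd.
  have Cl : 0 <= C * (q ^ l * q ^+ d) by rewrite !mulr_ge0// ltW.
  have Cd : 0 <= C * q ^+ d by rewrite mulr_ge0// ltW.
  have ld : 0 <= q ^ l * q ^+ d by rewrite mulr_ge0// ltW.
  have := hC A z nA; rewrite nz F0 sub0r normcN normc1.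
  have l1 : q ^ l * q ^+ d <= 1 by lra.
  by move=> /(_ l1); lra.
apply/eqP; rewrite -measure_le0 -N0; apply: le_measure; rewrite ?inE//.
by move=> x hx; apply: hN => /=; apply.
Qed.

End eigenpacket.

(** A packet around a support point [t] whose eigenvalue is close to [lam]
    satisfies [|(L* - lam) f| <= d |f|] with [d] as small as desired, against
    the bound on the resolvent. *)
Lemma cont_not_resolvent (lam : R) :
  closure (\bigcup_(l in [set: int]) Omega_tilde mu q l) lam ->
  ~ resolvent_set mu Lstar lam%:C.
Proof.
move=> cl [_ _ [M hM]].
pose d : R := (`|M| + 1)^-1.
have d0 : 0 < d by rewrite invr_gt0 ltr_wpDl.
have [z [[l _ [t [tq t_supp] <-]] zlam]] := cl _ (nbhsx_ballx lam (d / 2) ltac:(by rewrite divr_gt0)).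
have /andP[qt t1] : q < t <= 1 by move: tq; rewrite /= in_itv.
have t0 : 0 < t by apply: lt_trans qt.
have ql0 : 0 < q ^ l by rewrite exprz_gt0.
have [r r0 hr] : exists2 r, 0 < r & forall y, `|t - y| < r -> `|q ^ l / t - q ^ l / y| < d / 2.
  exists (Num.min (t / 2) (d * t ^+ 2 / (4 * q ^ l))).
    by rewrite lt_min !divr_gt0// ?mulr_gt0 ?exprn_gt0.
  move=> y; rewrite lt_min => /andP[y1 y2].
  have yt : t / 2 < y by move: y1; rewrite ltr_norml => /andP[_]; lra.
  have y0 : 0 < y by apply: lt_trans yt; rewrite divr_gt0.
  have -> : q ^ l / t - q ^ l / y = (q ^ l / (t * y)) * (- (t - y)).
    by field; rewrite !gt_eqF.
  rewrite normrM normrN gtr0_norm ?divr_gt0 ?mulr_gt0//.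
  rewrite ltr_pdivlMr ?mulr_gt0// in y2.
  rewrite mulrAC ltr_pdivrMr ?mulr_gt0//.
  have : d / 2 * (t * (t / 2)) < d / 2 * (t * y) by rewrite !ltr_pM2l ?divr_gt0.
  apply: le_lt_trans; rewrite -(ler_pM2l (_ : 0 < 4))//.
  rewrite (_ : 4 * (q ^ l * _) = `|t - y| * (4 * q ^ l)); last by ring.
  by apply: le_trans (ltW y2) _; rewrite le_eqVlt; apply/orP; left; apply/eqP; field.
(* t lies strictly between c q and c, so nearby points represent their orbits *)
pose c := t * (1 + q^-1) / 2.
have c0 : 0 < c by rewrite divr_gt0// mulr_gt0// addr_gt0 ?invr_gt0.
have ct : t < c.
  have q1 : 1 < q^-1 by rewrite invf_gt1.
  have : t * 1 < t * q^-1 by rewrite ltr_pM2l.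
  by rewrite /c; lra.
have cqt : c * q < t.
  have -> : c * q = t * (q + 1) / 2 by rewrite /c; field.
  have : t * q < t * 1 by rewrite ltr_pM2l.
  lra.
pose lo := Num.max ((c * q + t) / 2) (t - r).
pose hi := Num.min ((c + t) / 2) (t + r).
have lo_gt : c * q < lo by rewrite lt_max; apply/orP; left; lra.
have hi_lt : hi < c by rewrite gt_min; apply/orP; left; lra.
have lt_ : lo < t by rewrite gt_max; apply/andP; split; lra.
have th : t < hi by rewrite lt_min; apply/andP; split; lra.
pose f := packet c lo hi l.
have Lf : L2 mu f by exact: L2_packet.
have mf := L2_mC Lf.
have fe := packet_eq lo hi l c0.
have key x : f x != 0 -> `|eigv c l x - lam| <= d.
  rewrite /f /packet; case: ifP => [/andP[]|]; last by rewrite eqxx.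
  rewrite gt_max lt_min => /andP[_ h1] /andP[_ h2] _.
  have : `|t - rep c x| < r by rewrite ltr_norml; apply/andP; split; lra.
  move=> /hr h3; rewrite /ball/= in zlam; rewrite /eigv.
  rewrite (_ : - _ - lam = (q ^ l / t - q ^ l / rep c x) - (lam - - (q ^ l / t))); last by ring.
  apply: le_trans (ler_normB _ _) _; lra.
have Lq : L2 mu (qdiff q f).
  apply: (@L2_le _ _ _ f (((`|lam| + d) ^+ 2))); rewrite ?sqr_ge0//; first exact: mC_qdiff.
  apply: (ae_sub _ fe) => x ->; rewrite -/f normcM normc_real exprMn.
  have [->|/key fx] := eqVneq (f x) 0; first by rewrite normc0 expr0n/= !mulr0.
  rewrite ler_wpM2r ?sqr_ge0//; apply: sqr_mono => //.
  by rewrite -[eigv _ _ _](subrK lam) addrC; apply: le_trans (ler_normD _ _) _; rewrite lerD2l.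
have fA : Lstar (f, qdiff q f).
  by apply/adjointP => //; split => //; apply: aeW.
have := normL2_leW (hM _ _ fA).
have close : (I2 mu (fun x => qdiff q f x - lam%:C * f x)%R <= (d ^+ 2)%:E * I2 mu f)%E.
  apply: I2_le => //; rewrite ?sqr_ge0//.
  - by apply: mCB; [exact: mC_qdiff|exact: mCZ].
  - apply: (ae_sub _ fe) => x ->; rewrite -/f -mulrBl -rmorphB/= normcM normc_real exprMn.
    have [->|/key fx] := eqVneq (f x) 0; first by rewrite normc0 expr0n/= !mulr0.
    by rewrite ler_wpM2r ?sqr_ge0//; exact: sqr_mono.
move=> hM2.
have f0 : I2 mu f = 0%E.
  have /fineK ff : I2 mu f \is a fin_num by rewrite ge0_fin_numE ?L2_I2// I2_ge0.
  have Ms : 0 <= M ^+ 2 by rewrite sqr_ge0.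
  have : (I2 mu f <= (M ^+ 2)%:E * ((d ^+ 2)%:E * I2 mu f))%E.
    by apply: le_trans hM2 _; rewrite lee_wpmul2l.
  rewrite -ff -!EFinM lee_fin mulrA -exprMn => h.
  have r1 : 0 <= fine (I2 mu f) by rewrite fine_ge0// I2_ge0.
  have Md : (M * d) ^+ 2 < 1.
    rewrite -real_normK ?num_real// expr_lt1 ?normr_ge0// normrM (gtr0_norm d0).
    by rewrite /d ltr_pdivrMr ?mul1r ?ltrDl// ltr_wpDl.
  congr (_%:E); apply: le_anti; rewrite r1 andbT.
  move: (fine _) h r1 => u h r1.
  have : 0 <= (1 - (M * d) ^+ 2) by rewrite subr_ge0 ltW.
  move=> v0; rewrite leNgt; apply/negP => u0; have := ltr_pM2r u0 ((M * d) ^+ 2) 1.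
  by rewrite Md mul1r ltNge h.
have /packet_neq0 := I2_eq0 mf f0.
move=> /(_ c0 lo_gt hi_lt) lohi.
have := t_supp `]lo, hi[%classic (@interval_open R (BRight lo) (BLeft hi) isT isT) ltac:(by rewrite /= in_itv/= lt_ th).
by rewrite lohi ltxx.
Qed.

End approximate_eigenvalues.

(** * The spectrum *)

Section spectral.
Context {R : realType} (q : R).
Local Notation T := (measurableTypeR R).
Variable mu : {measure set T -> \bar R}.
Hypotheses (q_gt0 : 0 < q) (q_lt1 : q < 1) (Hmu : qscaling q mu).
Local Notation Q := (q%:C).
Local Notation Lstar := (adjoint mu (Lop mu q)).
Local Notation cont := (closure (\bigcup_(l in [set: int]) Omega_tilde mu q l)).
Implicit Types (x : R) (f h : R -> R[i]) (lam : R[i]).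

Let q_ge0 : 0 <= q. Proof. exact: ltW. Qed.
Let q_neq0 : q != 0. Proof. by rewrite gt_eqF. Qed.
Let Qn0 : Q != 0. Proof. exact: Q_neq0. Qed.
Let C0 x : x != 0 -> x%:C != 0 :> R[i].
Proof. by apply: contra => /eqP[] /eqP. Qed.
Let ae_pos : {ae mu, forall x, 0 < x}. Proof. by case: Hmu. Qed.

(** Null sets are preserved by scaling. *)
Lemma msupport_scale x (i : int) : msupport mu x -> msupport mu (x * q ^ i).
Proof.
move=> sx U oU Ux; rewrite lt0e measure_ge0 andbT; apply/eqP => U0.
have aeU : {ae mu, forall y : T, ~ U y}.
  exists U; split => //; first exact: open_measurable.
  by move=> y /= /contrapT.
pose V : set R := (fun y => y * q ^ i) @^-1` U.
have oV : open V by apply: open_comp => // y _; exact: mulrr_continuous.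
have [N [mN N0 hN]] := ae_orbit q_gt0 Hmu aeU.
have : (mu V <= mu N)%E.
  apply: le_measure; rewrite ?inE//; first exact: open_measurable.
  by move=> y Vy; apply: hN => /= /(_ i).
by rewrite N0 leNgt sx.
Qed.

Lemma Omega_tilde_orbit x : 0 < x -> msupport mu x -> forall i : int,
  (\bigcup_(l in [set: int]) Omega_tilde mu q l) (- (x * q ^ i)^-1).
Proof.
move=> x0 sx i; exists (- (i + qlog q x)) => //; exists (base q x).
  split; last by rewrite /base; exact: msupport_scale.
  by rewrite /= in_itv/=; exact: base_itv.
have -> : x * q ^ i = base q x * q ^ (i + qlog q x).
  by rewrite {1}(baseE q_gt0 x0) -mulrA -expfzDr// addrC.
by rewrite [in RHS]invfM invr_expz [in RHS]mulrC.
Qed.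

Lemma cont_le0 x : cont x -> x <= 0.
Proof.
move=> cx; have : closure [set y : R | y <= 0] x.
  apply: closure_subset cx => y [l _ [t [/= ht _] <-]].
  have t0 : 0 < t by move: ht; rewrite in_itv/= => /andP[+ _]; apply: lt_trans.
  by rewrite oppr_le0 divr_ge0 ?exprz_ge0// ltW.
by rewrite -(closure_id _).1//; exact: closed_le.
Qed.

(** The points [- 1 / (x q^i)] tend to 0 as [i] tends to minus infinity, for a
    single [x] in the support. *)
Lemma cont0 : mu [set: T] <> 0%E -> cont 0.
Proof.
move=> mu0.
have [x [x0 sx]] : exists x, 0 < x /\ msupport mu x.
  apply: contrapT => h; apply: mu0; apply: ae_false.
  apply: (ae2 _ ae_pos (mu_support mu)) => x x0 sx; apply: h; by exists x.
move=> U /nbhs_ballP[e e0 eU].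
have [d hd] := @qexp_small R q q_gt0 q_lt1 (e * x) ltac:(by rewrite mulr_gt0).
exists (- (x * q ^ (- d%:Z))^-1); split; first exact: Omega_tilde_orbit.
apply: eU; rewrite /ball/= sub0r opprK gtr0_norm; last by rewrite invr_gt0 mulr_gt0 ?exprz_gt0.
by rewrite -exprnN invfM invrK mulrC ltr_pdivrMr.
Qed.

(** A negative number is [- 1 / u], and [u] lies on the orbit of a point of
    [(q, 1]]. *)
Lemma cont_full : Omega mu q = `]q, 1]%classic -> mu [set: T] <> 0%E ->
  cont = `]-oo, 0]%classic.
Proof.
move=> Om mu0; apply/seteqP; split => x; first by rewrite /= in_itv/=; exact: cont_le0.
rewrite /= in_itv/= le_eqVlt => /orP[/eqP->|x0]; first exact: cont0.
apply: subset_closure; have u0 : 0 < (- x)^-1 by rewrite invr_gt0 oppr_gt0.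
exists (- qlog q (- x)^-1) => //; exists (base q (- x)^-1).
  by rewrite Om /= in_itv/=; exact: base_itv.
rewrite -[RHS]opprK -[X in _ = - X]invrK; move: (- x)^-1 u0 => u u0.
by rewrite [in RHS](baseE q_gt0 u0) [in RHS]invfM invr_expz [in RHS]mulrC.
Qed.

(** Off the real line the distance is at least the imaginary part. *)
Lemma cont_gap lam : ~ [set x%:C | x in cont] lam ->
  exists2 d, 0 < d & forall x, (\bigcup_(l in [set: int]) Omega_tilde mu q l) x ->
    d <= normc (lam - x%:C).
Proof.
case: lam => r s nc; have [s0|s0] := eqVneq s 0; last first.
  exists `|s|; first by rewrite normr_gt0.
  move=> x _; have := Im_le_normc (r +i* s - x%:C).
  by rewrite /= subr0.
have nr : ~ cont r.
  by move=> cr; apply: nc; exists r => //; rewrite s0.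
have [e e0 he] : exists2 e, 0 < e & forall x,
    (\bigcup_(l in [set: int]) Omega_tilde mu q l) x -> e <= `|r - x|.
  apply: contrapT => h; apply: nr => U /nbhs_ballP[e e0 eU].
  apply: contrapT => hU; apply: h; exists e => // x Bx; rewrite leNgt; apply/negP => xe.
  by apply: hU; exists x; split => //; apply: eU.
exists e => // x /he; move/le_trans; apply.
by have := Re_le_normc (r +i* s - x%:C).
Qed.

Lemma qpow_neq lam : ~ [set x%:C | x in [set q ^+ n | n in [set: nat]]] lam ->
  lam != 0 -> forall i, lam^-1 * Q ^+ i != 1.
Proof.
move=> nq l0 i; apply/eqP => e; apply: nq; exists (q ^+ i); first by exists i.
by rewrite -QE -[LHS](mulKf (invr_neq0 l0)) e invrK mulr1.
Qed.

(** Off the closure there is a uniform gap, so the Green operator is bounded on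
    the whole space; injectivity is [eigen_eq0], and it also transfers the bound
    from the Green operator to all of the domain. *)
Lemma off_spectrum lam : mu [set: T] <> 0%E ->
  ~ [set x%:C | x in [set q ^+ n | n in [set: nat]] `|` cont] lam ->
  resolvent_set mu Lstar lam.
Proof.
move=> mu0 nl.
have nq : ~ [set x%:C | x in [set q ^+ n | n in [set: nat]]] lam.
  by move=> [x hx e]; apply: nl; exists x => //; left.
have nc : ~ [set x%:C | x in cont] lam.
  by move=> [x hx e]; apply: nl; exists x => //; right.
have l0 : lam != 0.
  by apply/eqP => l0; apply: nc; exists 0; [exact: cont0|rewrite l0].
have lQ := qpow_neq nq l0.
have [d d0 hd] := cont_gap nc.
pose e := Num.min 3^-1 (d / (3 * normc lam)).
have e0 : 0 < e by rewrite lt_min invr_gt0 ltr0n/= divr_gt0// mulr_gt0// normc_gt0.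
have e1 : e <= 1 by rewrite ge_min invf_le1// ler1n.
pose P x : bool := (0 < x) && `[< away q e (lam * x%:C) >].
have mP : measurable_fun [set: T] P.
  by apply: measurable_and; [exact: measurable_fun_ltr|exact: measurable_away].
have aeP : {ae mu, forall x, P x}.
  apply: (ae2 _ ae_pos (mu_support mu)) => x x0 sx; rewrite /P x0/=; apply/asboolP.
  apply: away_of_gap => // i.
  by have := hd _ (Omega_tilde_orbit x0 sx i); rewrite rmorphN opprK.
pose cut h x := if P x then h x else 0.
have mcut h : mC h -> mC (cut h) by move=> mh; apply: mC_if => //; exact: mC_cst.
have cutE h : eqL2 mu (cut h) h by apply: (ae_sub _ aeP) => x; rewrite /cut => ->.
have Lcut h : L2 mu h -> L2 mu (cut h).
  by move=> Lh; apply: L2_ae (cutE h) => //; apply: mcut; exact: L2_mC Lh.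
have gcut h x : cut h x != 0 -> 0 < x /\ away q e (lam * x%:C).
  by rewrite /cut /P; case: ifP => [/andP[x0 /asboolP]|]; rewrite ?eqxx.
have [M M0 hM] := green_resolvent q_gt0 q_lt1 Hmu l0 lQ e0 e1.
split.
- move=> f g /adjointP[]// Lf Lg gf hz; apply: (eigen_eq0 q_gt0 q_lt1 Hmu l0 lQ Lf).
  apply: (ae2 _ gf hz) => x <- /eqP; by rewrite subr_eq0 => /eqP.
- move=> h Lh; split => //.
  have [_ [f [g [fg hfg]]]] := resolvent_range q_gt0 q_lt1 Hmu l0 lQ e0 e1 (Lcut h Lh) (gcut h).
  exists f, g; split => //.
  by apply: (ae2 _ (cutE h) hfg) => x <-.
- exists M => f g /adjointP[]// Lf Lg gf.
  pose k x := g x - lam * f x.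
  have Lk : L2 mu k by apply: L2B => //; exact: L2Z.
  have [Lr Ir er] := hM _ (Lcut k Lk) (gcut k).
  set r := green q lam (cut k) in Lr Ir er.
  have fr : eqL2 mu f r.
    have ker : eqL2 mu (qdiff q (fun x => f x - r x)) (fun x => lam * (f x - r x)).
      apply: (ae2 _ gf (ae2 (fun x => @conj _ _) (cutE k) er)) => x gx [ck rx].
      have : qdiff q r x = k x + lam * r x by rewrite -ck rx subrK.
      rewrite /k gx /qdiff => e2.
      rewrite -[RHS](_ : qdiff q f x - qdiff q r x = _); first by rewrite /qdiff; ring.
      by rewrite /qdiff e2; ring.
    have fr0 := eigen_eq0 q_gt0 q_lt1 Hmu l0 lQ (L2B Lf Lr) ker.
    by apply: (ae_sub _ fr0) => x /eqP; rewrite subr_eq0 => /eqP.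
  apply: normL2_le => //; rewrite (eq_I2 (L2_mC Lf) (L2_mC Lr) fr).
  apply: le_trans Ir _; rewrite (eq_I2 (mcut _ (L2_mC Lk)) (L2_mC Lk) (cutE k))//.
Qed.

Lemma qpow_eigenvalue n : mu [set: T] <> 0%E -> point_spectrum mu Lstar (q ^+ n)%:C.
Proof.
move=> mu0; have [f fE ffree] := eigenspace_infinite q_gt0 q_lt1 Hmu n mu0 1%N.
exists (f ord0) => // f0; have : (1 : R[i]) = 0.
  apply: (ffree (fun=> 1) _ ord0).
  by apply: (ae_sub _ f0) => x fx; rewrite big_ord1 fx mulr0.
by move/eqP; rewrite oner_eq0.
Qed.

Lemma point_spectrum_qpow lam : point_spectrum mu Lstar lam ->
  [set x%:C | x in [set q ^+ n | n in [set: nat]]] lam.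
Proof.
move=> [f fA fn0]; apply: contrapT => nq; apply: fn0.
have [l0|l0] := eqVneq lam 0.
  apply: (kernel0 q_gt0 q_lt1 Hmu fA); apply: aeW => x /=; by rewrite l0 mul0r.
move/adjointP: fA => []// Lf _ fe; apply: (eigen_eq0 q_gt0 q_lt1 Hmu l0 (qpow_neq nq l0) Lf).
by apply: (ae_sub _ fe) => x ->.
Qed.

Lemma point_spectrum_sub lam : point_spectrum mu Lstar lam -> spectrum mu Lstar lam.
Proof.
move=> [f fA fn0] [inj _ _]; apply: fn0; apply: inj fA _.
by apply: aeW => x; rewrite subrr.
Qed.

Lemma spectral : mu [set: T] <> 0%E ->
  let qpowers : set R := [set q ^+ n | n in [set: nat]] in
  let toC (S : set R) : set R[i] := [set x%:C | x in S] in
  [/\ point_spectrum mu Lstar = toC qpowers,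
      continuous_spectrum mu Lstar = toC cont &
      spectrum mu Lstar = toC (qpowers `|` cont)].
Proof.
move=> mu0 qpowers toC.
have ps : point_spectrum mu Lstar = toC qpowers.
  apply/seteqP; split => lam; first exact: point_spectrum_qpow.
  by move=> [_ [n _ <-] <-]; exact: qpow_eigenvalue.
have sp : spectrum mu Lstar = toC (qpowers `|` cont).
  apply/seteqP; split => lam.
    by move=> h; apply: contrapT => /(off_spectrum mu0).
  move=> [x [[n _ <-]|cx] <-].
    by apply: point_spectrum_sub; exact: qpow_eigenvalue.
  exact: cont_not_resolvent.
split => //; apply/seteqP; split => lam.
  move=> [h1 h2 _]; move: h1; rewrite sp => -[x [qx|cx] xl]; last by exists x.
  by case: h2; rewrite ps; exists x.
move=> [x cx <-]; split; first by rewrite sp; exists x => //; right.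
  rewrite ps => -[_ [n _ <-] [e]]; have := cont_le0 cx.
  by rewrite -e leNgt exprn_gt0.
have [->|x0] := eqVneq x 0; first exact: range_dense0.
apply: range_dense; rewrite ?C0// => i; apply: qpow_neq; last exact: C0.
move=> [_ [n _ <-] [e]]; have := cont_le0 cx.
by rewrite -e leNgt exprn_gt0.
Qed.

End spectral.

Theorem theorem4p6 (R : realType) (q : R) (w : R -> R)
    (mu : {measure set (measurableTypeR R) -> \bar R})
    (q_gt0 : 0 < q) (q_lt1 : q < 1)
    (w_meas : measurable_fun (`]0, +oo[ : set (measurableTypeR R)) w)
    (w_ge0 : forall x : R, 0 < x -> 0 <= w x)
    (w_int : (\int[lebesgue_measure]_(x in `]0%R, +oo[) (w x)%:E < +oo)%E)
    (w_q : forall x : R, 0 < x -> w (x * q) = x * w x)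
    (mu_w : forall A : set (measurableTypeR R), measurable A ->
      mu A = (\int[lebesgue_measure]_(x in A `&` `]0%R, +oo[) (w x)%:E)%E)
    (mu_neq0 : mu [set: R] <> 0%E) :
  let Lstar := adjoint mu (Lop mu q) in
  let qpowers : set R := [set q ^+ n | n in [set: nat]] in
  let cont : set R := closure (\bigcup_(l in [set: int]) Omega_tilde mu q l) in
  let toC (S : set R) : set R[i] := [set x%:C | x in S] in
  [/\ point_spectrum mu Lstar = toC qpowers,
      forall n : nat, infinite_dimL2 mu (op_eigenspace Lstar (q ^+ n)%:C),
      continuous_spectrum mu Lstar = toC cont,
      spectrum mu Lstar = toC (qpowers `|` cont) &
      Omega mu q = `]q, 1]%classic ->
        spectrum mu Lstar = toC (`]-oo, 0]%classic `|` qpowers)].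
Proof.
move=> Lstar qpowers cont toC.
have Hmu := qscaling_density q_gt0 w_meas w_ge0 w_int w_q mu_w.
have [ps cs sp] := spectral q_gt0 q_lt1 Hmu mu_neq0.
split=> // [n|Om]; first exact: eigenspace_infinite.
by rewrite sp -/qpowers -(cont_full q_gt0 q_lt1 Hmu Om mu_neq0) setUC.
Qed.
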